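(* Let $0<\alpha\le 1$. (i) (Bilinearity) The map $(f,g)\mapsto D_\xi^\alpha f\cdot g$ is bilinear on $\mathcal{S}(\mathbb{R})\times\mathcal{S}(\mathbb{R})$. (ii) (Skew-symmetry and diagonal vanishing) $D_\xi^\alpha f\cdot g=-D_\xi^\alpha g\cdot f$ and $D_\xi^\alpha f\cdot f=0$ for all $f,g\in\mathcal{S}(\mathbb{R})$. (iii) (Sobolev continuity) If $s>\tfrac12$, then there is a constant $C(s,\alpha)$, depending only on $s$ and $\alpha$, such that $$\|D_\xi^\alpha f\cdot g\|_{H^{s-\alpha}}\le C(s,\alpha)\,\|f\|_{H^s}\,\|g\|_{H^s}\qquad\text{for all } f,g\in H^s(\mathbb{R}).$$ (iv) (Classical limit) If $s>\tfrac12$ and $f,g\in H^s(\mathbb{R})$, then $$D_\xi^\alpha f\cdot g\to D_\xi f\cdot g\quad\text{in } H^{s-1}(\mathbb{R})\text{ as }\alpha\to1^-,$$ where $D_\xi f\cdot g=(\partial_\xi f)\,g-f\,(\partial_\xi g)$ is the classical first-order Hirota derivative.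
   Context: Fourier transform convention: $\widehat{f}(k)=\int_{\mathbb{R}} f(\xi)e^{-ik\xi}\,d\xi$, extended to tempered distributions. For $s\in\mathbb{R}$, $H^s(\mathbb{R})$ is the $L^2$-based Sobolev space with norm $\|f\|_{H^s}^2=\frac{1}{2\pi}\int_{\mathbb{R}}(1+|k|^2)^s|\widehat f(k)|^2\,dk$. For $0<\alpha\le1$ the spectral fractional derivative $D_\xi^\alpha f$ of a single function or distribution $f$ is defined by $\widehat{D_\xi^\alpha f}(k)=(ik)^\alpha\widehat f(k)$, where $(ik)^\alpha$ is the principal branch (with $0^\alpha=0$); it maps $H^s(\mathbb{R})$ boundedly to $H^{s-\alpha}(\mathbb{R})$. The spectral fractional Hirota bilinear operator is defined by $$D_\xi^\alpha f\cdot g:=(D_\xi^\alpha f)\,g-f\,(D_\xi^\alpha g).$$ Here $D_\xi^\alpha f\cdot g$ always denotes this bilinear operator applied to the pair $(f,g)$, not the product of $D_\xi^\alpha f$ with $g$. For $f,g\in H^s(\mathbb{R})$ with $s>\tfrac12$, the products of an element of $H^{s-\alpha}(\mathbb{R})$ with an element of $H^s(\mathbb{R})$ on the right-hand side are understood via the continuous extension of pointwise multiplication to $H^{s-\alpha}(\mathbb{R})\times H^s(\mathbb{R})\to H^{s-\alpha}(\mathbb{R})$ from Schwartz functions. *)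

(* Defs.v *)
From mathcomp Require Import all_boot all_order all_algebra.
From mathcomp Require Import all_classical all_reals all_analysis.
From mathcomp.real_closed Require Export complex.
Import Order.TTheory GRing.Theory Num.Theory ComplexField.Normc.
Import numFieldNormedType.Exports.

Set Implicit Arguments.
Unset Strict Implicit.
Unset Printing Implicit Defensive.

Local Open Scope classical_set_scope.
Local Open Scope ring_scope.
Local Open Scope complex_scope.

(* The projections of [R[i]], not [Num.Re] and [Num.Im]. *)
Local Notation Re := complex.Re.
Local Notation Im := complex.Im.

Definition expi (R : realType) (t : R) : R[i] := cos t +i* sin t.

(* Principal argument, in ]-pi, pi]; meaningful for z != 0. *)
Definition carg (R : realType) (z : R[i]) : R :=
  let t := acos (Re z / normc z) in if 0 <= Im z then t else - t.

(* Principal branch of z ^ a, with 0 ^ a = 0 for every a. *)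
Definition cpow (R : realType) (z : R[i]) (a : R) : R[i] :=
  if z == 0 then 0 else (normc z `^ a)%:C * expi (a * carg z).

Definition cmeasurable (R : realType) (f : R -> R[i]) : Prop :=
  measurable_fun setT (fun x => Re (f x)) /\
  measurable_fun setT (fun x => Im (f x)).

Definition cintegrable (R : realType) (f : R -> R[i]) : Prop :=
  lebesgue_measure.-integrable setT (fun x => (Re (f x))%:E) /\
  lebesgue_measure.-integrable setT (fun x => (Im (f x))%:E).

Definition cintegral (R : realType) (f : R -> R[i]) : R[i] :=
  (\int[lebesgue_measure]_x Re (f x)) +i* (\int[lebesgue_measure]_x Im (f x)).

Definition cderiven (R : realType) (n : nat) (f : R -> R[i]) : R -> R[i] :=
  fun x => (derive1n n (fun y => Re (f y)) x) +i*
           (derive1n n (fun y => Im (f y)) x).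

Definition csmooth (R : realType) (f : R -> R[i]) : Prop :=
  forall (n : nat) (x : R), derivable (derive1n n (fun y => Re (f y))) x 1 /\
                            derivable (derive1n n (fun y => Im (f y))) x 1.

Definition schwartz_values (R : realType) (m n : nat) (f : R -> R[i]) : set R :=
  range (fun x : R => `|x| ^+ m * normc (cderiven n f x)).

Definition schwartz (R : realType) (f : R -> R[i]) : Prop :=
  csmooth f /\ forall m n : nat, has_ubound (schwartz_values m n f).

Definition schwartz_seminorm (R : realType) (m n : nat) (f : R -> R[i]) : R :=
  sup (schwartz_values m n f).

Definition fourier (R : realType) (f : R -> R[i]) : R -> R[i] :=
  fun k => cintegral (fun x => f x * expi (- (k * x))).

Definition ifourier (R : realType) (F : R -> R[i]) : R -> R[i] :=
  fun x => ((2 * pi)^-1)%:C * cintegral (fun k => F k * expi (k * x)).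

(* Distributions are represented by functionals on all functions R -> R[i], but
   only their values on Schwartz functions carry information: [T] and [U]
   denote the same distribution when [eq_distr T U]. *)
Definition functional (R : realType) := (R -> R[i]) -> R[i].

Definition eq_distr (R : realType) (T U : functional R) : Prop :=
  forall phi, schwartz phi -> T phi = U phi.

Definition tempered (R : realType) (T : functional R) : Prop :=
  (forall (c : R[i]) (phi psi : R -> R[i]), schwartz phi -> schwartz psi ->
     T (fun x => c * phi x + psi x) = c * T phi + T psi) /\
  (exists (C : R) (N : nat), forall phi : R -> R[i], schwartz phi ->
     normc (T phi) <=
       C * \sum_(m < N) \sum_(n < N) schwartz_seminorm m n phi).

Definition distr_of_fun (R : realType) (F : R -> R[i]) : functional R :=
  fun phi => cintegral (fun x => F x * phi x).

Definition distr_sub (R : realType) (T U : functional R) : functional R :=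
  fun phi => T phi - U phi.

Definition distr_deriv (R : realType) (T : functional R) : functional R :=
  fun phi => - T (cderiven 1 phi).

Definition distr_fourier (R : realType) (T : functional R) : functional R :=
  fun phi => T (fourier phi).

Definition distr_ifourier (R : realType) (T : functional R) : functional R :=
  fun phi => T (ifourier phi).

Definition represents (R : realType) (F : R -> R[i]) (T : functional R) : Prop :=
  [/\ cmeasurable F,
      forall phi, schwartz phi -> cintegrable (fun x => F x * phi x) &
      eq_distr T (distr_of_fun F)].

(* The Fourier transform of [T] as a function, unique up to a null set;
   meaningful when [distr_fourier T] is represented by a function. *)
Definition fourier_density (R : realType) (T : functional R) : R -> R[i] :=
  xget (fun=> 0) [set F | represents F (distr_fourier T)].

(* The H^s norm, with value +oo outside H^s. *)
Definition sobolev_norm (R : realType) (s : R) (T : functional R) : \bar R :=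
  if `[< tempered T /\ exists F, represents F (distr_fourier T) >]
  then ((((2 * pi)^-1)%:E *
         \int[lebesgue_measure]_k
            ((1 + k ^+ 2) `^ s * normc (fourier_density T k) ^+ 2)%:E)
          `^ 2^-1)%E
  else +oo%E.

Definition sobolev (R : realType) (s : R) : set (functional R) :=
  [set T | (sobolev_norm s T < +oo)%E].

(* [M] is the continuous extension to H^t x H^s -> H^t of the pointwise
   multiplication of Schwartz functions. *)
Definition mul_extension (R : realType) (t s : R)
    (M : functional R -> functional R -> functional R) : Prop :=
  [/\ forall u v, sobolev t u -> sobolev s v -> sobolev t (M u v),
      forall phi psi, schwartz phi -> schwartz psi ->
        eq_distr (M (distr_of_fun phi) (distr_of_fun psi))
                 (distr_of_fun (fun x => phi x * psi x)) &
      forall u v, sobolev t u -> sobolev s v ->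
        forall e : R, 0 < e -> exists2 d : R, 0 < d &
          forall u' v', sobolev t u' -> sobolev s v' ->
            (sobolev_norm t (distr_sub u' u) < d%:E)%E ->
            (sobolev_norm s (distr_sub v' v) < d%:E)%E ->
            (sobolev_norm t (distr_sub (M u' v') (M u v)) < e%:E)%E].

(* The spectral fractional derivative of a function and of a distribution whose
   Fourier transform is a function: F^-1 ((ik)^a F f) in both cases. *)
Definition fun_fracD (R : realType) (a : R) (f : R -> R[i]) : R -> R[i] :=
  ifourier (fun k => cpow (0 +i* k) a * fourier f k).

Definition distr_fracD (R : realType) (a : R) (T : functional R) :
    functional R :=
  distr_ifourier
    (distr_of_fun (fun k => cpow (0 +i* k) a * fourier_density T k)).

Definition fun_hirota (R : realType) (a : R) (f g : R -> R[i]) : R -> R[i] :=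
  fun x => fun_fracD a f x * g x - f x * fun_fracD a g x.

(* The bilinear operator (D f) g - f (D g) on H^s x H^s, for an operator [D]
   from H^s to H^t. If the multiplication had no continuous extension to
   H^t x H^s, the value would be a nonlinear functional, of infinite Sobolev
   norm, so that a norm bound on [distr_hirota] entails that it is defined. *)
Definition distr_hirota (R : realType) (t s : R)
    (D : functional R -> functional R) (f g : functional R) : functional R :=
  xget (fun=> 1)
    [set h | exists2 M, mul_extension t s M &
                        h = distr_sub (M (D f) g) (M (D g) f)].

Definition frac_hirota (R : realType) (s a : R) (f g : functional R) :
    functional R :=
  distr_hirota (s - a) s (distr_fracD a) f g.

Definition classical_hirota (R : realType) (s : R) (f g : functional R) :
    functional R :=
  distr_hirota (s - 1) s (@distr_deriv R) f g.

(* Main.v *)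
(** A distribution in [H^s] is identified with the density of its Fourier
transform, an element of [L^2((1 + k^2)^s dk)]. On densities, the fractional
derivative is multiplication by [(ik)^a] and the product of functions becomes
[(2 pi)^-1] times convolution. Peetre's inequality and the Cauchy-Schwarz
inequality bound the [H^t] norm of a convolution by the [H^t] norm of one factor
times the [H^s] norm of the other when [s > 1/2] and [-s <= t <= s]. Hence
convolution of densities is a continuous multiplication [H^t x H^s -> H^t]
extending that of Schwartz functions, and it is the only one because Schwartz
functions are dense. So the Hirota operator has an explicit density: (iii) is the
convolution bound combined with [|(ik)^a| <= (1 + k^2)^(a/2)], and (iv) is the same
bound for the symbol [(ik)^a - ik], whose effect on a fixed density tends to [0] by
dominated convergence. *)

(* [distr_hirota] picks an unspecified multiplication among those satisfying [mul_extension], and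
   [fourier_density] picks an unspecified density. Nothing can be computed until both choices are
   shown to be immaterial: densities are unique almost everywhere, by a du Bois-Reymond argument
   with Schwartz tests, and every admissible multiplication has the same convolution as density. An
   admissible multiplication must also be exhibited, since otherwise the default value of [xget]
   would intervene. Gaussians serve three times: as summability kernel for Fourier inversion, as
   tests for uniqueness of densities, and as mollifiers for density of Schwartz functions. The
   condition s > 1/2 acts twice: it makes (1 + k^2)^(-s) integrable, and for a <= 1 it gives s - a
   >= -s, so that the possibly negative order s - a stays in the range of the convolution bound.
   Estimates are made on squared norms, whence the factors 2 and 4 and the splittings of e into
   quarters. *)
Require Import Defs.
From mathcomp Require Import all_boot all_order all_algebra.
From mathcomp Require Import ring lra.
From mathcomp Require Import all_classical all_reals all_analysis.
From mathcomp Require Import measurable_realfun lebesgue_integral_under.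
Import Order.TTheory GRing.Theory Num.Theory ComplexField.Normc.
Import numFieldNormedType.Exports.

Set Implicit Arguments.
Unset Strict Implicit.
Unset Printing Implicit Defensive.

Local Open Scope classical_set_scope.
Local Open Scope ring_scope.
Local Open Scope complex_scope.

Local Notation Re := complex.Re.
Local Notation Im := complex.Im.
Local Notation mu := (@lebesgue_measure _).

(** * Complex-valued integration *)

Section complex_numbers.
Context {R : realType}.
Implicit Types x y z : R[i].

Lemma complex_eqP x y : Re x = Re y -> Im x = Im y -> x = y.
Proof. by case: x => a b; case: y => c d /= -> ->. Qed.

Lemma cReM x y : Re (x * y) = Re x * Re y - Im x * Im y.
Proof. by case: x; case: y. Qed.

Lemma cImM x y : Im (x * y) = Re x * Im y + Im x * Re y.
Proof. by case: x => a b; case: y. Qed.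

Lemma cReD x y : Re (x + y) = Re x + Re y. Proof. by case: x; case: y. Qed.
Lemma cImD x y : Im (x + y) = Im x + Im y. Proof. by case: x; case: y. Qed.
Lemma cReN x : Re (- x) = - Re x. Proof. by case: x. Qed.
Lemma cImN x : Im (- x) = - Im x. Proof. by case: x. Qed.
Lemma cReB x y : Re (x - y) = Re x - Re y. Proof. by rewrite cReD cReN. Qed.
Lemma cImB x y : Im (x - y) = Im x - Im y. Proof. by rewrite cImD cImN. Qed.

Lemma normcE x : normc x = Num.sqrt (Re x ^+ 2 + Im x ^+ 2).
Proof. by case: x. Qed.

Lemma normc_ge0 x : 0 <= normc x.
Proof. by rewrite normcE sqrtr_ge0. Qed.

Lemma sqr_normcE x : normc x ^+ 2 = Re x ^+ 2 + Im x ^+ 2.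
Proof. by rewrite normcE sqr_sqrtr// addr_ge0// sqr_ge0. Qed.

Lemma ler_Re_normc x : `|Re x| <= normc x.
Proof.
rewrite -(ler_pXn2r (_ : (0 < 2)%N))// ?nnegrE ?normc_ge0// sqr_normcE.
by rewrite real_normK ?num_real// lerDl sqr_ge0.
Qed.

Lemma ler_Im_normc x : `|Im x| <= normc x.
Proof.
rewrite -(ler_pXn2r (_ : (0 < 2)%N))// ?nnegrE ?normc_ge0// sqr_normcE.
by rewrite real_normK ?num_real// lerDr sqr_ge0.
Qed.

Lemma ler_normc_ReIm x : normc x <= `|Re x| + `|Im x|.
Proof.
rewrite -(ler_pXn2r (_ : (0 < 2)%N))// ?nnegrE ?normc_ge0 ?addr_ge0//.
rewrite sqr_normcE sqrrD !real_normK ?num_real//.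
by rewrite lerD2r lerDl mulrn_wge0// mulr_ge0.
Qed.

Lemma ler_normcD x y : normc (x + y) <= normc x + normc y.
Proof. exact: le_normcD. Qed.

Lemma ler_normcB x y : normc (x - y) <= normc x + normc y.
Proof. by rewrite (le_trans (le_normcD _ _))// normcN. Qed.

Lemma normc_real (a : R) : normc a%:C = `|a|.
Proof. by rewrite normcE /= expr0n addr0 sqrtr_sqr. Qed.

Lemma normc_imag (a : R) : normc (0 +i* a) = `|a|.
Proof. by rewrite normcE /= expr0n add0r sqrtr_sqr. Qed.

Lemma normc_expi (t : R) : normc (expi t) = 1.
Proof. by rewrite normcE /= cos2Dsin2 sqrtr1. Qed.

Lemma expiD (s t : R) : expi (s + t) = expi s * expi t.
Proof.
by apply: complex_eqP; rewrite ?cReM ?cImM /= ?cosD ?sinD// addrC mulrC [X in _ + X]mulrC.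
Qed.

Lemma expi0 : expi 0 = 1 :> R[i].
Proof. by apply: complex_eqP; rewrite /= ?cos0 ?sin0. Qed.

Lemma realCM (a b : R) : (a * b)%:C = a%:C * b%:C.
Proof. by rewrite rmorphM. Qed.

Lemma realCV (a : R) : a != 0 -> (a^-1)%:C * a%:C = 1.
Proof. by move=> a0; rewrite -realCM mulVf. Qed.

End complex_numbers.

Section complex_measurable.
Context {R : realType} d (T : measurableType d).
Implicit Types f g : T -> R[i].

(* [cmeasurable] over an arbitrary measurable space, as needed on products. *)
Definition cmeas f : Prop :=
  measurable_fun setT (fun x => Re (f x)) /\
  measurable_fun setT (fun x => Im (f x)).

Lemma cmeas_cst (c : R[i]) : cmeas (fun=> c).
Proof. by split; exact: measurable_cst. Qed.

Lemma cmeas_real (f : T -> R) : measurable_fun setT f -> cmeas (fun x => (f x)%:C).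
Proof. by move=> mf; split => //=; exact: measurable_cst. Qed.

Lemma cmeas_imag (f : T -> R) : measurable_fun setT f -> cmeas (fun x => 0 +i* f x).
Proof. by move=> mf; split => //=; exact: measurable_cst. Qed.

Lemma cmeasD f g : cmeas f -> cmeas g -> cmeas (fun x => f x + g x).
Proof.
move=> [f1 f2] [g1 g2]; split.
- by under eq_fun do rewrite cReD; exact: measurable_funD.
- by under eq_fun do rewrite cImD; exact: measurable_funD.
Qed.

Lemma cmeasN f : cmeas f -> cmeas (fun x => - f x).
Proof.
move=> [f1 f2]; split.
- by under eq_fun do rewrite cReN; exact: measurable_funN.
- by under eq_fun do rewrite cImN; exact: measurable_funN.
Qed.

Lemma cmeasB f g : cmeas f -> cmeas g -> cmeas (fun x => f x - g x).
Proof. by move=> mf mg; apply: cmeasD => //; exact: cmeasN. Qed.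

Lemma cmeasM f g : cmeas f -> cmeas g -> cmeas (fun x => f x * g x).
Proof.
move=> [f1 f2] [g1 g2]; split.
- by under eq_fun do rewrite cReM; apply: measurable_funB; exact: measurable_funM.
- by under eq_fun do rewrite cImM; apply: measurable_funD; exact: measurable_funM.
Qed.

Lemma measurable_normc f : cmeas f -> measurable_fun setT (fun x => normc (f x)).
Proof.
move=> [f1 f2]; under eq_fun do rewrite normcE.
apply: (measurableT_comp (continuous_measurable_fun (@sqrt_continuous R))).
by apply: measurable_funD; exact: measurable_funX.
Qed.

Lemma cmeas_expi (f : T -> R) : measurable_fun setT f -> cmeas (fun x => expi (f x)).
Proof.
move=> mf; split => /=.
- apply: measurableT_comp mf; apply: continuous_measurable_fun; exact: continuous_cos.
- apply: measurableT_comp mf; apply: continuous_measurable_fun; exact: continuous_sin.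
Qed.

End complex_measurable.

Lemma cmeas_comp (R : realType) d d' (T : measurableType d) (T' : measurableType d')
    (f : T -> R[i]) (g : T' -> T) :
  measurable_fun setT g -> cmeas f -> cmeas (fun x => f (g x)).
Proof.
by move=> mg [f1 f2]; split;
  [exact: (measurableT_comp f1 mg)|exact: (measurableT_comp f2 mg)].
Qed.
Section complex_integral.
Context {R : realType}.
Implicit Types f g : R -> R[i].

Lemma measurable_normcE f : cmeas f -> measurable_fun setT (fun x => (normc (f x))%:E).
Proof. by move=> mf; apply/measurable_EFinP; exact: measurable_normc. Qed.

Lemma cintegrableP f :
  cintegrable f <-> cmeas f /\ (\int[mu]_x (normc (f x))%:E < +oo)%E.
Proof.
split=> [[/integrableP[m1 i1] /integrableP[m2 i2]]|[[m1 m2] fi]].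
  move: m1 m2 => /measurable_EFinP m1 /measurable_EFinP m2.
  have mf : cmeas f by [].
  split => //; have := lte_add_pinfty i1 i2.
  rewrite -ge0_integralD//; [|by apply/measurable_EFinP; exact: measurableT_comp..].
  apply: le_lt_trans; apply: ge0_le_integral => //.
  - by move=> x _; rewrite lee_fin normc_ge0.
  - exact: measurable_normcE.
  - by apply/measurable_EFinP; apply: measurable_funD; exact: measurableT_comp.
  - by move=> x _; rewrite -EFinD lee_fin ler_normc_ReIm.
split; apply/integrableP; split; try exact/measurable_EFinP;
  apply: le_lt_trans fi; apply: ge0_le_integral => //.
- by apply/measurable_EFinP; exact: measurableT_comp.
- exact: measurable_normcE.
- by move=> x _; rewrite lee_fin ler_Re_normc.
- by apply/measurable_EFinP; exact: measurableT_comp.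
- exact: measurable_normcE.
- by move=> x _; rewrite lee_fin ler_Im_normc.
Qed.

Lemma cintegrable_cmeas f : cintegrable f -> cmeas f.
Proof. by move=> /cintegrableP[]. Qed.

Lemma cintegrable_le f (g : R -> R) : cmeas f -> (forall x, normc (f x) <= g x) ->
  mu.-integrable setT (EFin \o g) -> cintegrable f.
Proof.
move=> mf fg /integrableP[/measurable_EFinP mg ig]; apply/cintegrableP; split => //.
apply: le_lt_trans ig; apply: ge0_le_integral => //.
- by move=> x _; rewrite lee_fin normc_ge0.
- exact: measurable_normcE.
- by apply/measurable_EFinP; exact: measurableT_comp.
- by move=> x _; rewrite lee_fin (le_trans (fg x))// ler_norm.
Qed.

Lemma integrable_normc f : cintegrable f -> mu.-integrable setT (fun x => (normc (f x))%:E).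
Proof.
move=> /cintegrableP[mf fi]; apply/integrableP; split; first exact: measurable_normcE.
by under eq_integral do rewrite gee0_abs ?lee_fin ?normc_ge0//.
Qed.

Lemma cintegrableD f g : cintegrable f -> cintegrable g ->
  cintegrable (fun x => f x + g x).
Proof.
move=> intf intg; apply: (@cintegrable_le _ (fun x => normc (f x) + normc (g x))).
- by apply: cmeasD; exact: cintegrable_cmeas.
- by move=> x; exact: ler_normcD.
- have -> : EFin \o (fun x => normc (f x) + normc (g x)) =
     ((fun x => (normc (f x))%:E) \+ (fun x => (normc (g x))%:E))%E by [].
  by apply: integrableD => //; exact: integrable_normc.
Qed.

Lemma cintegrable_bounded_mul f g C : cintegrable f -> cmeas g ->
  (forall x, normc (g x) <= C) -> cintegrable (fun x => f x * g x).
Proof.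
move=> intf mg gC; apply: (@cintegrable_le _ (fun x => C * normc (f x))).
- by apply: cmeasM => //; exact: cintegrable_cmeas.
- by move=> x; rewrite normcM mulrC ler_wpM2r// normc_ge0.
- have -> : EFin \o (fun x => C * normc (f x)) = (fun x => C%:E * (normc (f x))%:E)%E.
    by apply/funext => x /=; rewrite EFinM.
  by apply: integrableZl => //; exact: integrable_normc.
Qed.

Lemma cintegrableZ (c : R[i]) f : cintegrable f -> cintegrable (fun x => c * f x).
Proof.
move=> intf; under eq_fun do rewrite mulrC.
by apply: (cintegrable_bounded_mul (C := normc c)) => //; exact: cmeas_cst.
Qed.

Lemma cintegrableN f : cintegrable f -> cintegrable (fun x => - f x).
Proof. by move=> intf; under eq_fun do rewrite -mulN1r; exact: cintegrableZ. Qed.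

Lemma cintegrableB f g : cintegrable f -> cintegrable g ->
  cintegrable (fun x => f x - g x).
Proof. by move=> ? ?; apply: cintegrableD => //; exact: cintegrableN. Qed.

Lemma cintegrable_real (f : R -> R) : mu.-integrable setT (EFin \o f) ->
  cintegrable (fun x => (f x)%:C).
Proof. by move=> intf; split => //=; exact: integrable0. Qed.

Lemma eq_cintegral f g : f =1 g -> cintegral f = cintegral g.
Proof. by move=> /funext ->. Qed.

Lemma cintegralD f g : cintegrable f -> cintegrable g ->
  cintegral (fun x => f x + g x) = cintegral f + cintegral g.
Proof.
move=> [f1 f2] [g1 g2]; apply: complex_eqP; rewrite ?cReD ?cImD /=.
- by under eq_Rintegral do rewrite cReD; rewrite RintegralD.
- by under eq_Rintegral do rewrite cImD; rewrite RintegralD.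
Qed.

Lemma cintegralZ (c : R[i]) f : cintegrable f ->
  cintegral (fun x => c * f x) = c * cintegral f.
Proof.
move=> [f1 f2]; apply: complex_eqP; rewrite ?cReM ?cImM /=.
- under eq_Rintegral do rewrite cReM.
  rewrite RintegralB ?RintegralZl//; first exact: (integrableZl _ (Re c) f1).
  exact: (integrableZl _ (Im c) f2).
- under eq_Rintegral do rewrite cImM.
  rewrite RintegralD ?RintegralZl//; first exact: (integrableZl _ (Re c) f2).
  exact: (integrableZl _ (Im c) f1).
Qed.

Lemma cintegralN f : cintegrable f -> cintegral (fun x => - f x) = - cintegral f.
Proof.
by move=> intf; under eq_cintegral do rewrite -mulN1r; rewrite cintegralZ// mulN1r.
Qed.

Lemma cintegralB f g : cintegrable f -> cintegrable g ->
  cintegral (fun x => f x - g x) = cintegral f - cintegral g.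
Proof.
by move=> intf intg; rewrite cintegralD ?cintegralN//; exact: cintegrableN.
Qed.

Lemma cintegral_real (f : R -> R) :
  cintegral (fun x => (f x)%:C) = (\int[mu]_x f x)%:C.
Proof. by apply: complex_eqP => //=; rewrite Rintegral_cst// mul0r. Qed.

(* The constant 2, instead of 1, avoids rotating the integral. *)
Lemma le_normc_cintegral f : cmeas f ->
  ((normc (cintegral f))%:E <= 2%:E * \int[mu]_x (normc (f x))%:E)%E.
Proof.
move=> mf.
have I0 : (0 <= \int[mu]_x (normc (f x))%:E)%E.
  by apply: integral_ge0 => x _; rewrite lee_fin normc_ge0.
have [fi|] := ltP (\int[mu]_x (normc (f x))%:E)%E +oo%E; last first.
  by rewrite leye_eq => /eqP ->; rewrite gt0_muley// leey.
have [i1 i2] : cintegrable f by apply/cintegrableP.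
have fin : (\int[mu]_x (normc (f x))%:E)%E \is a fin_num by rewrite ge0_fin_numE.
rewrite -(fineK fin) -EFinM lee_fin mulr_natl mulr2n.
have bound (g : R -> R) : mu.-integrable setT (EFin \o g) ->
    (forall x, `|g x| <= normc (f x)) ->
    `|\int[mu]_x g x| <= fine (\int[mu]_x (normc (f x))%:E)%E.
  move=> ig gf; apply: le_trans (le_normr_Rintegral _ ig) _ => //; apply: fine_le => //.
    exact: integrable_fin_num (integrable_abse ig).
  apply: ge0_le_integral => //.
  - have /measurable_EFinP mg := measurable_int _ ig.
    by apply/measurable_EFinP; exact: measurableT_comp.
  - exact: measurable_normcE.
  - by move=> x _; rewrite lee_fin.
rewrite (le_trans (ler_normc_ReIm _))//= lerD//; apply: bound => // x.
- exact: ler_Re_normc.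
- exact: ler_Im_normc.
Qed.

Lemma normc_cintegral_le f (g : R -> R) : cmeas f -> (forall x, normc (f x) <= g x) ->
  mu.-integrable setT (EFin \o g) -> normc (cintegral f) <= 2 * \int[mu]_x g x.
Proof.
move=> mf fg ig; rewrite -lee_fin (le_trans (le_normc_cintegral mf))// EFinM.
apply: lee_wpmul2l; first by rewrite lee_fin.
rewrite /Rintegral fineK; last exact: integrable_fin_num.
apply: ge0_le_integral => //.
- by move=> x _; rewrite lee_fin normc_ge0.
- exact: measurable_normcE.
- by move: ig => /integrableP[].
- by move=> x _; rewrite lee_fin.
Qed.

End complex_integral.

Section affine_change_of_variables.
Context {R : realType}.

Lemma measurable_affine (a b : R) : measurable_fun setT (fun x : R => a * x + b).
Proof. by apply: measurable_funD => //; exact: measurable_funM. Qed.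

(** Scaled by [a], the push-forward of Lebesgue measure under the affine map agrees with Lebesgue
    measure on half-open intervals, hence on all measurable sets by uniqueness. *)
Let ge0_integral_affine_gt0 (a b : R) (f : R -> \bar R) : 0 < a ->
  measurable_fun setT f -> (forall x, 0 <= f x)%E ->
  (\int[mu]_x f (a * x + b)%R = a^-1%:E * \int[mu]_x f x)%E.
Proof.
move=> a0 mf f0.
pose phi : measurableTypeR R -> measurableTypeR R := fun x => a * x + b.
have mphi : measurable_fun setT phi by exact: measurable_affine.
have ai0 : 0 <= a by exact: ltW.
pose nu := mscale (NngNum ai0)
    (measure_function_pushforward__canonical__measure_function_Measure mu mphi).
have muE A : measurable A -> mu A = nu A.
  move=> mA; apply: lebesgue_measure_unique => // _ [[c d]] _ <-.
  rewrite /nu/= /mscale/= /pushforward.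
  have -> : phi @^-1` [set` Interval (BRight c) (BRight d)] =
      [set` Interval (BRight ((c - b) / a)) (BRight ((d - b) / a))].
    apply/seteqP; split=> x /=; rewrite /phi !in_itv/=.
    - by rewrite ltr_pdivrMr// ler_pdivlMr// [x * a]mulrC; lra.
    - by rewrite ltr_pdivrMr// ler_pdivlMr// [x * a]mulrC; lra.
  rewrite !lebesgue_measure_itv/= !lte_fin ltr_pM2r ?invr_gt0// ltrD2r.
  case: ifPn => _; last by rewrite mule0.
  by rewrite -!EFinB -EFinM; congr EFin; field; rewrite gt_eqF.
rewrite [X in (_ * X)%E](eq_measure_integral nu); last by move=> A mA _; exact: muE.
rewrite ge0_integral_mscale// ge0_integral_pushforward//.
rewrite muleA -EFinM/= mulVf ?gt_eqF// mul1e preimage_setT.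
by apply: eq_integral => x _.
Qed.

Lemma ge0_integral_opp (f : R -> \bar R) :
  measurable_fun setT f -> (forall x, 0 <= f x)%E ->
  (\int[mu]_x f (- x)%R = \int[mu]_x f x)%E.
Proof.
move=> mf f0.
rewrite [RHS](eq_measure_integral (pushforward mu (-%R : _ -> measurableTypeR R))); last first.
  by move=> A mA _; exact/esym/lebesgue_measureN.
by rewrite ge0_integral_pushforward// preimage_setT.
Qed.

Lemma ge0_integral_affine (a b : R) (f : R -> \bar R) : a != 0 ->
  measurable_fun setT f -> (forall x, 0 <= f x)%E ->
  (\int[mu]_x f (a * x + b)%R = `|a|^-1%:E * \int[mu]_x f x)%E.
Proof.
move=> a0 mf f0; have [a_gt0|a_lt0|a_eq0] := ltgtP a 0; last by rewrite a_eq0 eqxx in a0.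
- rewrite ltr0_norm//.
  rewrite -(ge0_integral_opp (f := fun x => f (a * x + b))) //; last first.
    by apply: measurableT_comp mf _; exact: measurable_affine.
  under eq_integral do rewrite mulrN -mulNr.
  by rewrite ge0_integral_affine_gt0// oppr_gt0.
- by rewrite gtr0_norm// ge0_integral_affine_gt0.
Qed.

Lemma integral_affine (a b : R) (f : R -> \bar R) : a != 0 ->
  mu.-integrable setT f ->
  (\int[mu]_x f (a * x + b)%R = `|a|^-1%:E * \int[mu]_x f x)%E.
Proof.
move=> a0 fi; have mf := measurable_int _ fi.
rewrite integralE [in RHS]integralE muleBr//; last exact: integrable_add_def.
rewrite -(ge0_integral_affine b)//; last exact: measurable_funepos.
rewrite -(ge0_integral_affine b)//; last exact: measurable_funeneg.
by congr (_ - _)%E; apply: eq_integral => x _; rewrite ?funeposE ?funenegE.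
Qed.

Lemma cintegral_affine (a b : R) (f : R -> R[i]) : a != 0 -> cintegrable f ->
  cintegral (fun x => f (a * x + b)) = (`|a|^-1)%:C * cintegral f.
Proof.
move=> a0 [f1 f2]; apply: complex_eqP; rewrite ?cReM ?cImM /= mul0r ?subr0 ?addr0.
- rewrite /Rintegral (integral_affine _ a0 f1) fineM//.
  exact: integrable_fin_num.
- rewrite /Rintegral (integral_affine _ a0 f2) fineM//.
  exact: integrable_fin_num.
Qed.

(** The change of variables applied to the indicator of a null set shows that its preimage is
    null. *)
Lemma ae_affine (a b : R) (P : R -> Prop) : a != 0 ->
  {ae mu, forall x, P x} -> {ae mu, forall x, P (a * x + b)}.
Proof.
move=> a0 [N [mN N0 PN]]; pose phi (x : R) := a * x + b.
have mphi : measurable (phi @^-1` N).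
  by rewrite -[X in measurable X]setTI; exact: (measurable_affine a b).
exists (phi @^-1` N); split => //; last by move=> x Px; apply: PN.
have iN : (\int[mu]_x (\1_N x)%:E = 0)%E by rewrite integral_indic// setIT.
have := @ge0_integral_affine a b (fun x => (\1_N x)%:E) a0 _ _.
rewrite iN mule0.
have -> : (fun x => (\1_N (a * x + b))%:E) = (fun x => (\1_(phi @^-1` N) x)%:E) :> (R -> \bar R).
  by apply/funext => x; rewrite !indicE; congr ((_ : bool)%:R%:E); apply/idP/idP; rewrite !inE.
rewrite integral_indic// setIT; apply => //.
by apply/measurable_EFinP; exact: measurable_indic.
Qed.

End affine_change_of_variables.

Section complex_fubini.
Context {R : realType}.
Local Notation RR := (measurableTypeR R).

(** Tonelli gives measurability of the inner integral for nonnegative integrands, so the positive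
    and negative parts are treated apart. *)
Lemma measurable_integral2 (f : RR * RR -> \bar R) : measurable_fun setT f ->
  measurable_fun setT (fun x => (\int[mu]_y f (x, y))%E).
Proof.
move=> mf.
have -> : (fun x => \int[mu]_y f (x, y))%E =
   ((fun x => \int[mu]_y f^\+ (x, y)) \- (fun x => \int[mu]_y f^\- (x, y)))%E.
  apply/funext => x; rewrite [LHS]integralE.
  under eq_integral do rewrite funepos_comp/=.
  by under [X in (_ - X = _)%E]eq_integral do rewrite funeneg_comp/=.
apply: emeasurable_funB.
- by apply: measurable_fun_fubini_tonelli_F => //; exact: measurable_funepos.
- by apply: measurable_fun_fubini_tonelli_F => //; exact: measurable_funeneg.
Qed.

Lemma measurable_Rintegral2 (f : RR * RR -> R) : measurable_fun setT f ->
  measurable_fun setT (fun x => \int[mu]_y f (x, y)).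
Proof.
move=> mf; apply: (measurableT_comp (fine_measurable measurableT)).
by apply: (measurable_integral2 (f := EFin \o f)); exact/measurable_EFinP.
Qed.

Lemma cmeas_cintegral2 (F : RR * RR -> R[i]) : cmeas F ->
  cmeas (fun x => cintegral (fun y => F (x, y))).
Proof.
move=> [m1 m2]; split => /=.
- exact: (measurable_Rintegral2 m1).
- exact: (measurable_Rintegral2 m2).
Qed.

(** [Rintegral] sends an infinite inner integral to 0, so the integrands agree only at the [x] whose
    section is integrable, which is almost every [x]. *)
Lemma Rintegral_fubini_F (f : RR * RR -> R) :
  (mu \x mu)%E.-integrable setT (EFin \o f) ->
  (\int[mu]_x (\int[mu]_y f (x, y))%R%:E = \int[mu]_x \int[mu]_y (f (x, y))%:E)%E.
Proof.
move=> fi; have mf := measurable_int _ fi.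
apply: ae_eq_integral => //.
- by apply/measurable_EFinP; apply: measurable_Rintegral2; exact/measurable_EFinP.
- exact: (measurable_integral2 mf).
- apply: filterS (ae_integrable1 fi) => x fx _.
  by rewrite /Rintegral fineK//; exact: integrable_fin_num fx.
Qed.

Lemma Rintegral_fubini_G (f : RR * RR -> R) :
  (mu \x mu)%E.-integrable setT (EFin \o f) ->
  (\int[mu]_y (\int[mu]_x f (x, y))%R%:E = \int[mu]_y \int[mu]_x (f (x, y))%:E)%E.
Proof.
move=> fi; have mf := measurable_int _ fi.
have mf' : measurable_fun setT (fun p : RR * RR => f (p.2, p.1)).
  move/measurable_EFinP : mf => mf; apply: measurableT_comp mf _.
  exact: measurable_fun_pair measurable_snd measurable_fst.
apply: ae_eq_integral => //.
- apply/measurable_EFinP.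
  exact: (measurable_Rintegral2 (f := fun p : RR * RR => f (p.2, p.1))).
- apply: (measurable_integral2 (f := fun p : RR * RR => (f (p.2, p.1))%:E)).
  exact/measurable_EFinP.
- apply: filterS (ae_integrable2 fi) => y fy _.
  by rewrite /Rintegral fineK//; exact: integrable_fin_num fy.
Qed.

Lemma Rintegral_fubini (f : RR * RR -> R) :
  (mu \x mu)%E.-integrable setT (EFin \o f) ->
  \int[mu]_x \int[mu]_y f (x, y) = \int[mu]_y \int[mu]_x f (x, y).
Proof.
move=> fi; rewrite [LHS]/Rintegral [RHS]/Rintegral; congr fine.
by rewrite (Rintegral_fubini_F fi) (Rintegral_fubini_G fi); exact: Fubini fi.
Qed.

Lemma cintegral_fubini (F : RR * RR -> R[i]) : cmeas F ->
  (\int[mu]_x \int[mu]_y (normc (F (x, y)))%:E < +oo)%E ->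
  cintegral (fun x => cintegral (fun y => F (x, y))) =
  cintegral (fun y => cintegral (fun x => F (x, y))).
Proof.
move=> mF Foo; have [m1 m2] := mF.
have nF : (mu \x mu)%E.-integrable setT (EFin \o (fun p => normc (F p))).
  apply/integrable12ltyP; first exact/measurable_EFinP/measurable_normc.
  by under eq_integral do under eq_integral do
    rewrite gee0_abs ?lee_fin ?normc_ge0//.
have i1 : (mu \x mu)%E.-integrable setT (EFin \o (fun p => Re (F p))).
  apply: (le_integrable measurableT _ _ nF); first exact/measurable_EFinP.
  by move=> p _ /=; rewrite lee_fin (le_trans (ler_Re_normc _))// ler_norm.
have i2 : (mu \x mu)%E.-integrable setT (EFin \o (fun p => Im (F p))).
  apply: (le_integrable measurableT _ _ nF); first exact/measurable_EFinP.
  by move=> p _ /=; rewrite lee_fin (le_trans (ler_Im_normc _))// ler_norm.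
by apply: complex_eqP => /=; [exact: (Rintegral_fubini i1)|exact: (Rintegral_fubini i2)].
Qed.

(** The product of the moduli of [A] and [B], times [C], dominates the double integrand. This is the
    form of Fubini behind the multiplication formula, the convolution theorem and the mollification
    of indicators. *)
Lemma cintegral_fubini_kernel (A B : R -> R[i]) (K : RR * RR -> R[i]) C :
  cintegrable A -> cintegrable B -> cmeas K -> (forall p, normc (K p) <= C) ->
  cintegral (fun x => A x * cintegral (fun y => B y * K (x, y))) =
  cintegral (fun y => B y * cintegral (fun x => A x * K (x, y))).
Proof.
move=> iA iB mK KC; have C0 : 0 <= C by rewrite (le_trans _ (KC (0, 0)))// normc_ge0.
have mKx x : cmeas (fun y => K (x, y)).
  exact: (cmeas_comp (pair1_measurable x) mK).
have mKy y : cmeas (fun x => K (x, y)).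
  exact: (cmeas_comp (pair2_measurable y) mK).
under eq_cintegral => x.
  rewrite -cintegralZ; last exact: cintegrable_bounded_mul iB (mKx _) (fun=> KC _).
  over.
under [RHS]eq_cintegral => y.
  rewrite -cintegralZ; last exact: cintegrable_bounded_mul iA (mKy _) (fun=> KC _).
  over.
have mA := cintegrable_cmeas iA; have mB := cintegrable_cmeas iB.
have mAK : cmeas (fun p : RR * RR => A p.1 * (B p.2 * K p)).
  apply: cmeasM; first exact: (cmeas_comp measurable_fst).
  by apply: cmeasM => //; exact: (cmeas_comp measurable_snd).
rewrite (cintegral_fubini mAK).
  by apply: eq_cintegral => y; apply: eq_cintegral => x /=; ring.
have /cintegrableP[_ ioA] := iA; have /cintegrableP[_ ioB] := iB.
apply: (@le_lt_trans _ _ (\int[mu]_x ((normc (A x))%:E *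
    (C%:E * \int[mu]_y (normc (B y))%:E)))%E).
  apply: ge0_le_integral => //.
  - by move=> x _; apply: integral_ge0 => y _; rewrite lee_fin normc_ge0.
  - apply: (measurable_integral2
      (f := fun p : RR * RR => (normc (A p.1 * (B p.2 * K p)))%:E)).
    exact/measurable_EFinP/measurable_normc.
  - by apply: emeasurable_funM => //; exact: measurable_normcE.
  - move=> x _; rewrite -ge0_integralZl//; last 2 first.
    + exact: measurable_normcE.
    + by move=> y _; rewrite lee_fin normc_ge0.
    rewrite -ge0_integralZl//; last 3 first.
    + by apply: emeasurable_funM => //; exact: measurable_normcE.
    + by move=> y _; rewrite -EFinM lee_fin mulr_ge0// normc_ge0.
    + by rewrite lee_fin normc_ge0.
    apply: ge0_le_integral => //.
    + by move=> y _; rewrite lee_fin normc_ge0.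
    + by apply: measurable_normcE; exact: (cmeasM (cmeas_cst _ (A x)) (cmeasM mB (mKx x))).
    + do 2 apply: emeasurable_funM => //; exact: measurable_normcE.
    + move=> y _; rewrite -!EFinM lee_fin !normcM ler_wpM2l ?normc_ge0//.
      by rewrite mulrC ler_wpM2r// normc_ge0.
rewrite ge0_integralZr//; last 3 first.
- exact: measurable_normcE.
- by move=> y _; rewrite lee_fin normc_ge0.
- by rewrite mule_ge0// integral_ge0// => y _; rewrite lee_fin normc_ge0.
have B0 : (0 <= \int[mu]_y (normc (B y))%:E)%E.
  by apply: integral_ge0 => y _; rewrite lee_fin normc_ge0.
have A0 : (0 <= \int[mu]_y (normc (A y))%:E)%E.
  by apply: integral_ge0 => y _; rewrite lee_fin normc_ge0.
rewrite lte_mul_pinfty// ?ge0_fin_numE// lte_mul_pinfty//.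
Qed.

End complex_fubini.

(** * Differentiation of complex functions of a real variable *)

Section complex_derivative.
Context {R : realType}.

(** A relation instead of an equation on [cderiven]: it carries differentiability along, so that
    derivatives can be built by rules and identified afterwards with [cder_unique]. *)
Definition cder (f g : R -> R[i]) : Prop := forall x : R,
  is_derive x 1 (fun y => Re (f y)) (Re (g x)) /\
  is_derive x 1 (fun y => Im (f y)) (Im (g x)).

Lemma is_derive_Rintegral (f g : R -> R -> R) (G : R -> R) :
  (forall k, mu.-integrable setT (EFin \o f k)) ->
  (forall (k : R) x, is_derive k 1 (f^~ x) (g k x)) ->
  (forall k x, `|g k x| <= G x) -> mu.-integrable setT (EFin \o G) ->
  forall k : R, is_derive k 1 (fun k => \int[mu]_x f k x) (\int[mu]_x g k x).
Proof.
move=> fi dfg gG Gi k.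
have gE a x : partial1of2 f a x = g a x by rewrite partial1of2E derive_val.
(* Differentiation under the integral is local in the parameter; since the domination by [G] is
   global, any open interval around [k] does. *)
have kI : `]k - 1, k + 1[%classic k by rewrite /= in_itv/= ltrBlDr ltrDl ltr01.
have G0 y : 0 <= G y by rewrite (le_trans _ (gG 0 y)).
have fi' x : `]k - 1, k + 1[%classic x -> mu.-integrable setT (EFin \o f x) by [].
have df x y : `]k - 1, k + 1[%classic x -> setT y -> derivable (f ^~ y) x 1 by [].
have Gub x y : `]k - 1, k + 1[%classic x -> setT y -> `|partial1of2 f x y| <= G y.
  by move=> _ _; rewrite gE.
apply: DeriveDef.
- exact: (derivable_under_integral measurableT kI fi' df G0 Gi Gub).
- rewrite -derive1E (differentiation_under_integral measurableT kI fi' df G0 Gi Gub).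
  by apply: eq_Rintegral => x _; rewrite -gE.
Qed.

Lemma cder_cintegral (f g : R -> R -> R[i]) (G : R -> R) :
  (forall k, cintegrable (f k)) ->
  (forall x, cder (f^~ x) (g^~ x)) ->
  (forall k x, normc (g k x) <= G x) -> mu.-integrable setT (EFin \o G) ->
  cder (fun k => cintegral (f k)) (fun k => cintegral (g k)).
Proof.
move=> fi dfg gG Gi k; split => /=.
- apply: (@is_derive_Rintegral (fun k x => Re (f k x)) (fun k x => Re (g k x)) G) => //.
  + by move=> a; case: (fi a).
  + by move=> a x; case: (dfg x a).
  + by move=> a x; rewrite (le_trans (ler_Re_normc _)).
- apply: (@is_derive_Rintegral (fun k x => Im (f k x)) (fun k x => Im (g k x)) G) => //.
  + by move=> a; case: (fi a).
  + by move=> a x; case: (dfg x a).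
  + by move=> a x; rewrite (le_trans (ler_Im_normc _)).
Qed.

Lemma cderD f1 g1 f2 g2 : cder f1 g1 -> cder f2 g2 ->
  cder (fun x => f1 x + f2 x) (fun x => g1 x + g2 x).
Proof.
move=> d1 d2 x; have [a1 b1] := d1 x; have [a2 b2] := d2 x; split.
- by under eq_fun do rewrite cReD; rewrite cReD; exact: is_deriveD.
- by under eq_fun do rewrite cImD; rewrite cImD; exact: is_deriveD.
Qed.

Lemma cderM f1 g1 f2 g2 : cder f1 g1 -> cder f2 g2 ->
  cder (fun x => f1 x * f2 x) (fun x => g1 x * f2 x + f1 x * g2 x).
Proof.
move=> d1 d2 x; have [a1 b1] := d1 x; have [a2 b2] := d2 x; split.
- under eq_fun do rewrite cReM.
  apply: is_derive_eq.
  by rewrite cReD !cReM /GRing.scale/=; ring.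
- under eq_fun do rewrite cImM.
  apply: is_derive_eq.
  by rewrite cImD !cImM /GRing.scale/=; ring.
Qed.

Lemma cder_unique f g h : cder f g -> cder f h -> g = h.
Proof.
move=> dg dh; apply/funext => x; have [a b] := dg x; have [a' b'] := dh x.
by apply: complex_eqP;
  [rewrite -(@derive_val _ _ _ _ _ _ _ a)|rewrite -(@derive_val _ _ _ _ _ _ _ b)]; apply: derive_val.
Qed.

Lemma cder_cst c : cder (fun=> c) (fun=> 0).
Proof. by move=> x; split; exact: is_derive_cst. Qed.

Lemma cder_real (f g : R -> R) : (forall x : R, is_derive x 1 f (g x)) ->
  cder (fun x => (f x)%:C) (fun x => (g x)%:C).
Proof. by move=> fg x; split => //=; exact: is_derive_cst. Qed.

Lemma cder_expi (a : R) : cder (fun x => expi (a * x)) (fun x => (0 +i* a) * expi (a * x)).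
Proof.
move=> x; split; rewrite /expi/=.
- by apply: is_derive_eq; rewrite /GRing.scale/=; ring.
- by apply: is_derive_eq; rewrite /GRing.scale/=; ring.
Qed.

Lemma cder_affine (a b : R) f g : cder f g ->
  cder (fun x => f (a * x + b)) (fun x => a%:C * g (a * x + b)).
Proof.
move=> d x; have [a1 b1] := d (a * x + b).
have dl : is_derive x 1 (fun x => a * x + b) a.
  by apply: is_derive_eq; rewrite /GRing.scale/=; ring.
split; rewrite ?cReM ?cImM/= mul0r ?subr0 ?addr0.
- have := @is_derive1_comp _ (fun y => Re (f y)) (fun x => a * x + b) x _ _ a1 dl.
  by rewrite mulrC.
- have := @is_derive1_comp _ (fun y => Im (f y)) (fun x => a * x + b) x _ _ b1 dl.
  by rewrite mulrC.
Qed.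

Lemma cder_cmeas f g : cder f g -> cmeas f.
Proof.
move=> d; split; apply: continuous_measurable_fun => x; have [dr di] := d x;
  by apply: differentiable_continuous; apply/derivable1_diffP.
Qed.

End complex_derivative.

Lemma is_derive_continuous (R : realType) (f : R -> R) (x d : R) :
  is_derive x 1 f d -> {for x, continuous f}.
Proof. by move=> [h _]; apply: differentiable_continuous; apply/derivable1_diffP. Qed.

(** * Schwartz functions *)

Section japanese_weight.
Context {R : realType}.
Implicit Types k x s t : R.

Definition jap k : R := 1 + k ^+ 2.

Lemma jap_ge1 k : 1 <= jap k. Proof. by rewrite lerDl sqr_ge0. Qed.

Lemma jap_gt0 k : 0 < jap k. Proof. exact: lt_le_trans ltr01 (jap_ge1 k). Qed.

Lemma jap_ge0 k : 0 <= jap k. Proof. exact/ltW/jap_gt0. Qed.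

Hint Resolve jap_ge1 jap_gt0 jap_ge0 : core.

Lemma jap_neq0 k : jap k != 0. Proof. by rewrite gt_eqF. Qed.

Lemma japN k : jap (- k) = jap k. Proof. by rewrite /jap sqrrN. Qed.

Lemma japw_gt0 k t : 0 < jap k `^ t. Proof. exact: powR_gt0. Qed.

Lemma japw_ge0 k t : 0 <= jap k `^ t. Proof. exact: powR_ge0. Qed.

Lemma japwD k s t : jap k `^ (s + t) = jap k `^ s * jap k `^ t.
Proof. by rewrite powRD// jap_neq0 implybT. Qed.

Lemma continuous_jap : continuous jap.
Proof.
by move=> x; rewrite /jap; apply: cvgD; [exact: cvg_cst|exact: exprn_continuous].
Qed.

Lemma continuous_japw t : continuous (fun k => jap k `^ t).
Proof.
move=> x; apply: (@continuous_comp _ _ _ jap (fun y => y `^ t)); first exact: continuous_jap.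
apply: differentiable_continuous; apply/derivable1_diffP.
by apply: derivable_powR; rewrite in_itv/= andbT.
Qed.

Lemma measurable_japw t : measurable_fun setT (fun k => jap k `^ t).
Proof. by apply: continuous_measurable_fun; exact: continuous_japw. Qed.

Let cvg_powRN p : 0 < p -> (1 + x) `^ (- p) @[x --> +oo] --> (0 : R).
Proof.
move=> p0; apply/cvgrPdist_le => /= e e0.
near=> x.
have x0 : 0 <= x by near: x; apply: nbhs_pinfty_ge; exact: num_real.
rewrite sub0r normrN ger0_norm ?powR_ge0// powRN -[leRHS]invrK lef_pV2 ?posrE ?invr_gt0 ?powR_gt0//;
  last by rewrite ltr_wpDr.
have -> : e^-1 = (e^-1 `^ p^-1) `^ p.
  by rewrite -powRrM mulVf ?gt_eqF// powRr1// invr_ge0 ltW.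
apply: ge0_ler_powR; rewrite ?nnegrE ?powR_ge0 ?ltW//; first by rewrite ltr_wpDr.
rewrite (@lt_trans _ _ x)//; last by rewrite ltrDr.
Unshelve. all: by end_near. Qed.

(** By evenness it is enough to integrate over the half-line, where the weight is compared with (1 +
    x)^(-2s). That power has an explicit primitive vanishing at infinity exactly because 2s > 1. *)
Lemma integrable_japwN s : 2^-1 < s ->
  mu.-integrable setT (EFin \o (fun k => jap k `^ (- s))).
Proof.
move=> s2; apply/integrableP; split; first by apply/measurable_EFinP; exact: measurable_japw.
under eq_integral do rewrite gee0_abs ?lee_fin ?japw_ge0//.
rewrite ge0_symfun_integralT; last 3 first.
- by move=> x; exact: japw_ge0.
- exact: continuous_japw.
- by move=> x /=; rewrite japN.
rewrite -set_itvcy; set I := (X in (_ * X)%E).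
have s0 : 0 < s by rewrite (lt_trans _ s2)// invr_gt0.
have I0 : (0 <= I)%E by apply: integral_ge0 => x _; rewrite lee_fin japw_ge0.
suff : (I < +oo)%E by move=> Ioo; rewrite lte_mul_pinfty// ge0_fin_numE.
pose f x := (2 * s - 1) * (1 + x) `^ (- (2 * s)).
pose F x := - (1 + x) `^ (1 - 2 * s).
have s21 : 0 < 2 * s - 1 by rewrite subr_gt0 -ltr_pdivrMl// mulr1.
have pos x : 0 <= x -> 0 < 1 + x by move=> x0; rewrite ltr_wpDr.
have dpow p (x : R) : 0 <= x -> is_derive x 1 (fun x => (1 + x) `^ p) (p * (1 + x) `^ (p - 1)).
  move=> x0; have dx : is_derive x 1 (fun x => 1 + x) (1 : R).
    by have := is_deriveD (is_derive_cst (1 : R) x 1) (is_derive_id x 1); rewrite add0r.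
  have := is_derive1_comp (is_derive1_powR p (pos x x0)) dx.
  by rewrite mulr1.
have dF x : 0 <= x -> is_derive x 1 F (f x).
  move=> x0; have /is_deriveN d := dpow (1 - 2 * s) x x0.
  rewrite /f (_ : (2 * s - 1) * _ = - ((1 - 2 * s) * (1 + x) `^ (1 - 2 * s - 1)))//.
  by rewrite (_ : 1 - 2 * s - 1 = - (2 * s)); ring.
have Ff : (\int[mu]_(x in `[0%R, +oo[) (f x)%:E = 0%:E - (F 0)%:E)%E.
  apply: ge0_continuous_FTC2y.
  - by move=> x x0; rewrite mulr_ge0 ?powR_ge0// ltW.
  - apply: continuous_in_subspaceT => x; rewrite inE/= in_itv/= andbT => x0.
    apply: cvgM; first exact: cvg_cst.
    exact: is_derive_continuous (dpow _ x x0).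
  - rewrite /F -[X in _ --> X]oppr0; apply: cvgN.
    by rewrite (_ : 1 - 2 * s = - (2 * s - 1)); [exact: cvg_powRN|ring].
  - by move=> x x0; have := dF x (ltW x0).
  - by apply: cvg_at_right_filter; exact: is_derive_continuous (dF 0 (lexx 0)).
  - move=> x; rewrite in_itv/= andbT => x0.
    by rewrite derive1E; have /@derive_val := dF x (ltW x0).
have mf : measurable_fun (`[0%R, +oo[%classic : set R) (fun x : R => (f x)%:E).
  apply/measurable_EFinP; apply: measurable_funM => //.
  apply: measurable_funTS; apply: (measurableT_comp (measurable_powR _)).
  exact: measurable_funD.
(* The factor 2^s comes from (1 + x)^2 <= 2 (1 + x^2), and 2s - 1 cancels the coefficient of [f]. *)
apply: (@le_lt_trans _ _ (\int[mu]_(x in `[0%R, +oo[)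
    ((2 `^ s / (2 * s - 1))%:E * (f x)%:E))%E).
  apply: ge0_le_integral => //.
  - by move=> x _; rewrite lee_fin japw_ge0.
  - by apply/measurable_EFinP; apply: measurable_funTS; exact: measurable_japw.
  - exact: emeasurable_funM.
  - move=> x; rewrite /= in_itv/= andbT => x0; rewrite -EFinM lee_fin.
    rewrite /f mulrA -[2 `^ s / _ * _]mulrA mulVf ?gt_eqF// mulr1.
    rewrite !powRN -[leLHS]mul1r ler_pdivrMr ?japw_gt0//.
    rewrite mulrAC ler_pdivlMr ?powR_gt0 ?pos// mul1r -powRM//.
    rewrite powRrM powR_mulrn ?(ltW (pos _ x0))//.
    apply: ge0_ler_powR; rewrite ?nnegrE ?sqr_ge0 ?mulr_ge0 ?(ltW s0)//.
    by rewrite /jap -subr_ge0 (_ : _ - _ = (1 - x) ^+ 2) ?sqr_ge0//; ring.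
rewrite ge0_integralZl//; last 2 first.
- move=> x; rewrite /= in_itv/= andbT => x0.
  by rewrite lee_fin mulr_ge0 ?powR_ge0// ltW.
- by rewrite lee_fin divr_ge0 ?powR_ge0// ltW.
by rewrite Ff -EFinB -EFinM ltry.
Qed.

Lemma integrable_japV : mu.-integrable setT (EFin \o (fun k => (jap k)^-1)).
Proof.
have -> : (fun k : R => (jap k)^-1) = (fun k => jap k `^ (-1)).
  by apply/funext => k; rewrite powR_inv1.
by apply: integrable_japwN; rewrite invf_lt1 ?ltr1n.
Qed.

Lemma jap_expn_le n k : jap k ^+ n <= 2 ^+ n * (1 + `|k| ^+ (2 * n)).
Proof.
rewrite exprM real_normK ?num_real// /jap.
have [k1|k1] := leP (k ^+ 2) 1.
  rewrite (@le_trans _ _ (2 ^+ n))//.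
    by rewrite lerXn2r ?nnegrE ?jap_ge0// (natrD _ 1 1) lerD2l.
  by rewrite ler_peMr ?exprn_ge0// lerDl exprn_ge0// sqr_ge0.
have k20 : 0 <= 2 * k ^+ 2 by rewrite mulr_ge0// sqr_ge0.
rewrite (@le_trans _ _ ((2 * k ^+ 2) ^+ n))//.
  apply: lerXn2r; rewrite ?nnegrE//; first exact: jap_ge0.
  by rewrite mulr_natl mulr2n lerD2r ltW.
by rewrite exprMn ler_wpM2l ?exprn_ge0// lerDr.
Qed.

Lemma expr_norm_le_jap m k : `|k| ^+ m <= jap k ^+ m.
Proof.
rewrite lerXn2r ?nnegrE ?jap_ge0// /jap.
rewrite -[k ^+ 2]real_normK ?num_real//; set y := `|k|.
rewrite -subr_ge0 (_ : _ - y = (y - 2^-1) ^+ 2 + 3 / 4); last by field.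
by rewrite addr_ge0 ?sqr_ge0// divr_ge0.
Qed.

Lemma ex_nat_ge (x : R) : exists n : nat, x <= n%:R.
Proof.
exists (Num.bound `|x|); rewrite (le_trans (ler_norm x))// ltW//.
exact: archi_boundP.
Qed.

Lemma japw_le_expn t (n : nat) (k : R) : t <= n%:R -> jap k `^ t <= jap k ^+ n.
Proof. by move=> tn; rewrite -powR_mulrn ?jap_ge0// ler_powR ?jap_ge1. Qed.

(** Converts fast decay into an integrable majorant of the weighted square: of the 2n + 2 powers of
    [jap] available, [n] absorb the weight and one is kept as the integrable factor. *)
Lemma japw_sqr_le t (n : nat) (k x D : R) : t <= n%:R -> 0 <= x -> 0 <= D ->
  jap k ^+ n.+1 * x <= D -> jap k `^ t * x ^+ 2 <= D ^+ 2 * (jap k)^-1.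
Proof.
move=> tn x0 D0 xD; have j0 := jap_gt0 k; have j1 := jap_ge1 k.
rewrite -ler_pdivrMr ?invr_gt0// invrK mulrAC.
apply: (@le_trans _ _ ((jap k ^+ n.+1 * x) ^+ 2)); last first.
  by rewrite lerXn2r// nnegrE ?mulr_ge0 ?exprn_ge0// ltW.
rewrite exprMn ler_wpM2r ?sqr_ge0//.
rewrite (le_trans (ler_wpM2r (ltW j0) (japw_le_expn k tn)))// -exprSr.
by rewrite expr2 ler_peMr ?exprn_ge0 ?exprn_ege1// ltW.
Qed.

(** The maximum, sharper than the product in [jap_add_leM], is what lets Peetre's inequality end in
    a sum of two integrable weights. *)
Lemma jap_add_le (y z : R) : jap (y + z) <= 4 * Num.max (jap y) (jap z).
Proof.
have h : jap (y + z) <= 2 * jap y + 2 * jap z.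
  rewrite /jap -subr_ge0 (_ : _ - _ = (y - z) ^+ 2 + 3); last by ring.
  by rewrite addr_ge0 ?sqr_ge0.
apply: (le_trans h); have [yz|zy] := leP (jap y) (jap z); first by lra.
by move: zy => /ltW zy; lra.
Qed.

Lemma jap_add_leM (y z : R) : jap (y + z) <= 4 * (jap y * jap z).
Proof.
rewrite (le_trans (jap_add_le y z))// ler_wpM2l// ge_max.
by rewrite ler_peMr ?jap_ge0 ?jap_ge1// ler_peMl ?jap_ge0 ?jap_ge1.
Qed.

Lemma jap_expn_add (m : nat) (y z : R) :
  jap (y + z) ^+ m <= 4 ^+ m * (jap y ^+ m * jap z ^+ m).
Proof.
rewrite -!exprMn; apply: lerXn2r; rewrite ?nnegrE ?jap_ge0 ?mulr_ge0 ?jap_ge0//.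
exact: jap_add_leM.
Qed.

End japanese_weight.

#[global] Hint Resolve jap_ge1 jap_gt0 jap_ge0 : core.
Section dominated_convergence.
Context {R : realType}.

Lemma ae_imp (P Q : R -> Prop) : (forall x, P x -> Q x) ->
  {ae mu, forall x, P x} -> {ae mu, forall x, Q x}.
Proof.
by move=> PQ [N [mN N0 PN]]; exists N; split => // x Qx; apply: PN => /PQ.
Qed.

Lemma ae_and (P Q : R -> Prop) : {ae mu, forall x, P x} -> {ae mu, forall x, Q x} ->
  {ae mu, forall x, P x /\ Q x}.
Proof.
move=> [N [mN N0 PN]] [M [mM M0 QM]]; exists (N `|` M); split.
- exact: measurableU.
- exact: null_set_setU.
- by move=> x; apply: contra_notP => /not_orP[Nx Mx]; split; apply: contrapT;
    [move=> /PN|move=> /QM].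
Qed.

Lemma integrable_scale (c : R) (f : R -> R) : mu.-integrable setT (EFin \o f) ->
  mu.-integrable setT (EFin \o (fun x => c * f x)).
Proof.
move=> fi; have -> : EFin \o (fun x => c * f x) = (fun x => c%:E * (f x)%:E)%E.
  by apply/funext => x /=; rewrite EFinM.
exact: integrableZl.
Qed.

Lemma Rintegral_dominated_cvg (f_ : nat -> R -> R) (f g : R -> R) :
  (forall n, measurable_fun setT (f_ n)) -> measurable_fun setT f ->
  {ae mu, forall x, f_ n x @[n --> \oo] --> f x} ->
  mu.-integrable setT (EFin \o g) -> (forall n x, `|f_ n x| <= g x) ->
  \int[mu]_x f_ n x @[n --> \oo] --> \int[mu]_x f x.
Proof.
move=> mf_ mf ff ig fg.
have ff' : {ae mu, forall x, setT x -> (f_ n x)%:E @[n --> \oo] --> (f x)%:E}.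
  by apply: ae_imp ff => x h _; apply: cvg_EFin => //; exact: nearW.
have mf_' n := (measurable_EFinP _ _).2 (mf_ n).
have fg' : {ae mu, forall x n, setT x -> (`|(f_ n x)%:E| <= (g x)%:E)%E}.
  by apply: aeW => x n _; rewrite lee_fin.
have [fi _ fcvg] := @dominated_convergence _ _ _ mu _ measurableT
  (fun n => EFin \o f_ n) (EFin \o f) (EFin \o g) mf_'
  ((measurable_EFinP _ _).2 mf) ff' ig fg'.
apply: fine_cvg; rewrite /Rintegral fineK; last exact: integrable_fin_num fi.
exact: fcvg.
Qed.

(** The integral over [-n-1, n+1] is a boundary term of size at most 2C / (n+1), and it tends to the
    full integral by dominated convergence. *)
Lemma Rintegral_derive0 (f g : R -> R) C :
  (forall x : R, is_derive x 1 f (g x)) -> continuous g ->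
  mu.-integrable setT (EFin \o g) -> (forall x, `|x| * `|f x| <= C) ->
  \int[mu]_x g x = 0.
Proof.
move=> df cg ig fC; have mg := (measurable_EFinP _ _).1 (measurable_int _ ig).
pose I n : set R := `[- n.+1%:R, n.+1%:R]%classic.
have mI n : measurable (I n) by exact: measurable_itv.
have cvg1 : \int[mu]_x (\1_(I n) x * g x) @[n --> \oo] --> \int[mu]_x g x.
  apply: (@Rintegral_dominated_cvg _ _ (fun x => `|g x|)) => //.
  - by move=> n; apply: measurable_funM => //; exact: measurable_indic.
  - apply: aeW => x; apply: cvg_near_cst; near=> n.
    rewrite indicE mem_set ?mul1r// /I/= in_itv/= -ler_norml.
    rewrite (@le_trans _ _ n%:R) ?ler_nat//.
    by near: n; exact: nbhs_infty_ger.
  - exact: integrable_norm.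
  - by move=> n x; rewrite normrM ler_piMl// indicE; case: (_ \in _); rewrite ?normr1 ?normr0.
have IE n : \int[mu]_x (\1_(I n) x * g x) = f n.+1%:R - f (- n.+1%:R).
  have -> : (fun x => \1_(I n) x * g x) = g \_ (I n).
    apply/funext => x; rewrite patchE indicE.
    by case: (x \in I n); rewrite ?mul1r ?mul0r.
  rewrite -Rintegral_mkcond /Rintegral (@continuous_FTC2 _ g f)//.
  - by rewrite ltrNl (lt_le_trans _ (ler0n _ _))// oppr_lt0.
  - exact: continuous_subspaceT.
  - split.
    + by move=> x _; have := df x.
    + by apply: cvg_at_right_filter; exact: is_derive_continuous (df _).
    + by apply: cvg_at_left_filter; exact: is_derive_continuous (df _).
  - by move=> x _; rewrite derive1E; have /@derive_val := df x.
have fn n (x : R) : `|x| = n.+1%:R -> `|f x| <= C * n.+1%:R^-1.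
  by move=> xn; rewrite ler_pdivlMr// mulrC -xn.
have cvg2 : \int[mu]_x (\1_(I n) x * g x) @[n --> \oo] --> (0 : R).
  apply: norm_cvg0; apply: (@squeeze_cvgr _ _ _ _ (cst 0) (fun n => (2 * C) * n.+1%:R^-1)).
  - apply: nearW => n; rewrite normr_ge0/= IE (le_trans (ler_normB _ _))//.
    rewrite [2 * C]mulr_natl mulr2n mulrDl lerD ?fn// ?normrN ger0_norm//.
  - exact: cvg_cst.
  - rewrite -[X in _ --> X](mulr0 (2 * C)); apply: cvgM; first exact: cvg_cst.
    exact: cvg_harmonic.
exact: (cvg_unique _ cvg1 cvg2).
Unshelve. all: by end_near. Qed.

End dominated_convergence.

Section schwartz.
Context {R : realType}.
Implicit Types (f g : R -> R[i]) (F : nat -> R -> R[i]).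

(** A Schwartz function presented as the head of an explicit sequence of successive derivatives.
    Closure properties are proved by writing the sequence down, without computing iterated
    [derive1n]. *)
Definition schwartz_seq F : Prop := (forall n, cder (F n) (F n.+1)) /\
  forall m n, exists C, forall x, `|x| ^+ m * normc (F n x) <= C.

Lemma schwartz_seq_cderiven F : schwartz_seq F -> forall n, cderiven n (F 0) = F n.
Proof.
move=> [dF _] n.
suff [r i] : (derive1n n (fun y => Re (F 0 y)) = fun y => Re (F n y)) /\
    (derive1n n (fun y => Im (F 0 y)) = fun y => Im (F n y)).
  by apply/funext => x; rewrite /cderiven r i; case: (F n x).
elim: n => [//|n [r i]]; rewrite !derive1nS r i; split; apply/funext => x.
- by rewrite derive1E; have [/@derive_val ->] := dF n x.
- by rewrite derive1E; have [_ /@derive_val ->] := dF n x.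
Qed.

Lemma cderiven0 f : cderiven 0 f = f.
Proof. by apply/funext => x; rewrite /cderiven/=; case: (f x). Qed.

Lemma schwartz_seq_intro F : schwartz_seq F -> schwartz (F 0).
Proof.
move=> sF; have Fn := schwartz_seq_cderiven sF; have [dF bF] := sF; split.
  move=> n x; have [rn ni] := dF n x;
  have -> : derive1n n (fun y => Re (F 0 y)) = (fun y => Re (F n y)).
    by apply/funext => y; rewrite -(Fn n).
  have -> : derive1n n (fun y => Im (F 0 y)) = (fun y => Im (F n y)).
    by apply/funext => y; rewrite -(Fn n).
  by split; [move: rn => []|move: ni => []].
by move=> m n; have [C FC] := bF m n; exists C => _ [x _ <-]; rewrite Fn.
Qed.

Lemma schwartz_seqP f : schwartz f -> schwartz_seq (fun n => cderiven n f).
Proof.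
move=> [sf bf]; split.
  move=> n x; have [rn ni] := sf n x; rewrite /cderiven/=; split.
  - by rewrite derive1E; exact: derivableP.
  - by rewrite derive1E; exact: derivableP.
by move=> m n; have [C fC] := bf m n; exists C => x; apply: fC; exists x.
Qed.

Lemma schwartz_cderiven n f : schwartz f -> schwartz (cderiven n f).
Proof.
move=> /schwartz_seqP[df bf].
have := @schwartz_seq_intro (fun m => cderiven (n + m) f).
rewrite addn0; apply; split => [m|m p]; rewrite ?addnS//; exact: bf.
Qed.

Lemma cderiven_cderiven m n f : schwartz f -> cderiven m (cderiven n f) = cderiven (m + n) f.
Proof.
move=> /schwartz_seqP[df bf].
have := @schwartz_seq_cderiven (fun m => cderiven (n + m) f).
rewrite addn0 addnC; apply; split => [p|p q]; rewrite ?addnS//; exact: bf.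
Qed.

Lemma schwartz_cder f : schwartz f -> cder f (cderiven 1 f).
Proof. by move=> /schwartz_seqP[/(_ 0)]; rewrite cderiven0. Qed.

Lemma schwartz_cmeas f : schwartz f -> cmeas f.
Proof. by move=> /schwartz_cder /cder_cmeas. Qed.

Lemma schwartz_bound m f : schwartz f ->
  exists2 C : R, 0 <= C & forall x, `|x| ^+ m * normc (f x) <= C.
Proof.
move=> /schwartz_seqP[_ /(_ m 0)][C fC]; rewrite cderiven0 in fC.
by exists C => //; rewrite (le_trans _ (fC 0))// mulr_ge0 ?exprn_ge0 ?normc_ge0.
Qed.

Lemma schwartz_jap_bound n f : schwartz f ->
  exists2 C : R, 0 <= C & forall x, jap x ^+ n * normc (f x) <= C.
Proof.
move=> sf; have [C C0 fC] := schwartz_bound 0 sf.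
have [D D0 fD] := schwartz_bound (2 * n) sf.
exists (2 ^+ n * (C + D)); first by rewrite mulr_ge0 ?exprn_ge0// addr_ge0.
move=> x; rewrite (le_trans (ler_wpM2r (normc_ge0 _) (jap_expn_le n x)))//.
rewrite -mulrA ler_wpM2l ?exprn_ge0// mulrDl lerD//.
by have := fC x; rewrite expr0.
Qed.

Lemma schwartz_jap_bound1 n f : schwartz f ->
  exists2 C : R, 0 <= C & forall x, jap x ^+ n * normc (f x) <= C * (jap x)^-1.
Proof.
move=> sf; have [C C0 fC] := schwartz_jap_bound n.+1 sf; exists C => // x.
rewrite ler_pdivlMr ?jap_gt0//.
by have := fC x; rewrite exprSr mulrAC.
Qed.

Lemma cintegrable_jap_bound f C : cmeas f -> (forall x, normc (f x) <= C * (jap x)^-1) ->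
  cintegrable f.
Proof.
move=> mf fC; apply: (cintegrable_le mf fC).
by apply: integrable_scale; exact: integrable_japV.
Qed.

Lemma schwartz_cintegrable f : schwartz f -> cintegrable f.
Proof.
move=> sf; have [C _ fC] := schwartz_jap_bound1 0 sf.
apply: (@cintegrable_jap_bound _ C); first exact: schwartz_cmeas.
by move=> x; have := fC x; rewrite expr0 mul1r.
Qed.

Lemma schwartz_lin (c : R[i]) f g : schwartz f -> schwartz g ->
  schwartz (fun x => c * f x + g x).
Proof.
move=> /schwartz_seqP[df bf] /schwartz_seqP[dg bg].
have := @schwartz_seq_intro (fun n x => c * cderiven n f x + cderiven n g x).
rewrite !cderiven0; apply; split.
  move=> n; have := cderD (cderM (cder_cst c) (df n)) (dg n).
  by under [X in cder _ X]eq_fun do rewrite mul0r add0r.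
move=> m n; have [C fC] := bf m n; have [D gD] := bg m n.
exists (normc c * C + D) => x.
rewrite (le_trans (ler_wpM2l (exprn_ge0 _ (normr_ge0 _)) (ler_normcD _ _)))// mulrDr lerD//.
by rewrite normcM mulrCA ler_wpM2l ?normc_ge0.
Qed.

Lemma schwartzZ c f : schwartz f -> schwartz (fun x => c * f x).
Proof.
(* Writing c f as (c - 1) f + f dispenses with the zero function as second summand. *)
move=> sf; have := schwartz_lin (c - 1) sf sf.
by under eq_fun do rewrite mulrBl mul1r subrK.
Qed.

Lemma schwartz_mulx f : schwartz f -> schwartz (fun x => x%:C * f x).
Proof.
move=> /schwartz_seqP[df bf].
have := @schwartz_seq_intro
  (* Leibniz's formula for the n-th derivative of x f. At n = 0 the truncated predecessor is
     harmless because its coefficient is 0. *)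
  (fun n x => x%:C * cderiven n f x + n%:R * cderiven n.-1 f x).
rewrite [X in schwartz X](_ : _ = fun x => x%:C * f x); last first.
  by apply/funext => x; rewrite cderiven0 mul0r addr0.
have dx : cder (fun x : R => x%:C) (fun=> 1%:C) by apply: cder_real => x; exact: is_derive_id.
apply; split.
  move=> [|n] /=.
    have := cderM dx (df 0).
    rewrite [X in cder X _ -> _](_ : _ = fun x => x%:C * cderiven 0 f x + 0%:R * cderiven 0 f x);
      last by apply/funext => x; rewrite mul0r addr0.
    by under [X in cder _ X -> _]eq_fun do rewrite addrC.
  have := cderD (cderM dx (df n.+1)) (cderM (cder_cst n.+1%:R) (df n)).
  rewrite [X in cder _ X -> _](_ : _ = fun x => x%:C * cderiven n.+2 f x + n.+2%:R * cderiven n.+1 f x)//.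
  by apply/funext => x; rewrite [n.+2%:R]mulrS; ring.
move=> m n; have [C fC] := bf m.+1 n; have [D fD] := bf m n.-1.
exists (C + n%:R * D) => x.
rewrite (le_trans (ler_wpM2l (exprn_ge0 _ (normr_ge0 _)) (ler_normcD _ _)))// mulrDr lerD//.
  by rewrite normcM normc_real mulrA -exprSr.
have -> : (n%:R : R[i]) = (n%:R : R)%:C by rewrite rmorph_nat.
by rewrite normcM normc_real normr_nat mulrCA ler_wpM2l.
Qed.

Lemma schwartz_affine (a b : R) f : a != 0 -> schwartz f ->
  schwartz (fun x => f (a * x + b)).
Proof.
move=> a0 sf; have [df _] := schwartz_seqP sf.
have := @schwartz_seq_intro (fun n x => (a ^+ n)%:C * cderiven n f (a * x + b)).
rewrite [X in schwartz X](_ : _ = fun x => f (a * x + b)); last first.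
  by apply/funext => x; rewrite cderiven0 expr0 mul1r.
apply; split.
  move=> n; have := cderM (cder_cst (a ^+ n)%:C) (cder_affine a b (df n)).
  by under [X in cder _ X -> _]eq_fun do rewrite mul0r add0r mulrA -realCM -exprSr.
move=> m n; have [C C0 fC] := schwartz_jap_bound m (schwartz_cderiven n sf).
(* With y = a x + b one has x = (y - b) / a, and the power of |y - b| is at most 4^m jap(y)^m
   jap(b)^m; [C] then bounds the decay of the derivative at [y]. *)
exists (`|a| ^+ n * (`|a|^-1 ^+ m * (4 ^+ m * jap b ^+ m * C))) => x.
rewrite normcM normc_real normrX mulrCA ler_wpM2l ?exprn_ge0//.
set y := a * x + b; have xE : x = a^-1 * (y - b) by rewrite /y addrK mulKf.
rewrite {1}xE normrM normfV exprMn -[leLHS]mulrA ler_wpM2l ?exprn_ge0 ?invr_ge0//.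
rewrite (le_trans (ler_wpM2r (normc_ge0 _) (expr_norm_le_jap m (y - b))))//.
rewrite (le_trans (ler_wpM2r (normc_ge0 _) (jap_expn_add m y (- b))))// japN.
rewrite [leLHS](_ : _ = 4 ^+ m * jap b ^+ m * (jap y ^+ m * normc (cderiven n f y))).
  by rewrite ler_wpM2l ?mulr_ge0 ?exprn_ge0 ?jap_ge0.
ring.
Qed.

Lemma schwartz_seminorm_ge0 m n f : 0 <= schwartz_seminorm m n f.
Proof.
have [[_ hs]|] := pselect (has_sup (schwartz_values m n f)); last first.
  (* Without a supremum, [sup] takes the value 0. *)
  by move=> h; rewrite /schwartz_seminorm sup_out.
apply: (@le_trans _ _ (`|0 : R| ^+ m * normc (cderiven n f 0))).
  by rewrite mulr_ge0 ?exprn_ge0 ?normc_ge0.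
apply: ub_le_sup; first exact: hs.
by exists (0 : R).
Qed.

Lemma le_schwartz_seminorm m n f x : schwartz f ->
  `|x| ^+ m * normc (cderiven n f x) <= schwartz_seminorm m n f.
Proof. by move=> [_ bf]; apply: ub_le_sup; [exact: bf|exists x]. Qed.

Definition seminorm_sum N f : R := \sum_(m < N) \sum_(n < N) schwartz_seminorm m n f.

Lemma seminorm_sum_ge0 N f : 0 <= seminorm_sum N f.
Proof. by do 2!apply: sumr_ge0 => ? _; exact: schwartz_seminorm_ge0. Qed.

Lemma le_seminorm_sum N m n f : (m < N)%N -> (n < N)%N ->
  schwartz_seminorm m n f <= seminorm_sum N f.
Proof.
move=> mN nN; rewrite /seminorm_sum (bigD1 (Ordinal mN))//= (bigD1 (Ordinal nN))//= -addrA lerDl.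
rewrite addr_ge0//; first by apply: sumr_ge0 => ? _; exact: schwartz_seminorm_ge0.
by do 2!apply: sumr_ge0 => ? _; exact: schwartz_seminorm_ge0.
Qed.

End schwartz.

(** * The Fourier transform on Schwartz space *)

Section fourier_schwartz.
Context {R : realType}.
Implicit Types (f g : R -> R[i]).

Lemma cmeas_fourier_kernel k : cmeas (fun x : R => expi (- (k * x))).
Proof. by apply: cmeas_expi; apply: measurable_funN; exact: measurable_funM. Qed.

Lemma cintegrable_fourier k f : cintegrable f ->
  cintegrable (fun x => f x * expi (- (k * x))).
Proof.
move=> intf; apply: (cintegrable_bounded_mul (C := 1)) => //.
- exact: cmeas_fourier_kernel.
- by move=> x; rewrite normc_expi.
Qed.

Lemma fourier_lin c f g : cintegrable f -> cintegrable g ->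
  fourier (fun x => c * f x + g x) = fun k => c * fourier f k + fourier g k.
Proof.
move=> intf intg; apply/funext => k; rewrite /fourier -cintegralZ; last exact: cintegrable_fourier.
rewrite -cintegralD; last 2 first.
- by apply: cintegrableZ; exact: cintegrable_fourier.
- exact: cintegrable_fourier.
by apply: eq_cintegral => x; rewrite mulrDl mulrA.
Qed.

Lemma fourierZ c f : cintegrable f -> fourier (fun x => c * f x) = fun k => c * fourier f k.
Proof.
move=> intf; apply/funext => k; rewrite /fourier -cintegralZ; last exact: cintegrable_fourier.
by apply: eq_cintegral => x; rewrite mulrA.
Qed.

Lemma ifourierE F x : ifourier F x = ((2 * pi)^-1)%:C * fourier F (- x) :> R[i].
Proof. by rewrite /fourier; under eq_cintegral do rewrite mulNr opprK mulrC -[x * _]mulrC mulrC. Qed.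

Lemma le_fourier f k : cintegrable f ->
  normc (fourier f k) <= 2 * \int[mu]_x normc (f x).
Proof.
move=> intf; apply: normc_cintegral_le.
- exact: cintegrable_cmeas (cintegrable_fourier k intf).
- by move=> x; rewrite normcM normc_expi mulr1.
- exact: integrable_normc.
Qed.

Lemma cder_expiN (k : R) :
  cder (fun x : R => expi (- (k * x))) (fun x : R => (0 +i* - k) * expi (- (k * x))).
Proof.
have := cder_expi (- k).
have -> : (fun x : R => expi (- k * x)) = (fun x => expi (- (k * x))).
  by apply/funext => x; rewrite mulNr.
have -> // : (fun x : R => (0 +i* - k) * expi (- k * x)) = (fun x => (0 +i* - k) * expi (- (k * x))).
by apply/funext => x; rewrite mulNr.
Qed.

Lemma cder_fourier f : cintegrable f -> cintegrable (fun x => x%:C * f x) ->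
  cder (fourier f) (fourier (fun x => (0 +i* -1) * (x%:C * f x))).
Proof.
move=> intf intxf; rewrite /fourier.
apply: (@cder_cintegral _ (fun k x => f x * expi (- (k * x)))
  (fun k x => (0 +i* -1) * (x%:C * f x) * expi (- (k * x))) (fun x => normc (x%:C * f x))).
- by move=> k; exact: cintegrable_fourier.
- move=> x; have := cderM (cder_cst (f x)) (cder_expiN x).
  have -> : (fun k : R => f x * expi (- (x * k))) = (fun k => f x * expi (- (k * x))).
    by apply/funext => k; rewrite [x * k]mulrC.
  have -> // : (fun k : R => 0 * expi (- (x * k)) + f x * ((0 +i* - x) * expi (- (x * k)))) =
    (fun k => (0 +i* -1) * (x%:C * f x) * expi (- (k * x))).
  apply/funext => k; rewrite mul0r add0r [x * k]mulrC.
  have -> : 0 +i* - x = (0 +i* -1) * x%:C :> R[i].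
    by apply: complex_eqP; rewrite ?cReM ?cImM/=; ring.
  by ring.
- by move=> k x; rewrite normcM normc_expi mulr1 normcM normc_imag normrN1 mul1r.
- exact: integrable_normc.
Qed.

Lemma cintegral_derive0 f g C : cder f g -> cder g (cderiven 1 g) -> cintegrable g ->
  (forall x, `|x| * normc (f x) <= C) -> cintegral g = 0.
Proof.
move=> df dg [g1 g2] fC; apply: complex_eqP => /=.
- apply: (@Rintegral_derive0 _ (fun x => Re (f x)) _ C) => //.
  + by move=> x; have [] := df x.
  + by move=> x; have [dgx _] := dg x; exact: is_derive_continuous dgx.
  + by move=> x; rewrite (le_trans _ (fC x))// ler_wpM2l// ler_Re_normc.
- apply: (@Rintegral_derive0 _ (fun x => Im (f x)) _ C) => //.
  + by move=> x; have [] := df x.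
  + by move=> x; have [_ dgx] := dg x; exact: is_derive_continuous dgx.
  + by move=> x; rewrite (le_trans _ (fC x))// ler_wpM2l// ler_Im_normc.
Qed.

(** Integration by parts: the derivative [g] of f(x) exp(-ikx) has zero integral because f(x)
    exp(-ikx) decays at least like 1/|x|. *)
Lemma fourier_cderiven1 f k : schwartz f ->
  fourier (cderiven 1 f) k = (0 +i* k) * fourier f k.
Proof.
move=> sf.
have dfe := cder_expiN k.
have sf1 := schwartz_cderiven 1 sf.
have i0 := cintegrable_fourier k (schwartz_cintegrable sf).
have i1 := cintegrable_fourier k (schwartz_cintegrable sf1).
have df := cderM (schwartz_cder sf) dfe.
have df1 := cderM (schwartz_cder sf1) dfe.
have [C C0 fC] := schwartz_bound 1 sf.
set g := (fun x => cderiven 1 f x * expi _ + _) in df.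
have gE : g = fun x => cderiven 1 f x * expi (- (k * x)) - (0 +i* k) * (f x * expi (- (k * x))).
  apply/funext => x; rewrite /g; have -> : 0 +i* - k = - (0 +i* k) :> R[i].
    by apply: complex_eqP => /=; rewrite ?oppr0.
  by ring.
have ig : cintegrable g.
  by rewrite gE; apply: cintegrableB => //; exact: cintegrableZ.
have dg := cderD df1 (cderM (cder_cst (- (0 +i* k))) df).
have /eqP : cintegral g = 0.
  apply: (@cintegral_derive0 (fun x => f x * expi (- (k * x))) g C) => //.
  - move: dg; rewrite [X in cder X _ -> _](_ : _ = g).
      move=> dg x; have [a b] := dg x; split; rewrite /cderiven/= derive1E.
        exact: derivableP.
      exact: derivableP.
    by apply/funext => x; rewrite gE; ring.
  - by move=> x; have := fC x; rewrite expr1 normcM normc_expi mulr1.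
rewrite gE cintegralB//; last exact: cintegrableZ.
by rewrite cintegralZ// subr_eq0 => /eqP.
Qed.

Lemma fourier_cderiven n f k : schwartz f ->
  fourier (cderiven n f) k = (0 +i* k) ^+ n * fourier f k.
Proof.
move=> sf; elim: n => [|n IH]; first by rewrite cderiven0 expr0 mul1r.
have -> : cderiven n.+1 f = cderiven 1 (cderiven n f) by rewrite cderiven_cderiven.
rewrite fourier_cderiven1 ?IH ?exprS ?mulrA//; exact: schwartz_cderiven.
Qed.

(** The function (-ix)^n f(x), whose transform is the n-th derivative of the transform of [f]. *)
Definition xmul n f : R -> R[i] := fun x => ((0 +i* -1) * x%:C) ^+ n * f x.

Lemma xmulS n f : xmul n.+1 f = fun x => (0 +i* -1) * (x%:C * xmul n f x).
Proof. by apply/funext => x; rewrite /xmul exprS; ring. Qed.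

Lemma schwartz_xmul n f : schwartz f -> schwartz (xmul n f).
Proof.
move=> sf; elim: n => [|n IH].
  by have -> : xmul 0 f = f by apply/funext => x; rewrite /xmul expr0 mul1r.
by rewrite xmulS; apply: schwartzZ; exact: schwartz_mulx.
Qed.

Lemma normc_expn (z : R[i]) n : normc (z ^+ n) = normc z ^+ n.
Proof. by elim: n => [|n IH]; rewrite ?expr0 ?normc1// !exprS normcM IH. Qed.

Lemma fourier_bound m f k : schwartz f ->
  `|k| ^+ m * normc (fourier f k) <= 2 * \int[mu]_x normc (cderiven m f x).
Proof.
move=> sf; rewrite -normc_imag -normc_expn -normcM -fourier_cderiven//.
by apply: le_fourier; apply: schwartz_cintegrable; exact: schwartz_cderiven.
Qed.

Lemma schwartz_fourier f : schwartz f -> schwartz (fourier f).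
Proof.
move=> sf; have := @schwartz_seq_intro _ (fun n => fourier (xmul n f)).
have -> : xmul 0 f = f by apply/funext => x; rewrite /xmul expr0 mul1r.
apply; split.
  move=> n; rewrite xmulS; apply: cder_fourier.
  - by apply: schwartz_cintegrable; exact: schwartz_xmul.
  - by apply: schwartz_cintegrable; apply: schwartz_mulx; exact: schwartz_xmul.
move=> m n; exists (2 * \int[mu]_x normc (cderiven m (xmul n f) x)) => k.
by apply: fourier_bound; exact: schwartz_xmul.
Qed.

Lemma schwartz_opp f : schwartz f -> schwartz (fun x => f (- x)).
Proof.
move=> sf; have := @schwartz_affine _ (-1) 0 f _ sf.
by under eq_fun do rewrite mulN1r addr0; apply; rewrite oppr_eq0 oner_eq0.
Qed.

Lemma schwartz_ifourier f : schwartz f -> schwartz (ifourier f).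
Proof.
move=> sf; rewrite (_ : ifourier f = fun x => ((2 * pi)^-1)%:C * fourier f (- x)).
  by apply: schwartzZ; apply: schwartz_opp; exact: schwartz_fourier.
by apply/funext => x; rewrite ifourierE.
Qed.

Lemma ifourier_lin c f g : cintegrable f -> cintegrable g ->
  ifourier (fun x => c * f x + g x) = fun k => c * ifourier f k + ifourier g k.
Proof.
move=> intf intg; apply/funext => k; rewrite !ifourierE fourier_lin//; ring.
Qed.

(** Quantitative continuity of the Fourier transform on Schwartz space, with constants independent
    of [f] as temperedness requires. Derivatives up to order 2n supply the decay in [k], and weights
    up to |x|^2 make them integrable against 1 / jap; the index 2n + 3 exceeds both 2n and 2. *)
Lemma fourier_jap_bound n : exists2 C : R, 0 <= C & forall f k, schwartz f ->
  jap k ^+ n * normc (fourier f k) <= C * seminorm_sum (2 * n + 3) f.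
Proof.
pose I := \int[mu]_x (jap x)^-1 : R.
have I0 : 0 <= I by apply: Rintegral_ge0 => x _; rewrite invr_ge0 jap_ge0.
exists (2 ^+ n * (2 * I * 4)); first by rewrite mulr_ge0 ?exprn_ge0// !mulr_ge0.
move=> f k sf.
set N := (2 * n + 3)%N; have S0 : 0 <= seminorm_sum N f by exact: seminorm_sum_ge0.
have int m : (m <= 2 * n)%N -> 2 * \int[mu]_x normc (cderiven m f x) <= 2 * I * (2 * seminorm_sum N f).
  move=> mn; rewrite -mulrA ler_wpM2l// mulrC -RintegralZl//; last exact: integrable_japV.
  have sfm := schwartz_cderiven m sf.
  apply: le_Rintegral => //.
  - exact: integrable_normc (schwartz_cintegrable sfm).
  - by apply: integrable_scale; exact: integrable_japV.
  - move=> x _; rewrite ler_pdivlMr ?jap_gt0// /jap mulrDr mulr1 mulr_natl mulr2n lerD//.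
      have := le_schwartz_seminorm 0 m x sf; rewrite expr0 mul1r => /le_trans; apply.
      by apply: le_seminorm_sum; rewrite /N ?addn3// ltnS (leq_trans mn)// leqW.
    have := le_schwartz_seminorm 2 m x sf; rewrite real_normK ?num_real// mulrC => /le_trans; apply.
    by apply: le_seminorm_sum; rewrite /N ?addn3// ltnS (leq_trans mn)// leqW.
rewrite (le_trans (ler_wpM2r (normc_ge0 _) (jap_expn_le n k)))//.
rewrite -!mulrA ler_wpM2l ?exprn_ge0// mulrDl mul1r.
have h0 := fourier_bound 0 k sf; have hn := fourier_bound (2 * n) k sf.
rewrite expr0 mul1r in h0.
have := lerD (le_trans h0 (int 0 _)) (le_trans hn (int (2 * n)%N _)).
move=> /(_ (leq0n _) (leqnn _)) => /le_trans; apply.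
by rewrite le_eqVlt; apply/orP; left; apply/eqP; ring.
Qed.

End fourier_schwartz.

Lemma is_derive_expR_comp (R : realType) (f : R -> R) (x d : R) :
  is_derive x 1 f d -> is_derive x 1 (fun y => expR (f y)) (d * expR (f x)).
Proof.
by move=> df; have := is_derive1_comp (is_derive_expR (f x)) df; rewrite mulrC.
Qed.

(** * Fourier inversion *)

Section real_scalars.
Context {R : realType}.
Implicit Types (a : R) (z : R[i]) (f : R -> R[i]).

Lemma cReMr z a : Re (z * a%:C) = Re z * a. Proof. by rewrite cReM mulr0 subr0. Qed.
Lemma cImMr z a : Im (z * a%:C) = Im z * a. Proof. by rewrite cImM mulr0 add0r. Qed.

Lemma Re_cintegral f : Re (cintegral f) = \int[mu]_x Re (f x). Proof. by []. Qed.
Lemma Im_cintegral f : Im (cintegral f) = \int[mu]_x Im (f x). Proof. by []. Qed.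

End real_scalars.

Section gaussian.
Context {R : realType}.
Local Notation gauss := (@gauss_fun R).

Lemma is_derive_gauss (x : R) : is_derive x 1 gauss (- (2 * x) * gauss x).
Proof.
rewrite /gauss_fun.
have d2 : is_derive x 1 (fun x : R => - x ^+ 2) (- (2 * x)).
  by apply: is_derive_eq; rewrite /GRing.scale/=; ring.
exact: is_derive_expR_comp d2.
Qed.

Lemma gauss_opp (x : R) : gauss (- x) = gauss x.
Proof. by rewrite /gauss_fun sqrrN. Qed.

Lemma gauss0 : gauss 0 = 1.
Proof. by rewrite /gauss_fun expr0n/= oppr0 expR0. Qed.

Lemma poly_gauss_bound (p : {poly R}) m :
  exists C : R, forall x, `|x| ^+ m * `|p.[x] * gauss x| <= C.
Proof.
elim/poly_ind: p m => [|p c IH] m.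
  by exists 0 => x; rewrite horner0 mul0r normr0 mulr0.
have [C pC] := IH m.+1.
have [D gD] : exists D : R, forall x, `|x| ^+ m * gauss x <= D.
  (* The factorial comes from exp(x^2) >= x^(2m) / m!. *)
  exists (2 ^+ m * (1 + m`!%:R)) => x.
  rewrite (le_trans (ler_wpM2r (gauss_fun_ge0 _) (expr_norm_le_jap m x)))//.
  rewrite (le_trans (ler_wpM2r (gauss_fun_ge0 _) (jap_expn_le m x)))//.
  rewrite -mulrA ler_wpM2l ?exprn_ge0// mulrDl mul1r lerD ?gauss_fun_le1//.
  rewrite exprM real_normK ?num_real// /gauss_fun expRN ler_pdivrMr ?expR_gt0//.
  case: m {IH pC} => [|m].
    by rewrite expr0 fact0 mul1r -expR0 ler_expR sqr_ge0.
  rewrite mulrC -ler_pdivrMr ?ltr0n ?fact_gt0//.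
  have := @expR_ge1Dxn R (x ^+ 2) m (sqr_ge0 x); apply: le_trans.
  by rewrite lerDr.
exists (C + `|c| * D) => x.
rewrite hornerMXaddC mulrDl (le_trans (ler_wpM2l _ (ler_normD _ _))) ?exprn_ge0//.
rewrite mulrDr lerD//.
  by rewrite (le_trans _ (pC x))// !normrM exprSr le_eqVlt; apply/orP; left; apply/eqP; ring.
rewrite normrM mulrCA ler_wpM2l// [`|gauss x|]ger0_norm ?gauss_fun_ge0//.
Qed.

Lemma schwartz_gauss : schwartz (fun x => (gauss x)%:C).
Proof.
(* The polynomial factor of the n-th derivative of exp(-x^2): the Hermite polynomial up to sign. *)
pose p := fix p n : {poly R} := if n is n'.+1 then (p n')^`() - 2%:P * 'X * p n' else 1.
have := @schwartz_seq_intro _ (fun n x => ((p n).[x] * gauss x)%:C).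
rewrite [X in schwartz X](_ : _ = fun x => (gauss x)%:C); last first.
  by apply/funext => x; rewrite /= hornerC mul1r.
apply; split.
  move=> n; apply: cder_real => x.
  have := is_deriveM (is_derive_poly (p n) x) (is_derive_gauss x).
  rewrite /GRing.scale/=; set d := (X in is_derive _ _ _ X).
  rewrite (_ : d = (p n.+1).[x] * gauss x)//.
  by rewrite /d /= hornerD hornerN !hornerM hornerC hornerX; ring.
move=> m n; have [C pC] := poly_gauss_bound (p n) m.
by exists C => x; rewrite normc_real.
Qed.

Lemma cintegral_gauss : cintegral (fun x => (gauss x)%:C) = (Num.sqrt pi)%:C.
Proof. by rewrite cintegral_real /Rintegral integralT_gauss. Qed.

(** The transform [G] satisfies G' = -(k/2) G, since multiplication by -ix of the Gaussian is i/2
    times its derivative. Hence G(k) exp(k^2/4) is constant, and its value at 0 is the Gaussian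
    integral. *)
Lemma fourier_gauss (k : R) :
  fourier (fun x => (gauss x)%:C) k = (Num.sqrt pi * gauss (k / 2))%:C.
Proof.
set g := fun x => (gauss x)%:C; have sg : schwartz g by exact: schwartz_gauss.
pose G := fourier g.
have xg : (fun x => (0 +i* -1) * (x%:C * g x)) = fun x => (0 +i* 2^-1) * cderiven 1 g x.
  apply/funext => x; rewrite (cder_unique (schwartz_cder sg) (cder_real is_derive_gauss)).
  by apply: complex_eqP; rewrite ?cReM ?cImM/=; field.
have dG : cder G (fun k => (- (k / 2))%:C * G k).
  have := cder_fourier (schwartz_cintegrable sg) (schwartz_cintegrable (schwartz_mulx sg)).
  rewrite xg fourierZ; last exact: schwartz_cintegrable (schwartz_cderiven 1 sg).
  have -> // : (fun k : R => (0 +i* 2^-1) * fourier (cderiven 1 g) k) =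
     (fun k => (- (k / 2))%:C * G k).
  apply/funext => z; rewrite fourier_cderiven1// mulrA; congr (_ * _).
  by apply: complex_eqP; rewrite ?cReM ?cImM/=; field.
pose E (z : R) := expR ((z / 2) ^+ 2).
have dE : cder (fun z => (E z)%:C) (fun z => (z / 2 * E z)%:C).
  apply: cder_real => z; rewrite /E.
  have d2 : is_derive z 1 (fun x : R => (x / 2) ^+ 2) (z / 2).
    by apply: is_derive_eq; rewrite /GRing.scale/=; field.
  exact: is_derive_expR_comp d2.
have dH := cderM dG dE.
have H0 (z : R) : is_derive z 1 (fun z => Re (G z * (E z)%:C)) 0 /\
            is_derive z 1 (fun z => Im (G z * (E z)%:C)) 0.
  have [a b] := dH z.
  suff E0 : (- (z / 2))%:C * G z * (E z)%:C + G z * (z / 2 * E z)%:C = 0.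
    by rewrite E0 in a b.
  rewrite realCM [(- _)%:C]rmorphN/=; ring.
have cH z : G z * (E z)%:C = G 0 * (E 0)%:C.
  apply: complex_eqP.
  - exact: (@is_derive_0_is_cst _ (fun z => Re (G z * (E z)%:C)) z 0 (fun z => (H0 z).1)).
  - exact: (@is_derive_0_is_cst _ (fun z => Im (G z * (E z)%:C)) z 0 (fun z => (H0 z).2)).
have G0 : G 0 = (Num.sqrt pi)%:C.
  rewrite -cintegral_gauss /G /fourier; apply: eq_cintegral => x.
  by rewrite mul0r oppr0 expi0 mulr1.
have := cH k; rewrite G0 /E mul0r expr0n/= expR0 mulr1 => GE.
rewrite /G in GE.
have -> : fourier g k = fourier g k * (E k)%:C * (gauss (k / 2))%:C.
  by rewrite -mulrA -realCM /E /gauss_fun -expRD subrr expR0 mulr1.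
by rewrite GE -realCM.
Qed.

Lemma fourier_scale (a k : R) f : a != 0 -> cintegrable f ->
  fourier (fun x => f (a * x)) k = (`|a|^-1)%:C * fourier f (k / a).
Proof.
move=> a0 intf; rewrite /fourier.
rewrite -(cintegral_affine 0 a0 (cintegrable_fourier (k / a) intf)).
by apply: eq_cintegral => x; rewrite addr0 mulrA divfK.
Qed.

Lemma inv_natS_gt0 n : 0 < n.+1%:R^-1 :> R. Proof. by rewrite invr_gt0. Qed.

Lemma cvg_inv_natS : n.+1%:R^-1 @[n --> \oo] --> (0 : R).
Proof. exact: cvg_harmonic. Qed.

Lemma integrable_gauss : mu.-integrable setT (EFin \o gauss).
Proof. exact: integrableT_gauss. Qed.

(** Averages against Gaussians of width 1/(n+1) converge at every continuity point, with [B * gauss]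
    as majorant. Continuity is asked only at [x], so that functions with jumps can be mollified
    too. *)
Lemma gauss_approximation (h : R -> R) (B x : R) : measurable_fun setT h ->
  (forall y, `|h y| <= B) -> {for x, continuous h} ->
  \int[mu]_y (h (x - n.+1%:R^-1 * y) * gauss y) @[n --> \oo] --> h x * Num.sqrt pi.
Proof.
move=> mh hB ch.
have -> : h x * Num.sqrt pi = \int[mu]_y (h x * gauss y).
  by rewrite RintegralZl//; [rewrite /Rintegral integralT_gauss|exact: integrable_gauss].
apply: (@Rintegral_dominated_cvg _ _ _ (fun y => B * gauss y)).
- move=> n; apply: measurable_funM; last exact: measurable_gauss_fun.
  apply: (measurableT_comp mh); apply: measurable_funB => //; exact: measurable_funM.
- by apply: measurable_funM => //; exact: measurable_gauss_fun.
- apply: aeW => y; apply: cvgM; last exact: cvg_cst.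
  apply: (continuous_cvg _ ch).
  rewrite -[X in _ --> X]subr0; apply: cvgB; first exact: cvg_cst.
  by rewrite -(mul0r y); apply: cvgM; [exact: cvg_inv_natS|exact: cvg_cst].
- by apply: integrable_scale; exact: integrable_gauss.
- by move=> n y; rewrite normrM ler_pM// ger0_norm// gauss_fun_ge0.
Qed.

End gaussian.

Section fourier_inversion.
Context {R : realType}.
Local Notation gauss := (@gauss_fun R).
Implicit Types (f g : R -> R[i]).

Lemma gauss_cvg1 (a : R) : gauss (n.+1%:R^-1 * a) @[n --> \oo] --> (1 : R).
Proof.
have cg : {for 0, continuous gauss} by exact: continuous_gauss_fun.
have h : n.+1%:R^-1 * a @[n --> \oo] --> 0.
  by rewrite -[X in _ --> X](mul0r a); apply: cvgM; [exact: cvg_inv_natS|exact: cvg_cst].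
by rewrite -[X in _ --> X]gauss0; exact: (@continuous_cvg _ _ _ _ _ _ gauss _ cg h).
Qed.

Lemma gauss_summation (A : R -> R) : mu.-integrable setT (EFin \o A) ->
  \int[mu]_k (A k * gauss (n.+1%:R^-1 * (k / 2))) @[n --> \oo] --> \int[mu]_k A k.
Proof.
move=> iA; have mA := (measurable_EFinP _ _).1 (measurable_int _ iA).
apply: (@Rintegral_dominated_cvg _ _ _ (fun k => `|A k|)) => //.
- move=> n; apply: measurable_funM => //.
  apply: (measurableT_comp measurable_gauss_fun).
  by apply: measurable_funM => //; exact: measurable_funM.
- apply: aeW => k; rewrite -[X in _ --> X]mulr1.
  by apply: cvgM; [exact: cvg_cst|exact: gauss_cvg1].
- exact: integrable_norm.
- move=> n k; rewrite normrM ler_piMr// ger0_norm ?gauss_fun_ge0//.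
  exact: gauss_fun_le1.
Qed.

(** The multiplication formula, which makes the transform of distributions extend that of
    functions. *)
Lemma fourier_fubini f g : cintegrable f -> cintegrable g ->
  cintegral (fun k => g k * fourier f k) = cintegral (fun x => f x * fourier g x).
Proof.
move=> intf intg; pose K (p : R * R) : R[i] := expi (- (p.1 * p.2)).
have mK : cmeas (K : measurableTypeR R * measurableTypeR R -> R[i]).
  apply: cmeas_expi; apply: measurable_funN; apply: measurable_funM.
  - exact: measurable_fst.
  - exact: measurable_snd.
have K1 p : normc (K p) <= 1 by rewrite normc_expi.
have := cintegral_fubini_kernel intg intf mK K1; rewrite /K/= => E.
rewrite /fourier E; apply: eq_cintegral => x; congr (_ * _).
by apply: eq_cintegral => k; rewrite [k * x]mulrC.
Qed.

Lemma fourier_modulate f (a k : R) :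
  fourier (fun x => f x * expi (a * x)) k = fourier f (k - a).
Proof.
apply: eq_cintegral => x; rewrite -mulrA -expiD; congr (_ * expi _).
by rewrite mulrBl opprB addrC.
Qed.

Lemma gauss_scaled_schwartz (a : R) : a != 0 -> schwartz (fun x => (gauss (a * x))%:C).
Proof.
move=> a0; have := schwartz_affine 0 a0 (@schwartz_gauss R).
by under eq_fun do rewrite addr0.
Qed.

(* Gaussian summation of the inversion integral; both sides converge as [n] grows. *)
Let inversion_approx f x n : schwartz f ->
  cintegral (fun k => fourier f k * expi (x * k) * (gauss (n.+1%:R^-1 * (k / 2)))%:C) =
  (2 * Num.sqrt pi)%:C * cintegral (fun y => f (x - n.+1%:R^-1 * y) * (gauss y)%:C).
Proof.
move=> sf; set e := n.+1%:R^-1; have e0 : 0 < e by exact: inv_natS_gt0.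
have e2 : e / 2 != 0 by rewrite mulf_neq0 ?gt_eqF// invr_gt0.
(* The scale e/2 offsets the factor 1/2 in [fourier_gauss], so that the transform is a Gaussian of
   width e. *)
pose G k := (gauss (e / 2 * k))%:C : R[i].
have sG : schwartz G by exact: gauss_scaled_schwartz.
pose A k := G k * expi (x * k).
have iA : cintegrable A.
  apply: (cintegrable_bounded_mul (C := 1)).
  - exact: schwartz_cintegrable.
  - by apply: cmeas_expi; exact: measurable_funM.
  - by move=> k; rewrite normc_expi.
have -> : cintegral (fun k => fourier f k * expi (x * k) * (gauss (e * (k / 2)))%:C) =
    cintegral (fun k => A k * fourier f k).
  apply: eq_cintegral => k; rewrite /A /G; have -> : e * (k / 2) = e / 2 * k by ring.
  by ring.
rewrite fourier_fubini//; last exact: schwartz_cintegrable.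
have FA y : fourier A y = (2 * Num.sqrt pi * e^-1 * gauss ((y - x) / e))%:C.
  rewrite /A fourier_modulate (@fourier_scale _ _ _ (fun x => (gauss x)%:C))//; last first.
    by apply: cintegrable_real; exact: integrable_gauss.
  rewrite fourier_gauss -realCM gtr0_norm ?divr_gt0//.
  have -> : (y - x) / (e / 2) / 2 = (y - x) / e by field; rewrite gt_eqF.
  by congr (_%:C); field; rewrite gt_eqF.
pose H y := f y * (gauss ((y - x) / e))%:C.
have iH : cintegrable H.
  apply: (cintegrable_bounded_mul (C := 1)); first exact: schwartz_cintegrable.
  - apply: cmeas_real; apply: (measurableT_comp measurable_gauss_fun).
    by apply: measurable_funM => //; exact: measurable_funB.
  - by move=> y; rewrite normc_real ger0_norm ?gauss_fun_ge0// gauss_fun_le1.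
have eN0 : - e != 0 by rewrite oppr_eq0 gt_eqF.
have := cintegral_affine x eN0 iH; rewrite normrN (gtr0_norm e0).
have -> : cintegral (fun y => H (- e * y + x)) = cintegral (fun y => f (x - e * y) * (gauss y)%:C).
  apply: eq_cintegral => y; rewrite /H.
  have -> : (- e * y + x - x) / e = - y by field; rewrite gt_eqF.
  by rewrite gauss_opp mulNr addrC.
move=> ->; rewrite mulrA -realCM -cintegralZ//.
by apply: eq_cintegral => y; rewrite FA /H !realCM; ring.
Qed.

Theorem ifourier_fourier f : schwartz f -> ifourier (fourier f) = f.
Proof.
move=> sf; apply/funext => x.
have sF := schwartz_fourier sf.
have iA : cintegrable (fun k => fourier f k * expi (x * k)).
  apply: (cintegrable_bounded_mul (C := 1)).
  - exact: schwartz_cintegrable.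
  - by apply: cmeas_expi; exact: measurable_funM.
  - by move=> k; rewrite normc_expi.
have [B B0 fB] := schwartz_bound 0 sf.
have fB' y : normc (f y) <= B by have := fB y; rewrite expr0 mul1r.
have cf := schwartz_cder sf x; have [mf1 mf2] := schwartz_cmeas sf.
have pi2 : 2 * Num.sqrt pi * Num.sqrt pi = 2 * pi :> R.
  by rewrite -mulrA -expr2 sqr_sqrtr// pi_ge0.
have pi0 : 2 * pi != 0 :> R by rewrite mulf_neq0// gt_eqF// pi_gt0.
suff : cintegral (fun k => fourier f k * expi (x * k)) = (2 * pi)%:C * f x.
  rewrite /ifourier; under [X in _ = _ -> _ * X = _]eq_cintegral do rewrite [_ * x]mulrC.
  by move=> ->; rewrite mulrA realCV// mul1r.
(* [P] stands for [Re] or [Im]: the convergence lemmas concern real integrals, and both parts are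
   handled by one argument. *)
have part (P : R[i] -> R) : (forall z a, P (z * a%:C) = P z * a) ->
    (forall g, P (cintegral g) = \int[mu]_y P (g y)) -> (forall z, `|P z| <= normc z) ->
    measurable_fun setT (fun y => P (f y)) -> {for x, continuous (fun y => P (f y))} ->
    mu.-integrable setT (EFin \o (fun k => P (fourier f k * expi (x * k)))) ->
    P (cintegral (fun k => fourier f k * expi (x * k))) = P ((2 * pi)%:C * f x).
  move=> PM PI Pn mP cP iP; have PMl a z : P (a%:C * z) = a * P z by rewrite mulrC PM mulrC.
  have c1 := gauss_summation iP.
  have c2 : 2 * Num.sqrt pi * \int[mu]_y (P (f (x - n.+1%:R^-1 * y)) * gauss y)
      @[n --> \oo] --> 2 * Num.sqrt pi * (P (f x) * Num.sqrt pi).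
    apply: cvgM; first exact: cvg_cst.
    apply: (@gauss_approximation _ (fun y => P (f y)) B) => // y.
    by rewrite (le_trans (Pn _)).
  have E : (fun n => \int[mu]_k (P (fourier f k * expi (x * k)) * gauss (n.+1%:R^-1 * (k / 2)))) =
      (fun n => 2 * Num.sqrt pi * \int[mu]_y (P (f (x - n.+1%:R^-1 * y)) * gauss y)).
    apply/funext => n; have := congr1 P (inversion_approx x n sf).
    rewrite PMl !PI.
    under eq_Rintegral do rewrite PM.
    by under [X in _ = _ * X -> _]eq_Rintegral do rewrite PM.
  rewrite E in c1; rewrite PI (cvg_unique _ c1 c2)// PMl -pi2; ring.
apply: complex_eqP.
- by apply: part iA.1 => //; [exact: cReMr|exact: ler_Re_normc|exact: is_derive_continuous cf.1].
- by apply: part iA.2 => //; [exact: cImMr|exact: ler_Im_normc|exact: is_derive_continuous cf.2].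
Qed.

Lemma fourier_opp f k : cintegrable f -> fourier (fun x => f (- x)) k = fourier f (- k).
Proof.
move=> intf; have N0 : (-1 : R) != 0 by rewrite oppr_eq0 oner_eq0.
have := fourier_scale k N0 intf; rewrite normrN1 invr1 mul1r invrN1 mulrN1 => <-.
by congr (fourier _ _); apply/funext => x; rewrite mulN1r.
Qed.

Theorem fourier_ifourier f : schwartz f -> fourier (ifourier f) = f.
Proof.
move=> sf; apply/funext => k.
rewrite (_ : ifourier f = fun x => ((2 * pi)^-1)%:C * fourier f (- x)); last first.
  by apply/funext => x; rewrite ifourierE.
have sF := schwartz_fourier sf.
rewrite fourierZ; last exact: schwartz_cintegrable (schwartz_opp sF).
rewrite fourier_opp; last exact: schwartz_cintegrable.
by rewrite -ifourierE ifourier_fourier.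
Qed.

End fourier_inversion.

(** * Densities of tempered distributions *)

Section du_bois_reymond.
Context {R : realType}.
Local Notation gauss := (@gauss_fun R).

Lemma ae_neq (a : R) : {ae mu, forall x : R, x != a}.
Proof.
exists [set a]; split => //; first exact: lebesgue_measure_set1.
by move=> x /= /negP; rewrite negbK => /eqP.
Qed.

Lemma continuous_indic_itvcc (a b x : R) : x != a -> x != b ->
  {for x, continuous (\1_(`[a, b]%classic) : R -> R)}.
Proof.
move=> xa xb; apply: cvg_near_cst.
have [xlta|xgea] := ltP x a.
  near=> y; rewrite !indicE !memNset//= in_itv/= -?ltNge.
  - by apply/negP; rewrite negb_and -ltNge xlta.
  - apply/negP; rewrite negb_and -ltNge; apply/orP; left.
    by near: y; exact: lt_nbhsl.
have [bltx|bgex] := ltP b x.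
  near=> y; rewrite !indicE !memNset//= in_itv/=.
  - by apply/negP; rewrite negb_and -!ltNge bltx orbT.
  - apply/negP; rewrite negb_and -!ltNge; apply/orP; right.
    by near: y; exact: lt_nbhsr.
have ax : a < x by rewrite lt_neqAle eq_sym xa.
have xb' : x < b by rewrite lt_neqAle xb.
near=> y; rewrite !indicE !mem_set//= in_itv/=; first by rewrite !ltW.
by apply/andP; split; apply: ltW; near: y; [exact: lt_nbhsr|exact: lt_nbhsl].
Unshelve. all: by end_near. Qed.

Lemma Rintegral_fubini_kernel (f g : R -> R) (K : R * R -> R) C :
  mu.-integrable setT (EFin \o f) -> mu.-integrable setT (EFin \o g) ->
  measurable_fun setT (K : measurableTypeR R * measurableTypeR R -> R) ->
  (forall p, `|K p| <= C) ->
  \int[mu]_x (f x * \int[mu]_y (g y * K (x, y))) =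
  \int[mu]_y (g y * \int[mu]_x (f x * K (x, y))).
Proof.
move=> intf intg mK KC; apply: (@complexI R).
have mKc : cmeas (fun p : measurableTypeR R * measurableTypeR R => (K p)%:C) by exact: cmeas_real.
have KcC p : normc (K p)%:C <= C by rewrite normc_real.
have := cintegral_fubini_kernel (cintegrable_real intf) (cintegrable_real intg) mKc KcC.
have E h (a : R) (k : R -> R) : h * cintegral (fun y => (k y)%:C * (K (a, y))%:C) =
    h * (\int[mu]_y (k y * K (a, y)))%:C.
  by congr (_ * _); rewrite -cintegral_real; apply: eq_cintegral => y; rewrite realCM.
have E' h (a : R) (k : R -> R) : h * cintegral (fun y => (k y)%:C * (K (y, a))%:C) =
    h * (\int[mu]_y (k y * K (y, a)))%:C.
  by congr (_ * _); rewrite -cintegral_real; apply: eq_cintegral => y; rewrite realCM.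
under eq_cintegral do rewrite E -realCM.
under [in X in _ = X -> _]eq_cintegral do rewrite E' -realCM.
by rewrite !cintegral_real.
Qed.

Lemma integrable_indic_itv (a b : R) :
  mu.-integrable setT (EFin \o (\1_(`[a, b]%classic) : R -> R)).
Proof.
apply/integrableP; split.
  by apply/measurable_EFinP; exact: measurable_indic.
under eq_integral do rewrite gee0_abs ?lee_fin//.
rewrite [X in (X < _)%E](_ : _ = mu `[a, b]%classic); last first.
  by rewrite -[X in _ = mu X]setIT -integral_indic.
by rewrite lebesgue_measure_itv/=; case: ifP => // _; rewrite ltry.
Qed.

Lemma normr_Rintegral_le (f g : R -> R) : measurable_fun setT f ->
  (forall x, `|f x| <= g x) -> mu.-integrable setT (EFin \o g) ->
  `|\int[mu]_x f x| <= \int[mu]_x g x.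
Proof.
move=> mf fg ig; have intf : mu.-integrable setT (EFin \o f).
  apply: (le_integrable measurableT _ _ ig); first exact/measurable_EFinP.
  by move=> x _ /=; rewrite lee_fin (le_trans (fg x))// ler_norm.
apply: (le_trans (le_normr_Rintegral measurableT intf)).
by apply: le_Rintegral => //; exact: integrable_norm.
Qed.

Lemma integrable_bounded_mul (f g : R -> R) C : mu.-integrable setT (EFin \o f) ->
  measurable_fun setT g -> (forall x, `|g x| <= C) ->
  mu.-integrable setT (EFin \o (fun x => f x * g x)).
Proof.
move=> intf mg gC; have mf := (measurable_EFinP _ _).1 (measurable_int _ intf).
apply: (le_integrable measurableT _ _ (integrable_scale C (integrable_norm intf))).
  by apply/measurable_EFinP; exact: measurable_funM.
move=> x _ /=; rewrite lee_fin normrM [leRHS]ger0_norm; last first.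
  by rewrite mulr_ge0// (le_trans _ (gC 0)).
by rewrite mulrC ler_wpM2r.
Qed.

Lemma measurable_gauss_comp d (T : measurableType d) (f : T -> R) : measurable_fun setT f ->
  measurable_fun setT (fun x => gauss (f x)).
Proof. by move=> mf; exact: (measurableT_comp measurable_gauss_fun). Qed.

Lemma norm_gauss_le1 (x : R) : `|gauss x| <= 1.
Proof. by rewrite ger0_norm ?gauss_fun_ge0// gauss_fun_le1. Qed.

Let J (a b : R) : R -> R := \1_(`[a, b]%classic).

Let measurable_J a b : measurable_fun setT (J a b).
Proof. exact: measurable_indic. Qed.

Let J_le1 a b y : `|J a b y| <= 1.
Proof. by rewrite /J indicE; case: (_ \in _); rewrite ?normr1 ?normr0. Qed.

Let gauss_mollify (a b x : R) n :
  \int[mu]_z (J a b (x - n.+1%:R^-1 * z) * gauss z) =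
  \int[mu]_u (n.+1%:R * J a b u * gauss ((u - x) * n.+1%:R)).
Proof.
set e := n.+1%:R^-1; have e0 : 0 < e by exact: inv_natS_gt0.
have eN0 : - e != 0 by rewrite oppr_eq0 gt_eqF.
pose H (u : R) := J a b u * gauss ((u - x) * n.+1%:R).
have iH : mu.-integrable setT (EFin \o H).
  apply: (@integrable_bounded_mul _ (fun u => gauss ((u - x) * n.+1%:R)) 1).
  - exact: integrable_indic_itv.
  - by apply: measurable_gauss_comp; apply: measurable_funM => //; exact: measurable_funB.
  - by move=> u; exact: norm_gauss_le1.
have := integral_affine x eN0 iH; rewrite normrN (gtr0_norm e0) invrK => E.
transitivity (fine (\int[mu]_z (H (- e * z + x))%:E)%E).
  apply: eq_Rintegral => z _; rewrite /H mulNr addrC; congr (_ * _).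
  rewrite -gauss_opp; congr gauss.
  by rewrite addrK mulNr mulrAC /e mulVf ?mul1r// pnatr_eq0.
rewrite E fineM//; last exact: integrable_fin_num iH.
by rewrite -[RHS]/(fine _) -RintegralZl//; apply: eq_Rintegral => u _; rewrite /H mulrA.
Qed.

(* Mollifying the indicator of an interval by Gaussians shows that the integral of
   [f] over it is zero; then differentiate the primitive of [f]. *)
Lemma gauss_orthogonal_ae0 (f : R -> R) : mu.-integrable setT (EFin \o f) ->
  (forall n u, \int[mu]_x (f x * gauss ((u - x) * n.+1%:R)) = 0) ->
  {ae mu, forall x, f x = 0}.
Proof.
move=> intf f0; have mf := (measurable_EFinP _ _).1 (measurable_int _ intf).
have fitv (a b : R) : \int[mu]_x (f x * J a b x) = 0.
  pose c n (x : R) := \int[mu]_z (J a b (x - n.+1%:R^-1 * z) * gauss z).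
  pose K n (p : R * R) := gauss ((p.2 - p.1) * n.+1%:R).
  have mK n : measurable_fun setT (K n : measurableTypeR R * measurableTypeR R -> R).
    apply: measurable_gauss_comp; apply: measurable_funM => //; apply: measurable_funB.
    - exact: measurable_snd.
    - exact: measurable_fst.
  have fc n : \int[mu]_x (f x * c n x) = 0.
    have K1 p : `|K n p| <= 1 by exact: norm_gauss_le1.
    have := Rintegral_fubini_kernel intf
      (integrable_scale n.+1%:R (integrable_indic_itv a b)) (mK n) K1.
    rewrite [X in _ = X -> _](_ : _ = 0).
      by move=> <-; apply: eq_Rintegral => x _; rewrite /c gauss_mollify.
    under eq_Rintegral do rewrite /K/= f0 mulr0.
    by rewrite Rintegral_cst// mul0r.
  have mc n : measurable_fun setT (c n).
    apply: (@measurable_Rintegral2 _ (fun p => J a b (p.1 - n.+1%:R^-1 * p.2) * gauss p.2)).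
    apply: measurable_funM; last by apply: measurable_gauss_comp; exact: measurable_snd.
    apply: (measurableT_comp (measurable_J a b)); apply: measurable_funB.
    - exact: measurable_fst.
    - by apply: measurable_funM => //; exact: measurable_snd.
  have cb n x : `|c n x| <= Num.sqrt pi.
    have -> : Num.sqrt pi = \int[mu]_x gauss x by rewrite /Rintegral integralT_gauss.
    apply: normr_Rintegral_le; last exact: integrable_gauss.
    - apply: measurable_funM; last exact: measurable_gauss_fun.
      apply: (measurableT_comp (measurable_J a b)); exact: measurable_funB.
    - move=> z; rewrite normrM [`|gauss z|]ger0_norm ?gauss_fun_ge0//.
      by rewrite ler_piMl ?gauss_fun_ge0.
  have cvgJ : \int[mu]_x (f x * c n x) @[n --> \oo] -->
      \int[mu]_x (f x * (J a b x * Num.sqrt pi)).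
    apply: (@Rintegral_dominated_cvg _ _ _ (fun x => Num.sqrt pi * `|f x|)).
    - by move=> n; exact: measurable_funM.
    - by apply: measurable_funM => //; exact: measurable_funM.
    - apply: ae_imp (ae_and (ae_neq a) (ae_neq b)) => x [xa xb].
      apply: cvgM; first exact: cvg_cst.
      by apply: (@gauss_approximation _ (J a b) 1) => //; exact: continuous_indic_itvcc.
    - by apply: integrable_scale; exact: integrable_norm.
    - by move=> n x; rewrite normrM mulrC ler_wpM2r.
  have {}cvgJ : cst 0 n @[n --> \oo] --> \int[mu]_x (f x * (J a b x * Num.sqrt pi)).
    by rewrite (_ : cst 0 = fun n => \int[mu]_x (f x * c n x))//; apply/funext => n; rewrite fc.
  have /eqP : 0 = \int[mu]_x (f x * (J a b x * Num.sqrt pi)).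
    by apply: (cvg_unique _ _ cvgJ) => //; exact: cvg_cst.
  rewrite eq_sym; under eq_Rintegral do rewrite mulrA mulrC.
  rewrite RintegralZl//; last first.
    exact: (integrable_bounded_mul intf (measurable_J a b) (J_le1 a b)).
  by rewrite mulf_eq0 gt_eqF ?sqrtr_gt0 ?pi_gt0//= => /eqP.
have floc : locally_integrable setT f by apply: open_integrable_locally => //; exact: openT.
have F0 (x : R) : \int[mu]_(t in `]-oo, x]) f t = 0.
  have cvg1 : \int[mu]_t (f t * J (- n%:R) x t) @[n --> \oo] -->
      \int[mu]_t (f t * (\1_(`]-oo, x]%classic) : R -> R) t).
    apply: (@Rintegral_dominated_cvg _ _ _ (fun x => `|f x|)).
    - by move=> n; exact: measurable_funM.
    - by apply: measurable_funM => //; exact: measurable_indic.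
    - apply: aeW => t; apply: cvg_near_cst; near=> n; congr (_ * _).
      rewrite /J !indicE; congr ((_ : bool)%:R); apply/idP/idP; rewrite !inE/= !in_itv/=.
      + by move=> /andP[].
      + move=> ->; rewrite andbT lerNl (le_trans (ler_norm _))// normrN.
        by near: n; exact: nbhs_infty_ger.
    - exact: integrable_norm.
    - by move=> n t; rewrite normrM ler_piMr.
  have {}cvg1 : cst 0 n @[n --> \oo] --> \int[mu]_t (f t * (\1_(`]-oo, x]%classic) : R -> R) t).
    rewrite (_ : cst 0 = fun n => \int[mu]_t (f t * J (- n%:R) x t))//.
    by apply/funext => n; rewrite fitv.
  have -> : 0 = \int[mu]_t (f t * (\1_(`]-oo, x]%classic) : R -> R) t).
    by apply: (cvg_unique _ _ cvg1) => //; exact: cvg_cst.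
  rewrite Rintegral_mkcond; apply: eq_Rintegral => t _.
  by rewrite patchE indicE; case: (_ \in _); rewrite ?mulr1 ?mulr0.
have fiNy y : mu.-integrable `]-oo, y] (EFin \o f).
  by apply: integrableS intf => //; exact: measurable_itv.
have := FTC1Ny fiNy floc; apply: ae_imp => x [_ <-].
rewrite (_ : (fun _ => _) = cst 0); first by rewrite derive1_cst.
by apply/funext => y; rewrite F0.
Unshelve. all: by end_near. Qed.

End du_bois_reymond.

(** * Almost everywhere uniqueness of densities *)

Section density_uniqueness.
Context {R : realType}.
Local Notation gauss := (@gauss_fun R).

(** Completing the square turns the product of the two Gaussians into a constant times one Gaussian
    of scale sqrt(1 + N^2). These are the tests demanded by [gauss_orthogonal_ae0] when applied to a
    density times [gauss]. *)
Lemma schwartz_gauss_translate (n : nat) (u : R) :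
  schwartz (fun x => (gauss x * gauss ((u - x) * n.+1%:R))%:C).
Proof.
move: (n.+1%:R : R) => N; pose s2 := 1 + N ^+ 2; pose s := Num.sqrt s2.
have s20 : 0 < s2 by rewrite ltr_wpDr ?sqr_ge0.
have s0 : 0 < s by rewrite sqrtr_gt0.
have sE : s ^+ 2 = s2 by rewrite sqr_sqrtr// ltW.
have sn0 : s != 0 by rewrite gt_eqF.
have -> : (fun x => (gauss x * gauss ((u - x) * N))%:C) =
  (fun x => (expR (- (N ^+ 2 * u ^+ 2 / s2)))%:C * (gauss (s * x + - (N ^+ 2 * u / s)))%:C).
  apply/funext => x; rewrite -realCM; congr (_%:C).
  rewrite /gauss_fun -!expRD; congr expR.
  have -> : (s * x + - (N ^+ 2 * u / s)) ^+ 2 =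
      s2 * x ^+ 2 - 2 * N ^+ 2 * u * x + N ^+ 4 * u ^+ 2 / s2 by rewrite -sE; field.
  have s2n0 : 1 + N ^+ 2 != 0 by rewrite gt_eqF.
  by rewrite /s2; field.
by apply: schwartzZ; exact: (schwartz_affine (- (N ^+ 2 * u / s)) sn0 (@schwartz_gauss R)).
Qed.

(** [F] is integrable only against Schwartz functions, so the real and imaginary parts of
    [F * gauss] are shown to vanish; dividing by the positive function [gauss] gives the claim for
    [F]. *)
Lemma schwartz_orthogonal_ae0 (F : R -> R[i]) :
  (forall phi, schwartz phi -> cintegrable (fun x => F x * phi x)) ->
  (forall phi, schwartz phi -> cintegral (fun x => F x * phi x) = 0) ->
  {ae mu, forall x, F x = 0}.
Proof.
move=> iF F0.
have g0 x : gauss x != 0 by rewrite gt_eqF// expR_gt0.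
have aeRe : {ae mu, forall x, Re (F x) * gauss x = 0}.
  apply: gauss_orthogonal_ae0.
    have [+ _] := iF _ (@schwartz_gauss R).
    by under eq_fun do rewrite cReMr.
  move=> n u; have := congr1 (@complex.Re R) (F0 _ (schwartz_gauss_translate n u)).
  rewrite Re_cintegral; under eq_Rintegral do rewrite cReMr mulrA.
  by [].
have aeIm : {ae mu, forall x, Im (F x) * gauss x = 0}.
  apply: gauss_orthogonal_ae0.
    have [_] := iF _ (@schwartz_gauss R).
    by under eq_fun do rewrite cImMr.
  move=> n u; have := congr1 (@complex.Im R) (F0 _ (schwartz_gauss_translate n u)).
  rewrite Im_cintegral; under eq_Rintegral do rewrite cImMr mulrA.
  by [].
apply: ae_imp (ae_and aeRe aeIm) => x [/eqP + /eqP].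
rewrite !mulf_eq0 !(negbTE (g0 x)) !orbF => /eqP r /eqP i.
exact: complex_eqP.
Qed.

Lemma represents_ae_unique (F G : R -> R[i]) T : represents F T -> represents G T ->
  {ae mu, forall x, F x = G x}.
Proof.
move=> [_ iF FT] [_ iG GT].
have : {ae mu, forall x, F x - G x = 0}.
  apply: schwartz_orthogonal_ae0 => phi sphi.
    under eq_fun do rewrite mulrBl.
    by apply: cintegrableB; [exact: iF|exact: iG].
  under eq_cintegral do rewrite mulrBl.
  rewrite cintegralB; [|exact: iF|exact: iG].
  by have := FT _ sphi; rewrite (GT _ sphi) /distr_of_fun => ->; rewrite subrr.
by apply: ae_imp => x /eqP; rewrite subr_eq0 => /eqP.
Qed.

Lemma ae_eq_cintegral (f g : R -> R[i]) : cmeas f -> cmeas g -> {ae mu, forall x, f x = g x} ->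
  cintegral f = cintegral g.
Proof.
move=> mf mg fg; apply: complex_eqP => /=; rewrite /Rintegral; congr fine; apply: ae_eq_integral => //.
- by apply/measurable_EFinP; case: mf.
- by apply/measurable_EFinP; case: mg.
- by apply: ae_imp fg => x -> _.
- by apply/measurable_EFinP; case: mf.
- by apply/measurable_EFinP; case: mg.
- by apply: ae_imp fg => x -> _.
Qed.

Lemma represents_ae_eq (F G : R -> R[i]) T : cmeas G -> {ae mu, forall x, F x = G x} ->
  represents F T -> represents G T.
Proof.
move=> mG FG [mF iF FT].
have h phi : schwartz phi -> cintegrable (fun x => G x * phi x) /\
    cintegral (fun x => G x * phi x) = cintegral (fun x => F x * phi x).
  move=> sphi; have mGp : cmeas (fun x => G x * phi x) by exact: cmeasM (schwartz_cmeas sphi).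
  have /cintegrableP[mFp iFp] := iF _ sphi; split.
    apply/cintegrableP; split => //.
    apply: le_lt_trans iFp; rewrite le_eqVlt; apply/orP; left; apply/eqP.
    apply: ge0_ae_eq_integral => //.
    - exact: measurable_normcE.
    - exact: measurable_normcE.
    - by move=> x _; rewrite lee_fin normc_ge0.
    - by move=> x _; rewrite lee_fin normc_ge0.
    - by apply: ae_imp FG => x -> _.
  by apply: ae_eq_cintegral => //; apply: ae_imp FG => x ->.
split => // [phi sphi|phi sphi]; first by have [] := h phi sphi.
by rewrite (FT _ sphi) /distr_of_fun (h phi sphi).2.
Qed.

End density_uniqueness.

(** * Weighted L^2 norms of densities and pairing with test functions *)

Section weighted_norm.
Context {R : realType}.
Implicit Types (F G : R -> R[i]) (t : R).

(* [2 pi] times the square of the [H^t] norm of a distribution with density [F]. *)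
Definition wnorm2 t F : \bar R := (\int[mu]_k (jap k `^ t * normc (F k) ^+ 2)%:E)%E.

Lemma wsqr_ge0 (t k x : R) : 0 <= jap k `^ t * x ^+ 2.
Proof. by rewrite mulr_ge0 ?japw_ge0 ?sqr_ge0. Qed.

Lemma wnorm2_ge0 t F : (0 <= wnorm2 t F)%E.
Proof. by apply: integral_ge0 => k _; rewrite lee_fin mulr_ge0 ?japw_ge0 ?sqr_ge0. Qed.

Lemma measurable_wnorm2 t F : cmeas F ->
  measurable_fun setT (fun k => (jap k `^ t * normc (F k) ^+ 2)%:E).
Proof.
move=> mF; apply/measurable_EFinP; apply: measurable_funM; first exact: measurable_japw.
by apply: measurable_funX; exact: measurable_normc.
Qed.

Lemma wnorm2_ae_eq t F G : cmeas F -> cmeas G -> {ae mu, forall x, F x = G x} ->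
  wnorm2 t F = wnorm2 t G.
Proof.
move=> mF mG FG; apply: ge0_ae_eq_integral => //.
- exact: measurable_wnorm2.
- exact: measurable_wnorm2.
- by move=> k _; rewrite lee_fin wsqr_ge0.
- by move=> k _; rewrite lee_fin wsqr_ge0.
- by apply: ae_imp FG => x -> _.
Qed.

(** From (a + b)^2 <= 2a^2 + 2b^2. It replaces the triangle inequality throughout, so a target e is
    split into two errors of size e/4. *)
Lemma wnorm2D t F G : cmeas F -> cmeas G ->
  (wnorm2 t (fun k => F k + G k)%R <= 2%:E * wnorm2 t F + 2%:E * wnorm2 t G)%E.
Proof.
move=> mF mG; rewrite /wnorm2 -!ge0_integralZl//; last 4 first.
- exact: measurable_wnorm2.
- by move=> k _; rewrite lee_fin wsqr_ge0.
- exact: measurable_wnorm2.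
- by move=> k _; rewrite lee_fin wsqr_ge0.
rewrite -ge0_integralD//; last 4 first.
- by move=> k _; rewrite -EFinM lee_fin mulr_ge0// wsqr_ge0.
- by apply: emeasurable_funM => //; exact: measurable_wnorm2.
- by move=> k _; rewrite -EFinM lee_fin mulr_ge0// wsqr_ge0.
- by apply: emeasurable_funM => //; exact: measurable_wnorm2.
apply: ge0_le_integral => //.
- by move=> k _; rewrite lee_fin wsqr_ge0.
- by apply: measurable_wnorm2; exact: cmeasD.
- by apply: emeasurable_funD; apply: emeasurable_funM => //; exact: measurable_wnorm2.
- move=> k _; rewrite -!EFinM -EFinD lee_fin.
  rewrite !(mulrCA 2) -mulrDr ler_wpM2l ?japw_ge0//.
  have := ler_normcD (F k) (G k).
  set a := normc (F k); set b := normc (G k); set c := normc _ => cab.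
  have c0 : 0 <= c by exact: normc_ge0.
  rewrite (@le_trans _ _ ((a + b) ^+ 2))//.
    by rewrite lerXn2r// nnegrE// (le_trans c0).
  by rewrite -subr_ge0 (_ : _ - _ = (a - b) ^+ 2) ?sqr_ge0//; ring.
Qed.

Lemma wnorm2N t F : wnorm2 t (fun k => - F k) = wnorm2 t F.
Proof. by apply: eq_integral => k _; rewrite normcN. Qed.

Lemma wnorm2B t F G : cmeas F -> cmeas G ->
  (wnorm2 t (fun k => F k - G k)%R <= 2%:E * wnorm2 t F + 2%:E * wnorm2 t G)%E.
Proof. by move=> mF mG; rewrite -(wnorm2N t G); apply: wnorm2D => //; exact: cmeasN. Qed.

Lemma wnorm2_le s t F G : cmeas F -> cmeas G ->
  (forall k, jap k `^ s * normc (F k) ^+ 2 <= jap k `^ t * normc (G k) ^+ 2) ->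
  (wnorm2 s F <= wnorm2 t G)%E.
Proof.
move=> mF mG FG; apply: ge0_le_integral => //.
- by move=> k _; rewrite lee_fin wsqr_ge0.
- exact: measurable_wnorm2.
- exact: measurable_wnorm2.
- by move=> k _; rewrite lee_fin.
Qed.

Lemma wnorm2_scale t F (c : R) : cmeas F ->
  wnorm2 t (fun k => c%:C * F k) = ((c ^+ 2)%:E * wnorm2 t F)%E.
Proof.
move=> mF; rewrite /wnorm2 -ge0_integralZl//; last 3 first.
- exact: measurable_wnorm2.
- by move=> k _; rewrite lee_fin wsqr_ge0.
- by rewrite lee_fin sqr_ge0.
apply: eq_integral => k _; rewrite -EFinM; congr EFin.
by rewrite normcM normc_real exprMn real_normK ?num_real//; ring.
Qed.

Lemma integrable_wnorm2 t F : cmeas F -> (wnorm2 t F < +oo)%E ->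
  mu.-integrable setT (EFin \o (fun k => jap k `^ t * normc (F k) ^+ 2)).
Proof.
move=> mF Foo; apply/integrableP; split; first exact: measurable_wnorm2.
apply: le_lt_trans Foo; rewrite le_eqVlt; apply/orP; left; apply/eqP.
by apply: eq_integral => k _; rewrite gee0_abs//= lee_fin wsqr_ge0.
Qed.

(** Completing a square bounds |F| jap^(-n) by jap^t |F|^2 + jap^(-t-2n). The choice n >= 1 - t
    makes t + 2n at least 1, so that the second term is integrable as well. *)
Lemma wnorm2_integrable_decay t F : cmeas F -> (wnorm2 t F < +oo)%E ->
  exists n : nat, mu.-integrable setT (EFin \o (fun k => normc (F k) * (jap k)^-1 ^+ n)).
Proof.
move=> mF Foo; have [n nt] := ex_nat_ge (1 - t); exists n.
have i1 := integrable_wnorm2 mF Foo.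
have i2 : mu.-integrable setT (EFin \o (fun k => jap k `^ (- (t + n%:R *+ 2)))).
  apply: integrable_japwN; rewrite (@lt_le_trans _ _ 1)//.
    by rewrite invf_lt1// ltr1n.
  rewrite mulr2n addrA; have := ler0n R n; lra.
apply: (le_integrable measurableT _ _ (integrableD measurableT i1 i2)).
  apply/measurable_EFinP; apply: measurable_funM; first exact: measurable_normc.
  rewrite (_ : (fun k => _) = (fun k => jap k `^ (- n%:R))); first exact: measurable_japw.
  by apply/funext => k; rewrite powR_invn ?jap_ge0// exprVn.
move=> k _ /=; rewrite lee_fin.
set a := normc (F k); have a0 : 0 <= a by exact: normc_ge0.
have -> : (jap k)^-1 ^+ n = jap k `^ (- n%:R) by rewrite powR_invn ?jap_ge0// exprVn.
have -> : - (t + n%:R *+ 2) = - t + (- n%:R - n%:R) :> R by rewrite mulr2n; ring.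
rewrite !japwD powRN; set w := jap k `^ t; set v := jap k `^ _.
have w0 : 0 < w by exact: japw_gt0.
have v0 : 0 < v by exact: japw_gt0.
rewrite !ger0_norm ?addr_ge0 ?mulr_ge0 ?invr_ge0 ?sqr_ge0 ?(ltW v0) ?(ltW w0)//.
rewrite -(ler_pM2l w0) -subr_ge0.
rewrite (_ : _ - _ = (w * a - v / 2) ^+ 2 + 3 / 4 * v ^+ 2); last by field; rewrite gt_eqF.
by rewrite addr_ge0 ?sqr_ge0// mulr_ge0 ?sqr_ge0// divr_ge0.
Qed.

(** [n] and [K] depend on [F] alone, so the pairing is controlled by a single weighted supremum of
    the test function; this is the source of temperedness. *)
Lemma wnorm2_pairing t F : cmeas F -> (wnorm2 t F < +oo)%E ->
  exists n, exists2 K : R, 0 <= K & forall phi C, cmeas phi ->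
    (forall k, jap k ^+ n * normc (phi k) <= C) ->
    cintegrable (fun k => F k * phi k) /\
    normc (cintegral (fun k => F k * phi k)) <= K * C.
Proof.
move=> mF Foo; have [n iF] := wnorm2_integrable_decay mF Foo.
pose A k := normc (F k) * (jap k)^-1 ^+ n.
have A0 k : 0 <= A k by rewrite mulr_ge0 ?normc_ge0 ?exprn_ge0 ?invr_ge0 ?jap_ge0.
exists n, (2 * \int[mu]_k A k); first by rewrite mulr_ge0// Rintegral_ge0.
move=> phi C mphi phiC.
have bd k : normc (F k * phi k) <= C * A k.
  rewrite normcM /A mulrCA ler_wpM2l ?normc_ge0// exprVn ler_pdivlMr ?exprn_gt0 ?jap_gt0//.
  by rewrite mulrC.
have mFp : cmeas (fun k => F k * phi k) by exact: cmeasM.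
have iCA : mu.-integrable setT (EFin \o (fun k => C * A k)) by exact: integrable_scale.
split; first exact: (cintegrable_le mFp bd).
have := normc_cintegral_le mFp bd iCA.
by rewrite RintegralZl// mulrCA mulrC.
Qed.

End weighted_norm.

Section tempered_distributions.
Context {R : realType}.
Implicit Types (F G phi psi : R -> R[i]) (T U : functional R) (s t : R).

Lemma temperedP T : tempered T ->
  exists N, exists2 C : R, 0 <= C & forall phi, schwartz phi ->
    normc (T phi) <= C * seminorm_sum N phi.
Proof.
move=> [_ [C [N TC]]]; exists N, `|C| => // phi sphi.
rewrite (le_trans (TC phi sphi))// ler_wpM2r ?ler_norm//.
exact: seminorm_sum_ge0.
Qed.

Lemma seminorm_sum_le M N phi : (M <= N)%N -> seminorm_sum M phi <= seminorm_sum N phi.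
Proof.
move=> MN; rewrite /seminorm_sum (big_ord_widen _ (fun m => \sum_(n < M) schwartz_seminorm m n phi) MN).
rewrite big_mkcond/=; apply: ler_sum => m _; case: ifP => _; last first.
  by apply: sumr_ge0 => ? _; exact: schwartz_seminorm_ge0.
rewrite (big_ord_widen _ (fun n => schwartz_seminorm m n phi) MN) big_mkcond/=.
by apply: ler_sum => n _; case: ifP => _ //; exact: schwartz_seminorm_ge0.
Qed.

Lemma tempered_intro T N (C : R) : 0 <= C ->
  (forall (c : R[i]) phi psi, schwartz phi -> schwartz psi ->
     T (fun x => c * phi x + psi x) = c * T phi + T psi) ->
  (forall phi, schwartz phi -> normc (T phi) <= C * seminorm_sum N phi) ->
  tempered T.
Proof. by move=> C0 lT TC; split => //; exists C, N. Qed.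

Lemma tempered_sub T U : tempered T -> tempered U -> tempered (distr_sub T U).
Proof.
move=> tT tU; have [M [C C0 TC]] := temperedP tT; have [N [D D0 UD]] := temperedP tU.
apply: (@tempered_intro _ (maxn M N) (C + D)); first by rewrite addr_ge0.
- move=> c phi psi sp sq; rewrite /distr_sub tT.1// tU.1//; ring.
- move=> phi sphi; rewrite /distr_sub (le_trans (ler_normcB _ _))// mulrDl lerD//.
  + rewrite (le_trans (TC _ sphi))// ler_wpM2l//.
    by apply: seminorm_sum_le; exact: leq_maxl.
  + rewrite (le_trans (UD _ sphi))// ler_wpM2l//.
    by apply: seminorm_sum_le; exact: leq_maxr.
Qed.

Lemma represents_sub F G T U : represents F (distr_fourier T) ->
  represents G (distr_fourier U) ->
  represents (fun k => F k - G k) (distr_fourier (distr_sub T U)).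
Proof.
move=> [mF iF FT] [mG iG GU]; split.
- exact: cmeasB.
- move=> phi sphi; under eq_fun do rewrite mulrBl.
  by apply: cintegrableB; [exact: iF|exact: iG].
- move=> phi sphi; rewrite /distr_fourier /distr_sub/=.
  have := FT _ sphi; have := GU _ sphi; rewrite /distr_fourier => -> ->.
  rewrite /distr_of_fun -cintegralB; [|exact: iF|exact: iG].
  by apply: eq_cintegral => k; rewrite mulrBl.
Qed.

Lemma seminorm_cderiven1 m n phi : schwartz phi ->
  schwartz_seminorm m n (cderiven 1 phi) = schwartz_seminorm m n.+1 phi.
Proof.
move=> sphi; have E : cderiven n (cderiven 1 phi) = cderiven n.+1 phi.
  by rewrite cderiven_cderiven// addn1.
by rewrite /schwartz_seminorm /schwartz_values E.
Qed.

Lemma cderiven1_lin (c : R[i]) phi psi : schwartz phi -> schwartz psi ->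
  cderiven 1 (fun x => c * phi x + psi x) = fun x => c * cderiven 1 phi x + cderiven 1 psi x.
Proof.
move=> sp sq; apply: cder_unique (schwartz_cder (schwartz_lin c sp sq)) _.
have := cderD (cderM (cder_cst c) (schwartz_cder sp)) (schwartz_cder sq).
by under [X in cder _ X -> _]eq_fun do rewrite mul0r add0r.
Qed.

Lemma tempered_deriv T : tempered T -> tempered (distr_deriv T).
Proof.
move=> tT; have [N [C C0 TC]] := temperedP tT.
apply: (@tempered_intro _ N.+1 C) => //.
- move=> c phi psi sp sq; rewrite /distr_deriv cderiven1_lin//.
  by rewrite tT.1//; [ring|exact: schwartz_cderiven|exact: schwartz_cderiven].
- move=> phi sphi; rewrite /distr_deriv normcN.
  rewrite (le_trans (TC _ (schwartz_cderiven 1 sphi)))// ler_wpM2l//.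
  (* Differentiation shifts the derivative index by one: the larger double sum is cut down by its
     last row and by the first term of each other row. *)
  rewrite /seminorm_sum big_ord_recr/= ler_wpDr//.
    by apply: sumr_ge0 => ? _; exact: schwartz_seminorm_ge0.
  apply: ler_sum => m _; rewrite big_ord_recl ler_wpDl ?schwartz_seminorm_ge0//.
  by apply: ler_sum => n _; rewrite seminorm_cderiven1.
Qed.

Lemma represents_deriv F T : tempered T -> represents F (distr_fourier T) ->
  represents (fun k => (0 +i* k) * F k) (distr_fourier (distr_deriv T)).
Proof.
move=> tT [mF iF FT].
have E phi : (fun k : R => (0 +i* k) * F k * phi k) =
    (fun k => (0 +i* 1) * (F k * (k%:C * phi k))).
  apply/funext => k; have -> : 0 +i* k = (0 +i* 1) * k%:C :> R[i].
    by apply: complex_eqP; rewrite ?cReM ?cImM/=; ring.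
  by ring.
split.
- by apply: cmeasM => //; exact: cmeas_imag.
- move=> phi sphi; rewrite E; apply: cintegrableZ; apply: iF; exact: schwartz_mulx.
- move=> phi sphi; rewrite /distr_fourier /distr_deriv.
  have sx := schwartz_mulx sphi.
  (* The summand 0 gives the derivative the shape c phi + psi in which linearity of [T] is
     stated. *)
  have -> : cderiven 1 (fourier phi) = fun k => (0 +i* -1) * fourier (fun x => x%:C * phi x) k + 0.
    apply: cder_unique (schwartz_cder (schwartz_fourier sphi)) _.
    have := cder_fourier (schwartz_cintegrable sphi) (schwartz_cintegrable sx).
    rewrite fourierZ; last exact: schwartz_cintegrable.
    by under [X in _ -> cder _ X]eq_fun do rewrite addr0.
  have s0 : schwartz (fun _ : R => 0 : R[i]).
    by have := schwartzZ 0 sphi; under eq_fun do rewrite mul0r.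
  have T0 : T (fun _ => 0) = 0.
    have := tT.1 (-1) _ _ s0 s0; under eq_fun do rewrite mulr0 addr0.
    by rewrite mulN1r addNr.
  rewrite tT.1//; last exact: schwartz_fourier.
  rewrite T0 addr0; have := FT _ sx; rewrite /distr_fourier => ->.
  rewrite /distr_of_fun E -mulNr cintegralZ; last exact: iF.
  by congr (_ * _); apply: complex_eqP => /=; ring.
Qed.

(** The pairing bound is composed with the continuity of the inverse transform on Schwartz space,
    read off from [fourier_jap_bound] by reflection. *)
Lemma tempered_of_density F t : cmeas F -> (wnorm2 t F < +oo)%E ->
  tempered (distr_ifourier (distr_of_fun F)).
Proof.
move=> mF Foo; have [n [K K0 FK]] := wnorm2_pairing mF Foo.
have [C C0 bC] := @fourier_jap_bound R n.
have pi20 : 0 <= (2 * pi)^-1 :> R by rewrite invr_ge0 mulr_ge0// pi_ge0.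
have b phi : schwartz phi -> forall k, jap k ^+ n * normc (ifourier phi k) <=
    (2 * pi)^-1 * C * seminorm_sum (2 * n + 3) phi.
  move=> sphi k; rewrite ifourierE normcM normc_real ger0_norm// mulrCA -mulrA ler_wpM2l//.
  by rewrite -japN; exact: bC.
have P phi : schwartz phi -> _ := fun sphi => FK _ _ (schwartz_cmeas (schwartz_ifourier sphi)) (b _ sphi).
apply: (@tempered_intro _ (2 * n + 3) (K * ((2 * pi)^-1 * C))).
- by rewrite !mulr_ge0.
- move=> c phi psi sp sq; rewrite /distr_ifourier /distr_of_fun.
  rewrite ifourier_lin; [|exact: schwartz_cintegrable..].
  rewrite -cintegralZ; last by have [] := P _ sp.
  rewrite -cintegralD; last 2 first.
  + by apply: cintegrableZ; have [] := P _ sp.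
  + by have [] := P _ sq.
  by apply: eq_cintegral => k; ring.
- by move=> phi sphi; rewrite -mulrA; have [] := P _ sphi.
Qed.

Lemma cintegrable_density F t phi : cmeas F -> (wnorm2 t F < +oo)%E -> schwartz phi ->
  cintegrable (fun k => F k * phi k).
Proof.
move=> mF Foo sphi; have [n [K K0 FK]] := wnorm2_pairing mF Foo.
have [C _ pC] := schwartz_jap_bound n sphi.
by have [] := FK phi C (schwartz_cmeas sphi) pC.
Qed.

Lemma represents_of_density F t : cmeas F -> (wnorm2 t F < +oo)%E ->
  represents F (distr_fourier (distr_ifourier (distr_of_fun F))).
Proof.
move=> mF Foo; split => //.
- by move=> phi; exact: cintegrable_density mF Foo.
- by move=> phi sphi; rewrite /distr_fourier /distr_ifourier ifourier_fourier.
Qed.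

Lemma schwartzM_cintegrable phi psi : schwartz phi -> schwartz psi ->
  cintegrable (fun x => phi x * psi x).
Proof.
move=> sphi spsi; have [C _ pC] := schwartz_bound 0 spsi.
apply: (cintegrable_bounded_mul (C := C) (schwartz_cintegrable sphi) (schwartz_cmeas spsi)) => x.
by have := pC x; rewrite expr0 mul1r.
Qed.

Lemma tempered_of_schwartz phi : schwartz phi -> tempered (distr_of_fun phi).
Proof.
move=> sphi; have iphi := schwartz_cintegrable sphi.
have ip psi : schwartz psi -> cintegrable (fun x => phi x * psi x).
  exact: schwartzM_cintegrable.
apply: (@tempered_intro _ 1 (2 * \int[mu]_x normc (phi x))).
- by rewrite mulr_ge0// Rintegral_ge0// => x _; exact: normc_ge0.
- move=> c f g sf sg; rewrite /distr_of_fun -cintegralZ; last exact: ip.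
  rewrite -cintegralD; [|by apply: cintegrableZ; exact: ip|exact: ip].
  by apply: eq_cintegral => x; ring.
- move=> f sf; set S := seminorm_sum 1 f.
  have fS x : normc (phi x * f x) <= S * normc (phi x).
    rewrite normcM mulrC ler_wpM2r ?normc_ge0//.
    have := le_schwartz_seminorm 0 0 x sf; rewrite expr0 mul1r cderiven0 => /le_trans; apply.
    exact: le_seminorm_sum.
  have := normc_cintegral_le (cintegrable_cmeas (ip _ sf)) fS
    (integrable_scale S (integrable_normc iphi)).
  rewrite RintegralZl//; last exact: integrable_normc.
  by rewrite mulrCA mulrC.
Qed.

Lemma represents_of_schwartz phi : schwartz phi ->
  represents (fourier phi) (distr_fourier (distr_of_fun phi)).
Proof.
move=> sphi; have sF := schwartz_fourier sphi; split.
- exact: schwartz_cmeas.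
- by move=> psi; exact: schwartzM_cintegrable.
- move=> psi sq; rewrite /distr_fourier /distr_of_fun.
  rewrite -(fourier_fubini (schwartz_cintegrable sphi) (schwartz_cintegrable sq)).
  by apply: eq_cintegral => x; rewrite mulrC.
Qed.

Lemma wnorm2_schwartz t phi : schwartz phi -> (wnorm2 t phi < +oo)%E.
Proof.
move=> sphi; have [n tn] := ex_nat_ge t.
have [C C0 pC] := schwartz_jap_bound n.+1 sphi.
apply: (@le_lt_trans _ _ (\int[mu]_k (C ^+ 2 * (jap k)^-1)%:E)%E); last first.
  exact: integrable_lty (integrable_scale (C ^+ 2) integrable_japV).
apply: ge0_le_integral => //.
- by move=> k _; rewrite lee_fin wsqr_ge0.
- by apply: measurable_wnorm2; exact: schwartz_cmeas.
- exact: measurable_int (integrable_scale (C ^+ 2) integrable_japV).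
- by move=> k _; rewrite lee_fin (japw_sqr_le tn) ?normc_ge0.
Qed.

End tempered_distributions.

(** * Sobolev norms computed from densities *)

Section sobolev_spaces.
Context {R : realType}.
Implicit Types (F G phi psi : R -> R[i]) (T U : functional R) (s t : R).

Lemma represents_fourier_density F T : represents F (distr_fourier T) ->
  represents (fourier_density T) (distr_fourier T).
Proof.
by move=> FT; rewrite /fourier_density; case: xgetP => [G _ //|/(_ F)]; apply: contra_notP.
Qed.

(** Any density computes the norm, because the one chosen by [fourier_density] agrees with it almost
    everywhere. *)
Lemma sobolev_normE s T F : tempered T -> represents F (distr_fourier T) ->
  sobolev_norm s T = (((2 * pi)^-1%:E * wnorm2 s F) `^ 2^-1)%E.
Proof.
move=> tT FT; rewrite /sobolev_norm; case: asboolP => [_|]; last first.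
  by move=> h; exfalso; apply: h; split => //; exists F.
have dT := represents_fourier_density FT.
congr ((_ * _) `^ _)%E; apply: wnorm2_ae_eq.
- by case: dT.
- by case: FT.
- exact: represents_ae_unique dT FT.
Qed.

Lemma inv_2pi_gt0 : 0 < (2 * pi)^-1 :> R.
Proof. by rewrite invr_gt0 mulr_gt0// pi_gt0. Qed.

Lemma sobolevP s T : sobolev s T ->
  [/\ tempered T, represents (fourier_density T) (distr_fourier T) &
      (wnorm2 s (fourier_density T) < +oo)%E].
Proof.
rewrite /sobolev/= => Too.
have [[tT [F FT]]|nT] := pselect (tempered T /\ exists F, represents F (distr_fourier T)); last first.
  by move: Too; rewrite /sobolev_norm; case: asboolP.
have dT := represents_fourier_density FT; split => //.
move: Too; rewrite (sobolev_normE _ tT dT) => /lty_poweRy.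
rewrite invr_eq0 pnatr_eq0 => /(_ isT).
have [//|] := ltP (wnorm2 s (fourier_density T)) +oo%E.
by rewrite leye_eq => /eqP ->; rewrite gt0_muley ?ltxx// lte_fin inv_2pi_gt0.
Qed.

Lemma sobolev_norm_lty s T F : tempered T -> represents F (distr_fourier T) ->
  (wnorm2 s F < +oo)%E -> sobolev s T.
Proof.
move=> tT FT Foo; rewrite /sobolev/= (sobolev_normE _ tT FT).
apply: poweR_lty; apply: lte_mul_pinfty => //.
by rewrite lee_fin ltW ?inv_2pi_gt0.
Qed.

Lemma sobolev_norm_lt s T F (e : R) : 0 < e -> tempered T -> represents F (distr_fourier T) ->
  (sobolev_norm s T < e%:E)%E = (wnorm2 s F < (2 * pi * e ^+ 2)%:E)%E.
Proof.
move=> e0 tT FT; rewrite (sobolev_normE _ tT FT).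
have W0 := wnorm2_ge0 s F; have pi2 : 0 < 2 * pi :> R by rewrite mulr_gt0// pi_gt0.
case: (wnorm2 s F) W0 => [w| |] //; last first.
  by rewrite gt0_muley ?lte_fin ?inv_2pi_gt0// poweRyr ?invr_eq0 ?pnatr_eq0.
rewrite lee_fin => w0; rewrite -EFinM poweR_EFin !lte_fin.
have v0 : 0 <= (2 * pi)^-1 * w by rewrite mulr_ge0// ltW ?inv_2pi_gt0.
rewrite powR12_sqrt// -{1}(ger0_norm (ltW e0)) -sqrtr_sqr ltr_sqrt ?exprn_gt0//.
by rewrite ltr_pdivrMl.
Qed.

Let sqrt_norm_le (p C : R) (x y z : \bar R) : 0 < p -> 0 <= C ->
  (0 <= x -> 0 <= y < +oo -> 0 <= z < +oo -> x <= C%:E * (y * z) ->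
   (p^-1%:E * x) `^ 2^-1 <=
   (Num.sqrt (p * C))%:E * (p^-1%:E * y) `^ 2^-1 * (p^-1%:E * z) `^ 2^-1)%E.
Proof.
move=> p0 C0; case: y => [y| |]; [|by move=> _ /andP[_]; rewrite ltxx|by move=> _ /andP[]].
case: z => [z| |]; [|by move=> _ _ /andP[_]; rewrite ltxx|by move=> _ _ /andP[]].
case: x => [x| |//] x0 /andP[y0 _] /andP[z0 _]; last by rewrite -!EFinM.
rewrite !lee_fin in x0 y0 z0; rewrite -!EFinM lee_fin => xyz.
rewrite poweR_EFin lee_fin.
have p0' : 0 <= p^-1 by rewrite invr_ge0 ltW.
rewrite !powR12_sqrt ?mulr_ge0// -!sqrtrM ?mulr_ge0 ?(ltW p0)//.
apply: ler_wsqrtr.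
rewrite (_ : _ * _ * _ = p^-1 * (C * (y * z))); last by field; rewrite gt_eqF.
by rewrite ler_wpM2l.
Qed.

(** Each squared norm carries a factor 1/(2 pi), once on the left and twice on the right, which
    leaves the 2 pi under the root. *)
Lemma sobolev_norm_le s t r T U V F G H (C : R) : 0 <= C ->
  tempered T -> represents F (distr_fourier T) ->
  tempered U -> represents G (distr_fourier U) ->
  tempered V -> represents H (distr_fourier V) ->
  (wnorm2 t G < +oo)%E -> (wnorm2 r H < +oo)%E ->
  (wnorm2 s F <= C%:E * (wnorm2 t G * wnorm2 r H))%E ->
  (sobolev_norm s T <= (Num.sqrt (2 * pi * C))%:E * sobolev_norm t U * sobolev_norm r V)%E.
Proof.
move=> C0 tT FT tU GU tV HV Goo Hoo FGH.
rewrite (sobolev_normE _ tT FT) (sobolev_normE _ tU GU) (sobolev_normE _ tV HV).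
apply: sqrt_norm_le => //; rewrite ?wnorm2_ge0//.
by rewrite mulr_gt0// pi_gt0.
Qed.

End sobolev_spaces.

(** * Convolution in weighted spaces *)

Section cauchy_schwarz.
Context {R : realType}.

Lemma cauchy_schwarz_integral (f g : R -> R) :
  measurable_fun setT f -> measurable_fun setT g ->
  (forall x, 0 <= f x) -> (forall x, 0 <= g x) ->
  ((\int[mu]_x (f x * g x)%:E) `^ 2 <=
   (\int[mu]_x (f x ^+ 2)%:E) * (\int[mu]_x (g x ^+ 2)%:E))%E.
Proof.
move=> mf mg f0 g0; have half : 2^-1 + 2^-1 = 1 :> R by lra.
have := @hoelder _ _ _ mu f g 2 2 mf mg (ltr0n _ _) (ltr0n _ _) half.
have sq (h : R -> R) : (forall x, 0 <= h x) ->
    ('N[mu]_2%:E[EFin \o h] `^ 2 = \int[mu]_x (h x ^+ 2)%:E)%E.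
  move=> h0; rewrite powR_Lnorm ?pnatr_eq0//; apply: eq_integral => x _ /=.
  by rewrite ger0_norm// powR_mulrn.
rewrite -(sq f f0) -(sq g g0) -poweRM ?Lnorm_ge0// => h.
have -> : (\int[mu]_x (f x * g x)%:E = 'N[mu]_1[EFin \o (f \* g)%R])%E.
  by rewrite Lnorm1; apply: eq_integral => x _ /=; rewrite ger0_norm// mulr_ge0.
apply: gt0_ler_poweR => //; rewrite in_itv/= leey andbT ?Lnorm_ge0//.
by rewrite mule_ge0 ?Lnorm_ge0.
Qed.

End cauchy_schwarz.

Section peetre.
Context {R : realType}.

(** The weight at y + z is at most 4^tau times that of the larger argument. If this is y, it cancels
    jap(y)^(-tau); if it is z, then jap(z)^(tau - s) <= jap(y)^(tau - s) because tau <= s, and the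
    weights at y combine to jap(y)^(-s). *)
Lemma peetre_le (tau s y z : R) : 0 <= tau <= s ->
  jap (y + z) `^ tau * jap y `^ (- tau) * jap z `^ (- s) <=
  4 `^ tau * (jap z `^ (- s) + jap y `^ (- s)).
Proof.
move=> /andP[t0 ts]; have pos (a b : R) : 0 <= jap a `^ b by exact: japw_ge0.
have m0 : 0 <= Num.max (jap y) (jap z) by rewrite le_max jap_ge0.
have h : jap (y + z) `^ tau <= 4 `^ tau * Num.max (jap y) (jap z) `^ tau.
  rewrite -powRM//; apply: ge0_ler_powR; rewrite ?nnegrE ?jap_ge0 ?mulr_ge0//.
  exact: jap_add_le.
apply: (le_trans (ler_wpM2r (pos _ _) (ler_wpM2r (pos _ _) h))).
rewrite -!mulrA ler_wpM2l ?powR_ge0//.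
have [yz|zy] := leP (jap y) (jap z).
- rewrite ler_wpDl ?pos// mulrCA -japwD; have -> : tau - s = - (s - tau) by ring.
  have -> : - s = - tau + - (s - tau) by ring.
  rewrite japwD ler_wpM2l ?pos// !powRN lef_pV2 ?posrE ?japw_gt0//.
  by apply: ge0_ler_powR; rewrite ?nnegrE ?jap_ge0// subr_ge0.
- by rewrite ler_wpDr ?pos// mulrA -japwD subrr powRr0 mul1r.
Qed.

Definition japI (s : R) : R := \int[mu]_k jap k `^ (- s).

Lemma japI_ge0 s : 0 <= japI s.
Proof. by apply: Rintegral_ge0 => k _; exact: japw_ge0. Qed.

Lemma integral_japwN (s : R) : 2^-1 < s ->
  (\int[mu]_k (jap k `^ (- s))%:E = (japI s)%:E)%E.
Proof. by move=> s2; rewrite /japI fineK//; exact: integrable_fin_num (integrable_japwN s2). Qed.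

(* [y = a * l + b] and [z = c * l] range over the two arguments of a convolution. *)
Lemma integral_peetre (tau s a b c : R) : 2^-1 < s -> 0 <= tau <= s ->
  `|a| = 1 -> `|c| = 1 ->
  (\int[mu]_l (jap (a * l + b + c * l) `^ tau * jap (a * l + b) `^ (- tau) *
     jap (c * l) `^ (- s))%:E <= (4 `^ s * (2 * japI s))%:E)%E.
Proof.
move=> s2 ts a1 c1; have s0 : 0 <= s by case/andP: ts => t0; exact: le_trans.
have a0 : a != 0 by rewrite -normr_eq0 a1 oner_eq0.
have c0 : c != 0 by rewrite -normr_eq0 c1 oner_eq0.
have mw (u v : R) (r : R) : measurable_fun setT (fun l : R => jap (u * l + v) `^ r).
  exact: (measurableT_comp (measurable_japw r) (measurable_affine u v)).
have mc (r : R) : measurable_fun setT (fun l : R => jap (c * l) `^ r).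
  by have := mw c 0 r; under eq_fun do rewrite addr0.
have Ic : (\int[mu]_l (jap (c * l) `^ (- s))%:E = (japI s)%:E)%E.
  have := ge0_integral_affine 0 c0 (f := fun k => (jap k `^ (- s))%:E).
  under eq_integral do rewrite addr0; rewrite c1 invr1 mul1e => -> //.
  - exact: integral_japwN.
  - by apply/measurable_EFinP; exact: measurable_japw.
  - by move=> k; rewrite lee_fin japw_ge0.
have Ia : (\int[mu]_l (jap (a * l + b) `^ (- s))%:E = (japI s)%:E)%E.
  have := ge0_integral_affine b a0 (f := fun k => (jap k `^ (- s))%:E).
  rewrite a1 invr1 mul1e => -> //.
  - exact: integral_japwN.
  - by apply/measurable_EFinP; exact: measurable_japw.
  - by move=> k; rewrite lee_fin japw_ge0.
apply: (@le_trans _ _ (\int[mu]_l ((4 `^ s)%:E *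
   ((jap (c * l) `^ (- s))%:E + (jap (a * l + b) `^ (- s))%:E)))%E).
  apply: ge0_le_integral => //.
  - by move=> l _; rewrite lee_fin !mulr_ge0 ?japw_ge0.
  - apply/measurable_EFinP.
    have mtau : measurable_fun setT (fun l : R => jap (a * l + b + c * l) `^ tau).
      by have := mw (a + c) b tau; under eq_fun do rewrite mulrDl addrAC.
    exact: (measurable_funM (measurable_funM mtau (mw a b _)) (mc _)).
  - apply: (emeasurable_funM (measurable_cst _)); apply: emeasurable_funD.
    + by apply/measurable_EFinP; exact: mc.
    + by apply/measurable_EFinP; exact: mw.
  - move=> l _; rewrite -EFinD -EFinM lee_fin (le_trans (peetre_le _ _ ts))//.
    (* 4^tau is raised to 4^s, so that the constant depends on [s] alone. *)
    rewrite ler_wpM2r ?addr_ge0 ?japw_ge0//; apply: ler_powR; first by rewrite ler1n.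
    by case/andP: ts.
rewrite ge0_integralZl//; last 2 first.
- by apply: emeasurable_funD; apply/measurable_EFinP; [exact: mc|exact: mw].
- by move=> l _; rewrite adde_ge0 ?lee_fin ?japw_ge0.
rewrite ge0_integralD//; last 4 first.
- by move=> l _; rewrite lee_fin japw_ge0.
- by apply/measurable_EFinP; exact: mc.
- by move=> l _; rewrite lee_fin japw_ge0.
- by apply/measurable_EFinP; exact: mw.
by rewrite Ic Ia -EFinD -EFinM lee_fin [2 * _]mulr_natl mulr2n.
Qed.

End peetre.

Section convolution.
Context {R : realType}.
Local Notation RR := (measurableTypeR R).
Implicit Types (U V : R -> R[i]) (s t : R).

Definition conv U V : R -> R[i] := fun k => cintegral (fun l => U (k - l) * V l).

(** The convolution of the moduli, taken in the extended reals so that it can be estimated before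
    the integral defining [conv] is known to converge. *)
Definition aconv U V (k : R) : \bar R :=
  (\int[mu]_l (normc (U (k - l)) * normc (V l))%:E)%E.

Lemma measurable_sub2 : measurable_fun setT (fun p : RR * RR => p.1 - p.2 : R).
Proof. by apply: measurable_funB; [exact: measurable_fst|exact: measurable_snd]. Qed.

Lemma cmeas_conv2 U V : cmeas U -> cmeas V ->
  cmeas (fun p : RR * RR => U (p.1 - p.2) * V p.2).
Proof.
move=> mU mV; apply: cmeasM; first exact: (cmeas_comp measurable_sub2 mU).
exact: (cmeas_comp measurable_snd mV).
Qed.

Lemma cmeas_shift U (k : R) : cmeas U -> cmeas (fun l : R => U (k - l)).
Proof. by move=> mU; apply: (cmeas_comp _ mU); exact: measurable_funB. Qed.

Lemma cmeas_conv U V : cmeas U -> cmeas V -> cmeas (conv U V).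
Proof. by move=> mU mV; exact: (cmeas_cintegral2 (cmeas_conv2 mU mV)). Qed.

Lemma aconv_ge0 U V k : (0 <= aconv U V k)%E.
Proof. by apply: integral_ge0 => l _; rewrite lee_fin mulr_ge0 ?normc_ge0. Qed.

Lemma measurable_aconv U V : cmeas U -> cmeas V -> measurable_fun setT (aconv U V).
Proof.
move=> mU mV.
apply: (measurable_integral2 (f := fun p : RR * RR => (normc (U (p.1 - p.2)) * normc (V p.2))%:E)).
apply/measurable_EFinP; have := measurable_normc (cmeas_conv2 mU mV).
by under eq_fun do rewrite normcM.
Qed.

Lemma integral_shift (f : R -> \bar R) (l : R) : measurable_fun setT f ->
  (forall x, 0 <= f x)%E -> (\int[mu]_k f (k - l)%R = \int[mu]_k f k)%E.
Proof.
move=> mf f0; have := ge0_integral_affine (- l) (oner_neq0 R) mf f0.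
by rewrite normr1 invr1 mul1e => <-; apply: eq_integral => k _; rewrite mul1r.
Qed.

Let wmul (t : R) (k : R) (x : \bar R) : (0 <= x)%E ->
  ((jap k `^ t)%:E * (x `^ 2) = ((Num.sqrt (jap k `^ t))%:E * x) `^ 2)%E.
Proof.
move=> x0; rewrite poweRM ?lee_fin ?sqrtr_ge0//; congr (_ * _)%E.
by rewrite poweR_EFin powR_mulrn ?sqrtr_ge0// sqr_sqrtr// japw_ge0.
Qed.

Lemma measurable_aconv2 t U V : cmeas U -> cmeas V ->
  measurable_fun setT (fun k : R => ((jap k `^ t)%:E * (aconv U V k) `^ 2)%E).
Proof.
move=> mU mV; apply: emeasurable_funM; first by apply/measurable_EFinP; exact: measurable_japw.
by apply: (measurableT_comp (measurable_poweR _)); exact: measurable_aconv.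
Qed.

(** Cauchy-Schwarz for an arbitrary splitting of the weighted squared integrand into p q. The cases
    t >= 0 and t <= 0 differ in the splitting. *)
Lemma aconv_schwarz t U V k (p q : R -> R) : cmeas U -> cmeas V ->
  measurable_fun setT p -> measurable_fun setT q ->
  (forall l, 0 <= p l) -> (forall l, 0 <= q l) ->
  (forall l, p l * q l = jap k `^ t * (normc (U (k - l)) * normc (V l)) ^+ 2) ->
  ((jap k `^ t)%:E * (aconv U V k) `^ 2 <= (\int[mu]_l (p l)%:E) * \int[mu]_l (q l)%:E)%E.
Proof.
move=> mU mV mp mq p0 q0 pq.
have msq (h : R -> R) : measurable_fun setT h -> measurable_fun setT (fun l => Num.sqrt (h l)).
  by move=> mh; exact: (measurableT_comp (continuous_measurable_fun (@sqrt_continuous R))).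
have pqE l : Num.sqrt (p l) * Num.sqrt (q l) =
    Num.sqrt (jap k `^ t) * (normc (U (k - l)) * normc (V l)).
  rewrite -sqrtrM// pq sqrtrM ?japw_ge0// sqrtr_sqr ger0_norm//.
  by rewrite mulr_ge0 ?normc_ge0.
rewrite wmul ?aconv_ge0// -ge0_integralZl//; last 2 first.
- apply/measurable_EFinP; apply: measurable_funM; apply: measurable_normc => //.
  exact: cmeas_shift.
- by move=> l _; rewrite lee_fin mulr_ge0 ?normc_ge0.
under eq_integral do rewrite -EFinM -pqE.
apply: (le_trans (cauchy_schwarz_integral (msq _ mp) (msq _ mq) _ _)).
- by move=> l; exact: sqrtr_ge0.
- by move=> l; exact: sqrtr_ge0.
rewrite le_eqVlt; apply/orP; left; apply/eqP.
by congr (_ * _)%E; apply: eq_integral => l _; rewrite sqr_sqrtr.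
Qed.

(** The weights of [U] and [V] go with their squares into [q], leaving in [p] a Peetre kernel whose
    integral over l is bounded uniformly in k. Tonelli and translation invariance then factor the
    integral of [q]. *)
Lemma aconv_bound_ge0 s t U V : 2^-1 < s -> 0 <= t <= s -> cmeas U -> cmeas V ->
  (\int[mu]_k ((jap k `^ t)%:E * (aconv U V k) `^ 2) <=
   (4 `^ s * (2 * japI s))%:E * (wnorm2 t U * wnorm2 s V))%E.
Proof.
move=> s2 ts mU mV.
pose A (k : R) : R := jap k `^ t * normc (U k) ^+ 2; pose B (k : R) : R := jap k `^ s * normc (V k) ^+ 2.
have A0 k : 0 <= A k by rewrite mulr_ge0 ?japw_ge0 ?sqr_ge0.
have B0 k : 0 <= B k by rewrite mulr_ge0 ?japw_ge0 ?sqr_ge0.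
have mA : measurable_fun setT A by apply/measurable_EFinP; exact: measurable_wnorm2.
have mB : measurable_fun setT B by apply/measurable_EFinP; exact: measurable_wnorm2.
set C := 4 `^ s * _.
have C0 : 0 <= C by rewrite !mulr_ge0 ?powR_ge0 ?japI_ge0.
have step k : ((jap k `^ t)%:E * (aconv U V k) `^ 2 <=
    C%:E * \int[mu]_l (A (k - l) * B l)%:E)%E.
  have mkl : measurable_fun setT (fun l : R => jap (k - l) `^ (- t)).
    by apply: (measurableT_comp (measurable_japw _)); exact: measurable_funB.
  apply: (le_trans (@aconv_schwarz t U V k
    (fun l => jap k `^ t * jap (k - l) `^ (- t) * jap l `^ (- s))
    (fun l => A (k - l) * B l) mU mV _ _ _ _ _)).
  - by apply: measurable_funM; [exact: measurable_funM|exact: measurable_japw].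
  - apply: measurable_funM => //; apply: (measurableT_comp mA).
    exact: measurable_funB.
  - by move=> l; rewrite !mulr_ge0 ?japw_ge0.
  - by move=> l; rewrite mulr_ge0.
  - move=> l; rewrite /A /B !powRN; have a0 := japw_gt0 (k - l) t; have b0 := japw_gt0 l s.
    by field; rewrite !gt_eqF.
  apply: lee_wpmul2r; first by apply: integral_ge0 => l _; rewrite lee_fin mulr_ge0.
  have N1 : `|-1| = 1 :> R by rewrite normrN1.
  have := integral_peetre k s2 ts N1 (normr1 R); apply: le_trans.
  rewrite le_eqVlt; apply/orP; left; apply/eqP; apply: eq_integral => l _.
  by rewrite mulN1r mul1r (addrC (- l)) subrK.
have mAB : measurable_fun setT (fun p : RR * RR => (A (p.1 - p.2) * B p.2)%:E).
  apply/measurable_EFinP; apply: measurable_funM.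
  - exact: (measurableT_comp mA measurable_sub2).
  - exact: (measurableT_comp mB measurable_snd).
have AB0 (p : RR * RR) : (0 <= (A (p.1 - p.2) * B p.2)%:E)%E by rewrite lee_fin mulr_ge0.
apply: (@le_trans _ _ (\int[mu]_k (C%:E * \int[mu]_l (A (k - l) * B l)%:E))%E).
  apply: ge0_le_integral => //.
  - by move=> k _; rewrite mule_ge0 ?lee_fin ?japw_ge0 ?poweR_ge0.
  - exact: measurable_aconv2.
  - by apply: emeasurable_funM => //; exact: (measurable_integral2 mAB).
rewrite ge0_integralZl//; last 2 first.
- exact: (measurable_integral2 mAB).
- by move=> k _; apply: integral_ge0 => l _; rewrite lee_fin mulr_ge0.
rewrite lee_wpmul2l ?lee_fin// (fubini_tonelli _ mAB AB0)/=.
have -> : (\int[mu]_l \int[mu]_k (A (k - l) * B l)%:E =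
    \int[mu]_l (wnorm2 t U * (B l)%:E))%E.
  apply: eq_integral => l _; under eq_integral do rewrite EFinM.
  rewrite ge0_integralZr//; last 3 first.
  - apply/measurable_EFinP; apply: (measurableT_comp mA); exact: measurable_funB.
  - by move=> k _; rewrite lee_fin.
  - by rewrite lee_fin.
  congr (_ * _)%E; apply: (integral_shift (f := fun k => (A k)%:E)).
  - exact/measurable_EFinP.
  - by move=> k; rewrite lee_fin.
rewrite ge0_integralZl//; last 3 first.
- exact/measurable_EFinP.
- by move=> k _; rewrite lee_fin.
- exact: wnorm2_ge0.
Qed.

(** The weight jap(k)^t no longer grows with k, so the splitting changes: one factor is the weighted
    square of [V] alone, and jap(k)^t jap(l)^(-s) stays with the square of [U]. The integral in l is
    taken last, after k = m + l has freed [U] from l. *)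
Lemma aconv_bound_lt0 s t U V : 2^-1 < s -> - s <= t <= 0 -> cmeas U -> cmeas V ->
  (\int[mu]_k ((jap k `^ t)%:E * (aconv U V k) `^ 2) <=
   (4 `^ s * (2 * japI s))%:E * (wnorm2 t U * wnorm2 s V))%E.
Proof.
move=> s2 ts mU mV.
pose B (k : R) : R := jap k `^ s * normc (V k) ^+ 2.
have B0 k : 0 <= B k by rewrite mulr_ge0 ?japw_ge0 ?sqr_ge0.
have mB : measurable_fun setT B by apply/measurable_EFinP; exact: measurable_wnorm2.
set C := 4 `^ s * _.
have C0 : 0 <= C by rewrite !mulr_ge0 ?powR_ge0 ?japI_ge0.
have mU2 : measurable_fun setT (fun k : R => normc (U k) ^+ 2).
  by apply: measurable_funX; exact: measurable_normc.
pose K (k l : R) : R := jap k `^ t * jap l `^ (- s) * normc (U (k - l)) ^+ 2.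
have K0 k l : 0 <= K k l by rewrite mulr_ge0 ?sqr_ge0// mulr_ge0 ?japw_ge0.
have step k : ((jap k `^ t)%:E * (aconv U V k) `^ 2 <=
    wnorm2 s V * \int[mu]_l (K k l)%:E)%E.
  apply: (@aconv_schwarz t U V k B (K k)) => //.
  - apply: measurable_funM; first by apply: measurable_funM => //; exact: measurable_japw.
    by apply: (measurableT_comp mU2); exact: measurable_funB.
  - by move=> l; rewrite /K /B !powRN; have b0 := japw_gt0 l s; field; rewrite gt_eqF.
have mK : measurable_fun setT (fun p : RR * RR => (K p.1 p.2)%:E).
  apply/measurable_EFinP; apply: measurable_funM.
    apply: measurable_funM.
    - exact: (measurableT_comp (measurable_japw t) measurable_fst).
    - exact: (measurableT_comp (measurable_japw (- s)) measurable_snd).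
  exact: (measurableT_comp mU2 measurable_sub2).
(* The kernel after the substitution k = m + l. *)
have mK' : measurable_fun setT (fun p : RR * RR => (K (p.1 + p.2) p.2)%:E).
  apply/measurable_EFinP; apply: measurable_funM.
    apply: measurable_funM.
    - apply: (measurableT_comp (measurable_japw t)); apply: measurable_funD.
      + exact: measurable_fst.
      + exact: measurable_snd.
    - exact: (measurableT_comp (measurable_japw (- s)) measurable_snd).
  under eq_fun do rewrite addrK.
  exact: (measurableT_comp mU2 measurable_fst).
apply: (@le_trans _ _ (\int[mu]_k (wnorm2 s V * \int[mu]_l (K k l)%:E))%E).
  apply: ge0_le_integral => //.
  - by move=> k _; rewrite mule_ge0 ?lee_fin ?japw_ge0 ?poweR_ge0.
  - exact: measurable_aconv2.
  - by apply: emeasurable_funM => //; exact: (measurable_integral2 mK).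
rewrite ge0_integralZl//; last 3 first.
- exact: (measurable_integral2 mK).
- by move=> k _; apply: integral_ge0 => l _; rewrite lee_fin.
- exact: wnorm2_ge0.
rewrite muleC muleA lee_wpmul2r ?wnorm2_ge0//.
have K0' (p : RR * RR) : (0 <= (K p.1 p.2)%:E)%E by rewrite lee_fin.
have K0'' (p : RR * RR) : (0 <= (K (p.1 + p.2) p.2)%:E)%E by rewrite lee_fin.
rewrite (fubini_tonelli _ mK K0')/=.
have -> : (\int[mu]_l \int[mu]_k (K k l)%:E = \int[mu]_l \int[mu]_m (K (m + l) l)%:E)%E.
  apply: eq_integral => l _.
  have mKl : measurable_fun setT (fun m : R => (K (m + l) l)%:E).
    exact: (measurableT_comp mK' (pair2_measurable l)).
  rewrite -(integral_shift l mKl); last by move=> m; rewrite lee_fin.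
  by apply: eq_integral => k _; rewrite subrK.
rewrite -(fubini_tonelli _ mK' K0'')/=.
rewrite /wnorm2 -ge0_integralZl//; last 2 first.
- exact: measurable_wnorm2.
- by move=> k _; rewrite lee_fin wsqr_ge0.
apply: ge0_le_integral => //.
- by move=> m _; apply: integral_ge0 => l _; rewrite lee_fin.
- exact: (measurable_integral2 mK').
- by apply: emeasurable_funM => //; exact: measurable_wnorm2.
move=> m _.
have Nts : 0 <= - t <= s by move: ts => /andP[st t0]; rewrite oppr_ge0 t0/= lerNl.
have N1 : `|-1| = 1 :> R by rewrite normrN1.
(* Peetre with exponent -t for the arguments l + m and -l, whose sum m does not depend on l. *)
have := integral_peetre m s2 Nts (normr1 R) N1 => P.
have D0 : 0 <= jap m `^ t * normc (U m) ^+ 2 by rewrite mulr_ge0 ?japw_ge0 ?sqr_ge0.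
rewrite muleC; apply: le_trans (lee_wpmul2l _ P); last by rewrite lee_fin.
rewrite -ge0_integralZl//; last 2 first.
- apply/measurable_EFinP; apply: measurable_funM; first apply: measurable_funM.
  + under eq_fun do rewrite mul1r mulN1r addrAC subrr add0r.
    exact: measurable_cst.
  + under eq_fun do rewrite mul1r.
    by apply: (measurableT_comp (measurable_japw _)); exact: measurable_funD.
  + under eq_fun do rewrite mulN1r japN.
    exact: measurable_japw.
- by move=> l _; rewrite lee_fin !mulr_ge0 ?japw_ge0.
rewrite le_eqVlt; apply/orP; left; apply/eqP; apply: eq_integral => l _.
rewrite -EFinM; congr EFin; rewrite /K mul1r mulN1r japN opprK addrK (addrC l m) addrK.
by rewrite [jap m `^ (- t)]powRN; have := japw_gt0 m t => mt0; field; rewrite gt_eqF.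
Qed.

Definition convC (s : R) : R := 4 `^ s * (2 * japI s).

Lemma convC_ge0 s : 0 <= convC s.
Proof. by rewrite !mulr_ge0 ?powR_ge0 ?japI_ge0. Qed.

Lemma aconv_bound s t U V : 2^-1 < s -> - s <= t <= s -> cmeas U -> cmeas V ->
  (\int[mu]_k ((jap k `^ t)%:E * (aconv U V k) `^ 2) <=
   (convC s)%:E * (wnorm2 t U * wnorm2 s V))%E.
Proof.
move=> s2 /andP[st ts] mU mV; have [t0|t0] := leP 0 t.
- by apply: aconv_bound_ge0 => //; rewrite t0.
- by apply: aconv_bound_lt0 => //; rewrite st ltW.
Qed.

(** The factor 4 is the square of the constant 2 in [le_normc_cintegral]. *)
Lemma conv_bound s t U V : 2^-1 < s -> - s <= t <= s -> cmeas U -> cmeas V ->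
  (wnorm2 t (conv U V) <= (4 * convC s)%:E * (wnorm2 t U * wnorm2 s V))%E.
Proof.
move=> s2 ts mU mV; rewrite EFinM -muleA.
apply: (@le_trans _ _ (4%:E * \int[mu]_k ((jap k `^ t)%:E * (aconv U V k) `^ 2))%E); last first.
  by apply: lee_wpmul2l; [rewrite lee_fin|exact: aconv_bound].
have mac := measurable_aconv2 t mU mV.
rewrite -ge0_integralZl//; last by move=> k _; rewrite mule_ge0 ?lee_fin ?japw_ge0 ?poweR_ge0.
apply: ge0_le_integral => //.
- by move=> k _; rewrite lee_fin wsqr_ge0.
- by apply: measurable_wnorm2; exact: cmeas_conv.
- exact: emeasurable_funM.
move=> k _; rewrite EFinM muleCA lee_wpmul2l ?lee_fin ?japw_ge0//.
have := le_normc_cintegral (cmeasM (cmeas_shift k mU) mV).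
under eq_integral do rewrite normcM.
rewrite -/(conv U V k) -/(aconv U V k) => h.
rewrite -powR_mulrn ?normc_ge0// -poweR_EFin.
have -> : (4%:E * aconv U V k `^ 2 = (2%:E * aconv U V k) `^ 2)%E.
  by rewrite poweRM ?lee_fin ?aconv_ge0// poweR_EFin powR_mulrn// -natrX.
apply: gt0_ler_poweR => //; rewrite in_itv/= leey andbT ?lee_fin ?normc_ge0//.
by rewrite mule_ge0 ?lee_fin ?aconv_ge0.
Qed.

(** A finite weighted integral forces [aconv] to be finite almost everywhere, since the weight is
    positive. Additivity of [conv] in each argument holds only at such points. *)
Lemma ae_cintegrable_conv s t U V : 2^-1 < s -> - s <= t <= s -> cmeas U -> cmeas V ->
  (wnorm2 t U < +oo)%E -> (wnorm2 s V < +oo)%E ->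
  {ae mu, forall k, cintegrable (fun l => U (k - l) * V l)}.
Proof.
move=> s2 ts mU mV Uoo Voo.
have mac := measurable_aconv2 t mU mV.
have iac : mu.-integrable setT (fun k => ((jap k `^ t)%:E * (aconv U V k) `^ 2)%E).
  apply/integrableP; split => //.
  under eq_integral do rewrite gee0_abs ?mule_ge0 ?lee_fin ?japw_ge0 ?poweR_ge0//.
  apply: (le_lt_trans (aconv_bound s2 ts mU mV)).
  apply: lte_mul_pinfty; rewrite ?lee_fin ?convC_ge0//.
  by apply: lte_mul_pinfty; rewrite ?ge0_fin_numE ?wnorm2_ge0.
have [N [mN N0 acN]] := integrable_ae measurableT iac.
exists N; split => // k /= nik; apply: acN => /=.
apply: contra_not nik => /(_ I) fin; apply/cintegrableP.
split; first exact: cmeasM (cmeas_shift k mU) mV.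
under eq_integral do rewrite normcM.
rewrite -/(aconv U V k); apply: contraTT fin; rewrite -leNgt leye_eq => /eqP ->.
by rewrite poweRyr ?pnatr_eq0// gt0_muley// lte_fin japw_gt0.
Qed.

(** Equality holds at every [k]: for fixed [k] the reflection l -> k - l preserves null sets, so the
    integrands agree almost everywhere. *)
Lemma conv_ae_eq U U' V V' : cmeas U -> cmeas U' -> cmeas V -> cmeas V' ->
  {ae mu, forall x, U x = U' x} -> {ae mu, forall x, V x = V' x} -> conv U V = conv U' V'.
Proof.
move=> mU mU' mV mV' UU' VV'; apply/funext => k; apply: ae_eq_cintegral.
- exact: cmeasM (cmeas_shift k mU) mV.
- exact: cmeasM (cmeas_shift k mU') mV'.
have N0 : (-1 : R) != 0 by rewrite oppr_eq0 oner_eq0.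
apply: ae_imp (ae_and (ae_affine k N0 UU') VV') => l [+ ->].
by rewrite mulN1r addrC => ->.
Qed.

End convolution.

(** * Density of Schwartz functions *)

Section approximation.
Context {R : realType}.
Local Notation gauss := (@gauss_fun R).
Implicit Types (F G Phi : R -> R[i]) (t : R).

Lemma realCB (a b : R) : (a - b)%:C = a%:C - b%:C.
Proof. by apply: complex_eqP; rewrite ?cReB ?cImB/= ?subr0. Qed.

Lemma integrable_jap_decay (h : R -> R) (m : nat) (C : R) : measurable_fun setT h ->
  (forall k, jap k ^+ m.+1 * `|h k| <= C) ->
  mu.-integrable setT (EFin \o (fun k => jap k ^+ m * `|h k|)).
Proof.
move=> mh hC; apply: (le_integrable measurableT _ _ (integrable_scale C (@integrable_japV R))).
  apply/measurable_EFinP; apply: measurable_funM; last exact: measurableT_comp.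
  apply: measurable_funX; apply: continuous_measurable_fun; exact: continuous_jap.
move=> k _ /=; rewrite lee_fin ger0_norm ?mulr_ge0 ?exprn_ge0 ?jap_ge0//.
apply: le_trans (ler_norm _); rewrite -ler_pdivrMr ?invr_gt0 ?jap_gt0// invrK.
by rewrite mulrC mulrA -exprS.
Qed.

(** All derivatives fall on [phi], so [h] needs only measurability and decay. Powers of k are shared
    between the factors by jap(k) <= 4 jap(k - l) jap(l). *)
Lemma schwartz_convolution (h phi : R -> R[i]) : cmeas h ->
  (forall m : nat, exists C : R, forall k, jap k ^+ m * normc (h k) <= C) ->
  schwartz phi -> schwartz (fun k => cintegral (fun l => h l * phi (k - l))).
Proof.
move=> mh hC sphi; have [dphi _] := schwartz_seqP sphi.
have bphi n m := schwartz_jap_bound m (schwartz_cderiven n sphi).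
have mn : measurable_fun setT (fun k : R => normc (h k)) by exact: measurable_normc.
have ih (m : nat) : mu.-integrable setT (EFin \o (fun k => jap k ^+ m * normc (h k))).
  have [C hmC] := hC m.+1.
  have := @integrable_jap_decay (fun k => normc (h k)) m C mn.
  under eq_fun do rewrite ger0_norm ?normc_ge0//.
  by apply => k; rewrite ger0_norm ?normc_ge0.
have ih0 : mu.-integrable setT (EFin \o (fun k => normc (h k))).
  by have := ih 0; under eq_fun do rewrite expr0 mul1r.
have mphi n (k : R) : cmeas (fun l : R => cderiven n phi (k - l)).
  by apply: cmeas_shift; exact: schwartz_cmeas (schwartz_cderiven n sphi).
have le1 n : exists2 D : R, 0 <= D & forall k l, normc (h l * cderiven n phi (k - l)) <= D * normc (h l).
  have [D D0 pD] := bphi n 0; exists D => // k l.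
  by rewrite normcM mulrC ler_wpM2r ?normc_ge0//; have := pD (k - l); rewrite expr0 mul1r.
have := @schwartz_seq_intro _ (fun n k => cintegral (fun l => h l * cderiven n phi (k - l))).
rewrite cderiven0; apply; split.
  move=> n; have [D D0 bD] := le1 n; have [D' D'0 bD'] := le1 n.+1.
  apply: (@cder_cintegral _ (fun k l => h l * cderiven n phi (k - l))
    (fun k l => h l * cderiven n.+1 phi (k - l)) (fun l => D' * normc (h l))).
  - move=> k; apply: (cintegrable_le (g := fun l => D * normc (h l))) => //.
    + exact: cmeasM.
    + exact: integrable_scale.
  - move=> l; have := cderM (cder_cst (h l)) (cder_affine 1 (- l) (dphi n)).
    by under [X in cder _ X -> _]eq_fun do rewrite mul0r add0r mul1r mul1r;
      under [X in cder X _ -> _]eq_fun do rewrite mul1r.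
  - by move=> k l; exact: bD'.
  - exact: integrable_scale.
move=> m n; have [C C0 pC] := bphi n m.
exists (2 * \int[mu]_l (4 ^+ m * C * (jap l ^+ m * normc (h l)))) => k.
rewrite -[`|k| ^+ m](ger0_norm (exprn_ge0 _ (normr_ge0 _))) -normc_real -normcM.
have [D D0 bD] := le1 n.
rewrite -cintegralZ; last first.
  apply: (cintegrable_le (g := fun l => D * normc (h l))) => //.
  - exact: cmeasM.
  - exact: integrable_scale.
apply: normc_cintegral_le; last exact: integrable_scale.
  by apply: cmeasM; [exact: cmeas_cst|exact: cmeasM].
move=> l; rewrite !normcM normc_real ger0_norm ?exprn_ge0//.
have h1 : `|k| ^+ m <= 4 ^+ m * (jap (k - l) ^+ m * jap l ^+ m).
  by rewrite (le_trans (expr_norm_le_jap m k))//; have := jap_expn_add m (k - l) l; rewrite subrK.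
rewrite (le_trans (ler_wpM2r _ h1)) ?mulr_ge0 ?normc_ge0//.
rewrite [leLHS](_ : _ = 4 ^+ m * (jap l ^+ m * normc (h l)) *
  (jap (k - l) ^+ m * normc (cderiven n phi (k - l)))); last by ring.
rewrite [leRHS](_ : _ = 4 ^+ m * (jap l ^+ m * normc (h l)) * C); last by ring.
by rewrite ler_wpM2l// !mulr_ge0 ?exprn_ge0 ?jap_ge0 ?normc_ge0.
Qed.

Lemma wnorm2_real t (f : R -> R) : measurable_fun setT f ->
  wnorm2 t (fun k => (f k)%:C) = (\int[mu]_k (jap k `^ t * f k ^+ 2)%:E)%E.
Proof.
by move=> mf; apply: eq_integral => k _; rewrite normc_real real_normK ?num_real.
Qed.

Lemma wnorm2_dominated_cvg t (F_ : nat -> R -> R[i]) (g : R -> R) :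
  (forall n, cmeas (F_ n)) ->
  (forall n k, jap k `^ t * normc (F_ n k) ^+ 2 <= g k) ->
  mu.-integrable setT (EFin \o g) ->
  {ae mu, forall k, normc (F_ n k) @[n --> \oo] --> 0} ->
  forall e : R, 0 < e -> \forall n \near \oo, (wnorm2 t (F_ n) < e%:E)%E.
Proof.
move=> mF Fg ig F0 e e0.
have p0 n k : 0 <= jap k `^ t * normc (F_ n k) ^+ 2 by rewrite mulr_ge0 ?japw_ge0 ?sqr_ge0.
have mw n : measurable_fun setT (fun k : R => jap k `^ t * normc (F_ n k) ^+ 2).
  by apply/measurable_EFinP; exact: measurable_wnorm2.
have := @Rintegral_dominated_cvg _ (fun n k => jap k `^ t * normc (F_ n k) ^+ 2) (fun=> 0) g mw
  (@measurable_cst _ _ _ _ _ _) _ ig.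
have h n k : `|jap k `^ t * normc (F_ n k) ^+ 2| <= g k by rewrite ger0_norm.
have c0 : {ae mu, forall k, jap k `^ t * normc (F_ n k) ^+ 2 @[n --> \oo] --> 0}.
  apply: ae_imp F0 => k k0; rewrite -[X in _ --> X](mulr0 (jap k `^ t)).
  apply: cvgM; first exact: cvg_cst.
  rewrite -[X in _ --> X](mulr0 0); under eq_fun do rewrite expr2.
  exact: (cvgM k0 k0).
move=> /(_ c0 h); rewrite Rintegral_cst// mul0r => /cvgrPdist_lt/(_ _ e0).
apply: filterS => n; rewrite sub0r normrN => lt_e.
have i : mu.-integrable setT (EFin \o (fun k => jap k `^ t * normc (F_ n k) ^+ 2)).
  apply: (le_integrable measurableT _ _ ig); first by apply/measurable_EFinP; exact: mw.
  by move=> k _ /=; rewrite lee_fin (le_trans (h n k))// ler_norm.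
rewrite /wnorm2 -[X in (X < _)%E]fineK ?(integrable_fin_num _ i)// lte_fin.
exact: le_lt_trans (ler_norm _) lt_e.
Qed.

Definition approximable t F : Prop := forall e : R, 0 < e ->
  exists2 Phi, schwartz Phi & (wnorm2 t (fun k => Phi k - F k)%R < e%:E)%E.

(** Approximability survives limits, so that a density can be simplified one step at a time. *)
Lemma approximable_close t F : cmeas F ->
  (forall e : R, 0 < e -> exists G, [/\ cmeas G, approximable t G &
    (wnorm2 t (fun k => G k - F k)%R < e%:E)%E]) -> approximable t F.
Proof.
move=> mF H e e0; have e4 : 0 < e / 4 by rewrite divr_gt0.
have [G [mG aG GF]] := H _ e4; have [Phi sPhi PG] := aG _ e4; exists Phi => //.
have mP := schwartz_cmeas sPhi.
have -> : (fun k => Phi k - F k) = (fun k => (Phi k - G k) + (G k - F k)).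
  by apply/funext => k; rewrite subrKA.
apply: (le_lt_trans (wnorm2D t (cmeasB mP mG) (cmeasB mG mF))).
have -> : (e%:E = 2%:E * (e / 4)%:E + 2%:E * (e / 4)%:E)%E.
  by rewrite -!EFinM -EFinD; congr EFin; field.
by apply: lteD; rewrite lte_pmul2l ?lte_fin.
Qed.

Definition mollify (h : R -> R) (n : nat) (k : R) : R :=
  (Num.sqrt pi)^-1 * \int[mu]_z (h (k - n.+1%:R^-1 * z) * gauss z).

Lemma schwartz_mollify (h : R -> R) n : measurable_fun setT h ->
  (forall m : nat, exists C : R, forall k, jap k ^+ m * `|h k| <= C) ->
  schwartz (fun k => (mollify h n k)%:C).
Proof.
move=> mh hC; have N0 : n.+1%:R != 0 :> R by rewrite pnatr_eq0.
pose a : R := - n.+1%:R^-1; have a0 : a != 0 by rewrite oppr_eq0 invr_eq0.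
have hC' (m : nat) : exists C : R, forall k, jap k ^+ m * normc (h k)%:C <= C.
  by have [C h1] := hC m; exists C => k; rewrite normc_real.
have sg := gauss_scaled_schwartz N0.
have sc := schwartz_convolution (cmeas_real mh) hC' sg.
have s0 : schwartz (fun k : R => 0 : R[i]).
  by have := schwartz_lin (-1) sg sg; under eq_fun do rewrite mulN1r addNr.
have := schwartz_lin ((Num.sqrt pi)^-1 * n.+1%:R)%:C sc s0.
rewrite [X in schwartz X -> _](_ : _ = (fun k => (mollify h n k)%:C)) //.
apply/funext => k; rewrite addr0 /mollify [(_ * \int[_]_z _)%:C]realCM -cintegral_real.
rewrite [(_ * n.+1%:R)%:C]realCM -mulrA; congr (_ * _).
pose f l := (h l)%:C * (gauss (n.+1%:R * (k - l)))%:C.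
have intf : cintegrable f.
  have ih : cintegrable (fun l => (h l)%:C).
    apply: cintegrable_real; have [C h1] := hC 1%N.
    have := integrable_jap_decay mh h1; under eq_fun do rewrite expr0 mul1r.
    apply: le_integrable => //; first exact/measurable_EFinP.
    by move=> l _ /=; rewrite normr_id.
  apply: (cintegrable_bounded_mul (C := 1) ih).
    apply: cmeas_real; apply: (measurableT_comp measurable_gauss_fun).
    by apply: measurable_funM => //; exact: measurable_funB.
  by move=> l; rewrite normc_real norm_gauss_le1.
have := cintegral_affine k a0 intf; rewrite normrN ger0_norm ?invr_ge0// invrK => <-.
by apply: eq_cintegral => z; rewrite /f /a realCM mulNr [- _ + k]addrC subKr mulVKf.
Qed.

(** The mollifications converge at almost every point and inherit the decay of [h] uniformly in the
    width, so dominated convergence applies in the weighted norm. *)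
Lemma approximable_decay t (h : R -> R) : measurable_fun setT h ->
  (forall m : nat, exists C : R, forall k, jap k ^+ m * `|h k| <= C) ->
  {ae mu, forall x, {for x, continuous h}} -> approximable t (fun k => (h k)%:C).
Proof.
move=> mh hC ch e e0.
have sM n := schwartz_mollify n mh hC.
have [n tn] := ex_nat_ge t.
have [C hCn] := hC n.+1; have C0 : 0 <= C.
  by rewrite (le_trans _ (hCn 0))// mulr_ge0 ?exprn_ge0 ?jap_ge0.
have [B hB] := hC 0; have {}hB k : `|h k| <= B by have := hB k; rewrite expr0 mul1r.
have sp0 : 0 < Num.sqrt pi :> R by rewrite sqrtr_gt0 pi_gt0.
have ig : mu.-integrable setT (EFin \o (fun z => jap z ^+ n.+1 * gauss z)).
  have [D _ gD] := schwartz_jap_bound n.+2 (@schwartz_gauss R).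
  have := @integrable_jap_decay gauss n.+1 D (@measurable_gauss_fun R).
  under eq_fun do rewrite ger0_norm ?gauss_fun_ge0//.
  by apply => k; rewrite -normc_real.
pose D := (Num.sqrt pi)^-1 * \int[mu]_z (4 ^+ n.+1 * C * (jap z ^+ n.+1 * gauss z)).
have D0 : 0 <= D.
  rewrite mulr_ge0 ?invr_ge0 ?sqrtr_ge0//; apply: Rintegral_ge0 => z _.
  by rewrite !mulr_ge0 ?exprn_ge0 ?jap_ge0 ?gauss_fun_ge0.
have mhz0 (k : R) p : measurable_fun setT (fun z : R => h (k - p.+1%:R^-1 * z)).
  apply: (measurableT_comp mh); have := measurable_affine (- p.+1%:R^-1) k.
  by under eq_fun do rewrite mulNr addrC.
have mhz (k : R) p : measurable_fun setT (fun z : R => h (k - p.+1%:R^-1 * z) * gauss z).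
  by apply: measurable_funM; [exact: mhz0|exact: measurable_gauss_fun].
(* Uniform in [p]: the argument z / (p+1) of the shift has weight at most that of z, and the
   Gaussian absorbs the powers of jap(z). *)
have MD p k : jap k ^+ n.+1 * `|mollify h p k| <= D.
  rewrite /mollify normrM [`|_^-1|]ger0_norm ?invr_ge0 ?sqrtr_ge0// mulrCA.
  rewrite ler_wpM2l ?invr_ge0 ?sqrtr_ge0//.
  rewrite -[jap k ^+ _]ger0_norm ?exprn_ge0 ?jap_ge0// -normrM.
  rewrite -RintegralZl//; last first.
    have -> : (fun z => h (k - p.+1%:R^-1 * z) * gauss z) =
        (fun z => gauss z * h (k - p.+1%:R^-1 * z)) by apply/funext => z; exact: mulrC.
    exact: (integrable_bounded_mul (@integrable_gauss R) (mhz0 k p) (fun z => hB _)).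
  apply: normr_Rintegral_le; last exact: integrable_scale.
    by apply: measurable_funM => //; exact: measurable_cst.
  move=> z; rewrite !normrM [`|jap k ^+ _|]ger0_norm ?exprn_ge0 ?jap_ge0//.
  rewrite [`|gauss z|]ger0_norm ?gauss_fun_ge0//.
  set y := k - _; have kE : k = y + p.+1%:R^-1 * z by rewrite subrK.
  have jz : jap (p.+1%:R^-1 * z) ^+ n.+1 <= jap z ^+ n.+1.
    rewrite lerXn2r ?nnegrE ?jap_ge0// /jap lerD2l exprMn ler_piMl ?sqr_ge0//.
    by rewrite expr_le1 ?invr_ge0// invf_le1 ?ler1n.
  rewrite mulrA [leRHS]mulrA ler_wpM2r ?gauss_fun_ge0//.
  rewrite {1}kE (le_trans (ler_wpM2r _ (jap_expn_add _ _ _)))//.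
  rewrite -!mulrA ler_wpM2l ?exprn_ge0//.
  by rewrite mulrCA [leRHS]mulrC ler_pM ?mulr_ge0 ?exprn_ge0 ?jap_ge0.
have mM p : measurable_fun setT (mollify h p) by have [] := schwartz_cmeas (sM p).
pose E := D + C; have E0 : 0 <= E by rewrite addr_ge0.
have H : {ae mu, forall k, normc ((mollify h p k)%:C - (h k)%:C) @[p --> \oo] --> 0}.
  apply: ae_imp ch => k ck; have := gauss_approximation mh hB ck => c.
  have c1 : mollify h p k @[p --> \oo] --> h k.
    rewrite -[X in _ --> X](_ : (Num.sqrt pi)^-1 * (h k * Num.sqrt pi) = h k).
      by apply: cvgM => //; exact: cvg_cst.
    by field; rewrite gt_eqF.
  have -> : (fun p => normc ((mollify h p k)%:C - (h k)%:C)) = (fun p => `|mollify h p k - h k|).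
    by apply/funext => p; rewrite -realCB normc_real.
  by apply/norm_cvg0P; rewrite -[X in _ --> X](subrr (h k)); apply: cvgB => //; exact: cvg_cst.
have mMh p : cmeas (fun k => (mollify h p k)%:C - (h k)%:C).
  by apply: cmeasB; apply: cmeas_real.
have ME p k : jap k `^ t * normc ((mollify h p k)%:C - (h k)%:C) ^+ 2 <= E ^+ 2 * (jap k)^-1.
  apply: (japw_sqr_le tn) => //; first exact: normc_ge0.
  rewrite -realCB normc_real (le_trans (ler_wpM2l _ (ler_normB _ _))) ?exprn_ge0 ?jap_ge0//.
  by rewrite mulrDr lerD.
have := wnorm2_dominated_cvg mMh ME (integrable_scale _ (@integrable_japV R)) H e0.
case=> p _ /(_ p (leqnn p))/= pe.
by exists (fun k => (mollify h p k)%:C).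
Qed.

End approximation.

(** * From bounded compactly supported densities to arbitrary ones *)

Section density.
Context {R : realType}.
Implicit Types (F G Phi : R -> R[i]) (t : R).

Lemma jap_le (x y : R) : `|x| <= `|y| -> jap x <= jap y.
Proof.
move=> xy; rewrite /jap lerD2l -[x ^+ 2]real_normK ?num_real//.
by rewrite -[y ^+ 2]real_normK ?num_real// lerXn2r ?nnegrE.
Qed.

Lemma clamp_le (B x : R) : 0 <= B -> `|Num.max (- B) (Num.min x B)| <= B.
Proof.
move=> B0; rewrite ler_norml le_max lexx/= ge_max ge_min lexx orbT andbT.
by rewrite (le_trans _ B0)// oppr_le0.
Qed.

(** Clamping projects onto [-B, B] and so brings no value farther from a point of that interval. *)
Lemma clamp_dist_le (B x y : R) : `|x| <= B ->
  `|Num.max (- B) (Num.min y B) - x| <= `|y - x|.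
Proof.
rewrite ler_norml => /andP[Bx xB].
have [yB|By] := leP y B.
  have [h|h] := leP (- B) y; first by [].
  rewrite ler0_norm ?subr_le0// [`|y - x|]ler0_norm ?subr_le0 ?(le_trans (ltW h))//.
  by rewrite lerN2 lerB// ltW.
have h : - B <= B by exact: le_trans Bx xB.
have [_|] := leP (- B) B; last by rewrite ltNge h.
rewrite ger0_norm ?subr_ge0// [`|y - x|]ger0_norm ?subr_ge0 ?(le_trans xB (ltW By))//.
by rewrite lerB// ltW.
Qed.

(** An L^1-close continuous function is clamped to [-B, B] and cut off outside [-N, N]. The result
    decays trivially and is continuous off the two endpoints, hence is covered by
    [approximable_decay]. *)
Lemma approximable_bounded t (f : R -> R) (N B : R) : 0 <= N -> 0 <= B ->
  measurable_fun setT f -> (forall k, `|f k| <= B) -> (forall k, N < `|k| -> f k = 0) ->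
  approximable t (fun k => (f k)%:C).
Proof.
move=> N0 B0 mf fB fN; apply: approximable_close; first exact: cmeas_real.
move=> e e0; have [n tn] := ex_nat_ge t.
pose I : set R := `[- N, N]%classic.
have mI : measurable I by exact: measurable_itv.
have inI (k : R) : (k \in I) = (`|k| <= N) by rewrite ler_norml /I mem_setE in_itv.
have Ifin : (mu I < +oo)%E by rewrite lebesgue_measure_itv/=; case: ifP; rewrite -?EFinD ltry.
have intf : mu.-integrable I (EFin \o f).
  apply: measurable_bounded_integrable => //.
    exact: (measurable_funS measurableT).
  exists B; split; first exact: num_real.
  by move=> M BM x _ /=; rewrite (le_trans (fB x))// ltW.
(* Passes from L^1 to the weighted square: on the support the weight is at most jap(N)^n, and one of
   the two factors |h - f| is at most 2B. *)
pose c := jap N ^+ n * (2 * B).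
have c0 : 0 <= c by rewrite !mulr_ge0 ?exprn_ge0 ?jap_ge0.
pose d := e / (c + 1); have d0 : 0 < d by rewrite divr_gt0// ltr_wpDl.
have [g_ [cg _ gf]] := approximation_continuous_integrable mI Ifin intf.
have nb : nbhs (0%E : \bar R) [set y | (y < d%:E)%E].
  by apply: open_nbhs_nbhs; split; [exact: open_ereal_lt_ereal|rewrite /= lte_fin].
have [p _] := gf _ nb.
move=> /(_ p (leqnn p))/= gd.
pose g k := Num.max (- B) (Num.min (g_ p k) B).
pose h k := g k * \1_I k.
have mg : measurable_fun setT g.
  apply: measurable_maxr => //; apply: measurable_minr => //.
  by apply: continuous_measurable_fun; exact: cg.
have mh : measurable_fun setT h by apply: measurable_funM => //; exact: measurable_indic.
exists (fun k => (h k)%:C); split; first exact: cmeas_real.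
- apply: approximable_decay => //.
    move=> m; exists (jap N ^+ m * B) => k; rewrite /h indicE inI.
    have [kN|kN] := boolP (`|k| <= N).
      rewrite mulr1 ler_pM ?exprn_ge0 ?jap_ge0//; last exact: clamp_le.
      by rewrite lerXn2r ?nnegrE ?jap_ge0// jap_le// (ger0_norm N0).
    by rewrite mulr0 normr0 mulr0 mulr_ge0 ?exprn_ge0 ?jap_ge0.
  have cg' : continuous g.
    move=> x; have cst (y : R) : {for x, continuous (fun=> y : R)} by exact: cvg_cst.
    exact: (@continuous_max _ _ (fun=> - B) (g_ p \min (fun=> B)) x (cst _)
              (@continuous_min _ _ (g_ p) (fun=> B) x (cg p x) (cst _))).
  apply: ae_imp (ae_and (ae_neq (- N)) (ae_neq N)) => k [k1 k2].
  by apply: cvgM; [exact: cg'|exact: continuous_indic_itvcc].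
rewrite (_ : (fun k => _) = fun k => (h k - f k)%:C); last by apply/funext => k; rewrite realCB.
rewrite wnorm2_real; last exact: measurable_funB.
have le1 k : jap k `^ t * (h k - f k) ^+ 2 <= c * (`|f k - g_ p k| * \1_I k).
  rewrite /h indicE inI; have [kN|kN] := boolP (`|k| <= N); last first.
    by rewrite !mulr0 sub0r fN ?ltNge// oppr0 expr0n mulr0.
  rewrite !mulr1 /c -mulrA ler_pM ?japw_ge0 ?sqr_ge0//.
    rewrite (le_trans (japw_le_expn k tn))// lerXn2r ?nnegrE ?jap_ge0//.
    by rewrite jap_le// (ger0_norm N0).
  rewrite -real_normK ?num_real// expr2 ler_pM//.
    by rewrite (le_trans (ler_normB _ _))// mulr_natl mulr2n lerD// clamp_le.
  by rewrite [leRHS]distrC; exact: clamp_dist_le.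
have mfg : measurable_fun setT (fun k : R => `|f k - g_ p k| * \1_I k).
  apply: measurable_funM; last exact: measurable_indic.
  apply: (measurableT_comp (@normr_measurable _ _)); apply: measurable_funB => //.
  by apply: continuous_measurable_fun; exact: cg.
apply: (@le_lt_trans _ _ (\int[mu]_k (c%:E * (`|f k - g_ p k| * \1_I k)%:E))%E).
  apply: ge0_le_integral => //.
  - by move=> k _; rewrite lee_fin wsqr_ge0.
  - apply/measurable_EFinP; apply: measurable_funM; first exact: measurable_japw.
    by apply: measurable_funX; exact: measurable_funB.
  - apply/measurable_EFinP; apply: measurable_funM => //.
  - by move=> k _; rewrite lee_fin.
rewrite ge0_integralZl//; last by apply/measurable_EFinP.
have E : (\int[mu]_k (`|f k - g_ p k| * \1_I k)%:E =
    \int[mu]_(z in I) `|(f z - g_ p z)%:E|)%E.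
  rewrite [RHS]integral_mkcond; apply: eq_integral => k _.
  by rewrite patchE indicE; case: ifP => _; rewrite ?mulr1 ?mulr0.
rewrite E; apply: (@le_lt_trans _ _ (c%:E * d%:E)%E).
  by apply: lee_wpmul2l; [rewrite lee_fin|exact: ltW].
rewrite -EFinM lte_fin /d mulrA ltr_pdivrMr ?ltr_wpDl// mulrC.
by rewrite ltr_pM2l// ltrDl.
Unshelve. all: by end_near. Qed.

(** Truncation of both the values and the support at [n]; the weighted square of [f] itself
    dominates the error. *)
Lemma approximable_real t (f : R -> R) : measurable_fun setT f ->
  (wnorm2 t (fun k => (f k)%:C) < +oo)%E -> approximable t (fun k => (f k)%:C).
Proof.
move=> mf foo; apply: approximable_close; first exact: cmeas_real.
move=> e e0.
pose A (n : nat) : set R := [set k | `|f k| <= n%:R] `&` `[- n%:R, n%:R]%classic.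
have mA n : measurable (A n).
  apply: measurableI; last exact: measurable_itv.
  have m : measurable_fun setT (fun k : R => `|f k|) by exact: measurableT_comp.
  rewrite [X in measurable X](_ : _ = (fun k => `|f k|) @^-1` `]-oo, n%:R]%classic).
    by rewrite -[X in measurable X]setTI; exact: m.
  by apply/seteqP; split => k /=; rewrite in_itv.
pose f_ n k := f k * \1_(A n) k.
have mf_ n : measurable_fun setT (f_ n).
  by apply: measurable_funM => //; exact: measurable_indic.
have inA n k : (k \in A n) = (`|f k| <= n%:R) && (`|k| <= n%:R).
  apply/idP/andP => [/set_mem[/= a]|[a b]]; first by rewrite in_itv/= -ler_norml.
  by apply/mem_set; split => //=; rewrite in_itv/= -ler_norml.
have mF n : cmeas (fun k => (f_ n k)%:C - (f k)%:C) by apply: cmeasB; exact: cmeas_real.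
have dom n k : jap k `^ t * normc ((f_ n k)%:C - (f k)%:C) ^+ 2 <=
    jap k `^ t * normc (f k)%:C ^+ 2.
  rewrite ler_wpM2l ?japw_ge0// -realCB !normc_real lerXn2r ?nnegrE//.
  rewrite /f_ indicE; case: (k \in A n); last by rewrite mulr0 sub0r normrN.
  by rewrite mulr1 subrr normr0.
have cvg0 : {ae mu, forall k, normc ((f_ n k)%:C - (f k)%:C) @[n --> \oo] --> 0}.
  apply: aeW => k; apply: cvg_near_cst; near=> n.
  rewrite /f_ indicE inA (_ : _ && _) ?mulr1 ?subrr ?normc0//.
  by apply/andP; split; near: n; exact: nbhs_infty_ger.
have := wnorm2_dominated_cvg mF dom (integrable_wnorm2 (cmeas_real mf) foo) cvg0 e0.
case=> n _ /(_ n (leqnn n))/= lte; exists (fun k => (f_ n k)%:C); split => //.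
  exact: cmeas_real.
apply: (@approximable_bounded _ _ n%:R n%:R) => //.
- move=> k; rewrite /f_ indicE inA; case: andP => [[a _]|_]; first by rewrite mulr1.
  by rewrite mulr0 normr0.
- by move=> k nk; rewrite /f_ indicE inA [`|k| <= _]leNgt nk andbF mulr0.
Unshelve. all: by end_near. Qed.

Theorem schwartz_dense t F : cmeas F -> (wnorm2 t F < +oo)%E -> approximable t F.
Proof.
move=> mF Foo e e0; have e4 : 0 < e / 4 by rewrite divr_gt0.
have [mr mi] := mF.
have roo : (wnorm2 t (fun k => (Re (F k))%:C) < +oo)%E.
  apply: le_lt_trans Foo; apply: (wnorm2_le (cmeas_real mr) mF).
  move=> k; rewrite ler_wpM2l ?japw_ge0// lerXn2r ?nnegrE ?normc_ge0//.
  by rewrite normc_real ler_Re_normc.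
have ioo : (wnorm2 t (fun k => (Im (F k))%:C) < +oo)%E.
  apply: le_lt_trans Foo; apply: (wnorm2_le (cmeas_real mi) mF).
  move=> k; rewrite ler_wpM2l ?japw_ge0// lerXn2r ?nnegrE ?normc_ge0//.
  by rewrite normc_real ler_Im_normc.
have [P sP Pe] := approximable_real mr roo e4.
have [Q sQ Qe] := approximable_real mi ioo e4.
exists (fun k => (0 +i* 1) * Q k + P k); first exact: schwartz_lin.
have mP := cmeasB (schwartz_cmeas sP) (cmeas_real mr).
have mQ := cmeasB (schwartz_cmeas sQ) (cmeas_real mi).
have miQ : cmeas (fun k => (0 +i* 1) * (Q k - (Im (F k))%:C)).
  by apply: cmeasM mQ; exact: cmeas_cst.
have -> : (fun k => (0 +i* 1) * Q k + P k - F k) =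
    (fun k => (0 +i* 1) * (Q k - (Im (F k))%:C) + (P k - (Re (F k))%:C)).
  apply/funext => k; rewrite [F k in LHS](_ : _ = (Re (F k))%:C + (0 +i* 1) * (Im (F k))%:C); first by ring.
  by apply: complex_eqP; rewrite ?cReD ?cImD ?cReM ?cImM/=; ring.
apply: (le_lt_trans (wnorm2D t miQ mP)).
have -> : wnorm2 t (fun k => (0 +i* 1) * (Q k - (Im (F k))%:C)) =
    wnorm2 t (fun k => Q k - (Im (F k))%:C).
  by apply: eq_integral => k _; rewrite normcM normc_imag normr1 mul1r.
have -> : (e%:E = 2%:E * (e / 4)%:E + 2%:E * (e / 4)%:E)%E.
  by rewrite -!EFinM -EFinD; congr EFin; field.
by apply: lteD; rewrite lte_pmul2l ?lte_fin.
Qed.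

End density.

(** * Multiplication of Sobolev distributions *)

Section sobolev_multiplication.
Context {R : realType}.
Implicit Types (U V F G Phi Psi phi psi : R -> R[i]) (s t : R).

Lemma wnorm2_fineK t F : (wnorm2 t F < +oo)%E -> ((fine (wnorm2 t F))%:E = wnorm2 t F)%E.
Proof. by move=> Foo; rewrite fineK// ge0_fin_numE ?wnorm2_ge0. Qed.

Lemma wnorm2_fine_ge0 t F : 0 <= fine (wnorm2 t F).
Proof. by rewrite fine_ge0// wnorm2_ge0. Qed.

Definition mconv U V (k : R) : R[i] := ((2 * pi)^-1)%:C * conv U V k.

Definition mconvC s : R := (2 * pi)^-1 ^+ 2 * (4 * convC s).

Lemma mconvC_ge0 s : 0 <= mconvC s.
Proof. by rewrite mulr_ge0 ?sqr_ge0// mulr_ge0 ?convC_ge0. Qed.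

Lemma cmeas_mconv U V : cmeas U -> cmeas V -> cmeas (mconv U V).
Proof. by move=> mU mV; apply: cmeasM (cmeas_conv mU mV); exact: cmeas_cst. Qed.

Lemma wnorm2_mconv s t U V : 2^-1 < s -> - s <= t <= s -> cmeas U -> cmeas V ->
  (wnorm2 t (mconv U V) <= (mconvC s)%:E * (wnorm2 t U * wnorm2 s V))%E.
Proof.
move=> s2 ts mU mV; rewrite wnorm2_scale; last exact: cmeas_conv.
by rewrite /mconvC (EFinM ((2 * pi)^-1 ^+ 2)) -muleA lee_wpmul2l ?lee_fin ?sqr_ge0//; exact: conv_bound.
Qed.

Lemma mconv_lty s t U V : 2^-1 < s -> - s <= t <= s -> cmeas U -> cmeas V ->
  (wnorm2 t U < +oo)%E -> (wnorm2 s V < +oo)%E -> (wnorm2 t (mconv U V) < +oo)%E.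
Proof.
move=> s2 ts mU mV Uoo Voo; apply: (le_lt_trans (wnorm2_mconv s2 ts mU mV)).
by rewrite -(wnorm2_fineK Uoo) -(wnorm2_fineK Voo) -!EFinM ltry.
Qed.

Lemma ae_mconvB s t U U' V : 2^-1 < s -> - s <= t <= s -> cmeas U -> cmeas U' -> cmeas V ->
  (wnorm2 t U < +oo)%E -> (wnorm2 t U' < +oo)%E -> (wnorm2 s V < +oo)%E ->
  {ae mu, forall k, mconv (fun l => U l - U' l) V k = mconv U V k - mconv U' V k}.
Proof.
move=> s2 ts mU mU' mV Uoo Uoo' Voo.
apply: ae_imp (ae_and (ae_cintegrable_conv s2 ts mU mV Uoo Voo)
                      (ae_cintegrable_conv s2 ts mU' mV Uoo' Voo)) => k [i1 i2].
rewrite /mconv -mulrBr /conv -cintegralB//; congr (_ * _).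
by apply: eq_cintegral => l; rewrite mulrBl.
Qed.

Lemma ae_mconvBr s t U V V' : 2^-1 < s -> - s <= t <= s -> cmeas U -> cmeas V -> cmeas V' ->
  (wnorm2 t U < +oo)%E -> (wnorm2 s V < +oo)%E -> (wnorm2 s V' < +oo)%E ->
  {ae mu, forall k, mconv U (fun l => V l - V' l) k = mconv U V k - mconv U V' k}.
Proof.
move=> s2 ts mU mV mV' Uoo Voo Voo'.
apply: ae_imp (ae_and (ae_cintegrable_conv s2 ts mU mV Uoo Voo)
                      (ae_cintegrable_conv s2 ts mU mV' Uoo Voo')) => k [i1 i2].
rewrite /mconv -mulrBr /conv -cintegralB//; congr (_ * _).
by apply: eq_cintegral => l; rewrite mulrBr.
Qed.

Lemma mconv_ae_eq U U' V V' : cmeas U -> cmeas U' -> cmeas V -> cmeas V' ->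
  {ae mu, forall x, U x = U' x} -> {ae mu, forall x, V x = V' x} -> mconv U V = mconv U' V'.
Proof. by move=> mU mU' mV mV' UU' VV'; rewrite /mconv (conv_ae_eq mU mU' mV mV' UU' VV'). Qed.

Lemma wnorm2_shift_le t U U' (d : R) : cmeas U -> cmeas U' -> (wnorm2 t U < +oo)%E ->
  (wnorm2 t (fun k => U' k - U k)%R < d%:E)%E ->
  (wnorm2 t U' <= (2 * d + 2 * fine (wnorm2 t U))%:E)%E.
Proof.
move=> mU mU' Uoo Ud; have -> : U' = (fun k => (U' k - U k) + U k).
  by apply/funext => k; rewrite subrK.
apply: (le_trans (wnorm2D t (cmeasB mU' mU) mU)).
rewrite (EFinD (2 * d)) [(2 * fine _)%:E]EFinM wnorm2_fineK// leeD2r// EFinM.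
by apply: lee_wpmul2l => //; exact: ltW.
Qed.

(** From U' * V' - U * V = (U' - U) * V' + U * (V' - V), valid almost everywhere. *)
Lemma mconv_continuous s t U V (e : R) : 2^-1 < s -> - s <= t <= s -> cmeas U -> cmeas V ->
  (wnorm2 t U < +oo)%E -> (wnorm2 s V < +oo)%E -> 0 < e ->
  exists2 d : R, 0 < d & forall U' V', cmeas U' -> cmeas V' ->
    (wnorm2 t (fun k => U' k - U k)%R < d%:E)%E -> (wnorm2 s (fun k => V' k - V k)%R < d%:E)%E ->
    (wnorm2 t (fun k => mconv U' V' k - mconv U V k)%R < e%:E)%E.
Proof.
move=> s2 ts mU mV Uoo Voo e0.
have a0 := wnorm2_fine_ge0 t U; have b0 := wnorm2_fine_ge0 s V.
have aE := wnorm2_fineK Uoo; have bE := wnorm2_fineK Voo.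
have K0 := mconvC_ge0 s; set K := mconvC s in K0.
set a := fine (wnorm2 t U) in a0 aE; set b := fine (wnorm2 s V) in b0 bE.
(* For d <= 1 the squared norm of [V'] is at most 2 + 2b by [wnorm2_shift_le]; the outer factors 2
   come from [wnorm2D]. *)
pose c := 2 * (K * (2 + 2 * b)) + 2 * (K * a).
have b2 : 0 <= 2 + 2 * b by rewrite addr_ge0// mulr_ge0.
have c0 : 0 <= c by apply: addr_ge0; apply: mulr_ge0 => //; exact: mulr_ge0.
pose d := Num.min 1 (e / (c + 1)).
have d0 : 0 < d by rewrite lt_min ltr01 divr_gt0// ltr_wpDl.
have d1 : d <= 1 by rewrite ge_min lexx.
have de : c * d < e.
  apply: (@le_lt_trans _ _ (c * (e / (c + 1)))); first by rewrite ler_wpM2l// ge_min lexx orbT.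
  by rewrite mulrA ltr_pdivrMr ?ltr_wpDl// mulrC ltr_pM2l// ltrDl.
exists d => // U' V' mU' mV' Ud Vd.
have V'b := wnorm2_shift_le mV mV' Voo Vd.
have V'oo : (wnorm2 s V' < +oo)%E by rewrite (le_lt_trans V'b)// ltry.
have U'oo : (wnorm2 t U' < +oo)%E by rewrite (le_lt_trans (wnorm2_shift_le mU mU' Uoo Ud))// ltry.
have mdU := cmeasB mU' mU; have mdV := cmeasB mV' mV.
have mX := cmeas_mconv mdU mV'; have mY := cmeas_mconv mU mdV.
have ae1 := ae_and (ae_mconvB s2 ts mU' mU mV' U'oo Uoo V'oo)
                   (ae_mconvBr s2 ts mU mV' mV Uoo V'oo Voo).
rewrite -(@wnorm2_ae_eq _ _ (fun k => mconv (fun l => U' l - U l) V' k +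
    mconv U (fun l => V' l - V l) k)); first last.
- by apply: ae_imp ae1 => k [-> ->]; rewrite subrKA.
- by apply: cmeasB; exact: cmeas_mconv.
- exact: cmeasD.
apply: (le_lt_trans (wnorm2D t mX mY)).
apply: (@le_lt_trans _ _ (c * d)%:E); last by rewrite lte_fin.
have h1 : (wnorm2 t (mconv (fun l => U' l - U l)%R V') <= (K * (d * (2 + 2 * b)))%:E)%E.
  apply: (le_trans (wnorm2_mconv s2 ts mdU mV')).
  rewrite (EFinM K) lee_wpmul2l ?lee_fin// (EFinM d).
  apply: lee_pmul; rewrite ?wnorm2_ge0//; first exact: ltW.
  by apply: (le_trans V'b); rewrite lee_fin lerD2r ler_piMr.
have h2 : (wnorm2 t (mconv U (fun l => V' l - V l)%R) <= (K * (a * d))%:E)%E.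
  apply: (le_trans (wnorm2_mconv s2 ts mU mdV)).
  rewrite (EFinM K) lee_wpmul2l ?lee_fin// (EFinM a) aE.
  by apply: lee_wpmul2l; [exact: wnorm2_ge0|exact: ltW].
apply: (@le_trans _ _ (2%:E * (K * (d * (2 + 2 * b)))%:E + 2%:E * (K * (a * d))%:E)%E).
  by apply: leeD; apply: lee_wpmul2l.
by rewrite -!EFinM -EFinD lee_fin le_eqVlt; apply/orP; left; apply/eqP; rewrite /c; ring.
Qed.

Lemma inv_2piC : ((2 * pi)^-1)%:C * (2 * pi)%:C = 1 :> R[i].
Proof. by rewrite -realCM mulVf// mulf_neq0// gt_eqF// pi_gt0. Qed.

(** The convolution theorem: the shift by l is a modulation of [phi], Fubini moves the integral in l
    inside, and Fourier inversion evaluates it as 2 pi psi(x). *)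
Lemma mconv_fourier phi psi : schwartz phi -> schwartz psi ->
  mconv (fourier phi) (fourier psi) = fourier (fun x => phi x * psi x).
Proof.
move=> sphi spsi; apply/funext => k.
pose K (p : R * R) : R[i] := expi (p.1 * p.2).
have mK : cmeas (K : measurableTypeR R * measurableTypeR R -> R[i]).
  apply: cmeas_expi; apply: measurable_funM.
  - exact: measurable_fst.
  - exact: measurable_snd.
have K1 p : normc (K p) <= 1 by rewrite normc_expi.
have sF := schwartz_fourier spsi.
have := cintegral_fubini_kernel (schwartz_cintegrable sF)
  (cintegrable_fourier k (schwartz_cintegrable sphi)) mK K1.
rewrite /mconv /conv => E.
rewrite (_ : cintegral (fun l => fourier phi (k - l) * fourier psi l) =
    cintegral (fun x => phi x * expi (- (k * x)) *
      cintegral (fun l => fourier psi l * expi (l * x)))); last first.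
  rewrite -E; apply: eq_cintegral => l; rewrite mulrC; congr (_ * _).
  rewrite -fourier_modulate; apply: eq_cintegral => x.
  by rewrite mulrAC.
have inv x : cintegral (fun l => fourier psi l * expi (l * x)) = (2 * pi)%:C * psi x.
  rewrite -[in RHS](ifourier_fourier spsi) /ifourier mulrA [(2 * pi)%:C * _]mulrC.
  by rewrite inv_2piC mul1r.
rewrite -cintegralZ.
  apply: eq_cintegral => x; rewrite inv.
  rewrite (_ : _ * _ = ((2 * pi)^-1)%:C * (2 * pi)%:C * (phi x * psi x * expi (- (k * x)))); last by ring.
  by rewrite inv_2piC mul1r.
under eq_fun do rewrite inv.
have -> : (fun x => phi x * expi (- (k * x)) * ((2 * pi)%:C * psi x)) =
    (fun x => (2 * pi)%:C * (phi x * psi x * expi (- (k * x)))).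
  by apply/funext => x; ring.
by apply: cintegrableZ; apply: cintegrable_fourier; exact: schwartzM_cintegrable.
Qed.

Lemma represents_mconv_fourier phi psi : schwartz phi -> schwartz psi ->
  represents (mconv (fourier phi) (fourier psi))
    (distr_fourier (distr_of_fun (fun x => phi x * psi x))).
Proof.
move=> sphi spsi; have sF := schwartz_fourier sphi; have sG := schwartz_fourier spsi.
have mM := cmeas_mconv (schwartz_cmeas sF) (schwartz_cmeas sG).
(* Any admissible orders give integrability against Schwartz functions; s = t = 1 is taken. *)
have s1 : 2^-1 < 1 :> R by rewrite invf_lt1 ?ltr1n.
have ts : - 1 <= (1 : R) <= 1 by rewrite lexx andbT (@le_trans _ _ 0)// oppr_le0.
have Moo := mconv_lty s1 ts (schwartz_cmeas sF) (schwartz_cmeas sG)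
  (wnorm2_schwartz 1 sF) (wnorm2_schwartz 1 sG).
split => // [chi schi|chi schi]; first exact: cintegrable_density mM Moo schi.
rewrite /distr_fourier /distr_of_fun mconv_fourier//.
rewrite (fourier_fubini (schwartz_cintegrable schi) (schwartzM_cintegrable sphi spsi)).
by apply: eq_cintegral => x; rewrite mulrC.
Qed.

Definition sobolev_mul (u v : functional R) : functional R :=
  distr_ifourier (distr_of_fun (mconv (fourier_density u) (fourier_density v))).

Lemma represents_eq_distr F (T T' : functional R) : eq_distr T T' ->
  represents F (distr_fourier T) -> represents F (distr_fourier T').
Proof.
move=> TT' [mF iF FT]; split => // phi sphi.
by rewrite -FT// /distr_fourier TT'//; exact: schwartz_fourier.
Qed.

Lemma mul_extension_sobolev_mul t s : 2^-1 < s -> - s <= t <= s ->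
  mul_extension t s sobolev_mul.
Proof.
move=> s2 ts; split.
- move=> u v /sobolevP[tu [mu_ _ _] uoo] /sobolevP[tv [mv _ _] voo].
  have mM := cmeas_mconv mu_ mv; have Moo := mconv_lty s2 ts mu_ mv uoo voo.
  exact: (sobolev_norm_lty (tempered_of_density mM Moo) (represents_of_density mM Moo) Moo).
- move=> phi psi sphi spsi chi schi.
  have rphi := represents_of_schwartz sphi; have rpsi := represents_of_schwartz spsi.
  have dphi := represents_fourier_density rphi; have dpsi := represents_fourier_density rpsi.
  rewrite /sobolev_mul (mconv_ae_eq _ _ _ _ (represents_ae_unique dphi rphi)
    (represents_ae_unique dpsi rpsi)); [|by case: dphi|by case: rphi|by case: dpsi|by case: rpsi].
  rewrite mconv_fourier// /distr_ifourier /distr_of_fun.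
  have si := schwartz_ifourier schi.
  under eq_cintegral do rewrite mulrC.
  rewrite fourier_fubini ?fourier_ifourier//; [exact: schwartzM_cintegrable|].
  exact: schwartz_cintegrable.
- move=> u v su sv e e0.
  have [tu du uoo] := sobolevP su; have [tv dv voo] := sobolevP sv.
  have [mdu _ _] := du; have [mdv _ _] := dv.
  have p0 : 0 < 2 * pi :> R by rewrite mulr_gt0 ?pi_gt0.
  have e'0 : 0 < 2 * pi * e ^+ 2 by rewrite mulr_gt0 ?exprn_gt0.
  have [d d0 H] := mconv_continuous s2 ts mdu mdv uoo voo e'0.
  (* A Sobolev norm below r means [wnorm2] below 2 pi r^2, so this radius corresponds to [d]. *)
  have d'0 : 0 < Num.sqrt (d / (2 * pi)) by rewrite sqrtr_gt0 divr_gt0.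
  have dE : 2 * pi * Num.sqrt (d / (2 * pi)) ^+ 2 = d.
    by rewrite sqr_sqrtr ?divr_ge0 ?ltW// mulrC divfK ?gt_eqF.
  exists (Num.sqrt (d / (2 * pi))) => // u' v' su' sv'.
  have [tu' du' u'oo] := sobolevP su'; have [tv' dv' v'oo] := sobolevP sv'.
  have [mdu' _ _] := du'; have [mdv' _ _] := dv'.
  rewrite (sobolev_norm_lt _ d'0 (tempered_sub tu' tu) (represents_sub du' du)) dE => ud.
  rewrite (sobolev_norm_lt _ d'0 (tempered_sub tv' tv) (represents_sub dv' dv)) dE => vd.
  have mM := cmeas_mconv mdu mdv; have Moo := mconv_lty s2 ts mdu mdv uoo voo.
  have mM' := cmeas_mconv mdu' mdv'; have Moo' := mconv_lty s2 ts mdu' mdv' u'oo v'oo.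
  rewrite (sobolev_norm_lt _ e0
    (tempered_sub (tempered_of_density mM' Moo') (tempered_of_density mM Moo))
    (represents_sub (represents_of_density mM' Moo') (represents_of_density mM Moo))).
  exact: H.
Qed.

Lemma wnorm2_eq0 t F : cmeas F -> wnorm2 t F = 0%E -> {ae mu, forall k, F k = 0}.
Proof.
move=> mF F0.
have := (ae_eq_integral_abs mu measurableT (measurable_wnorm2 t mF)).1.
have E : (\int[mu]_k `|(jap k `^ t * normc (F k) ^+ 2)%:E| = 0)%E.
  rewrite -F0; apply: eq_integral => k _.
  by rewrite gee0_abs// lee_fin wsqr_ge0.
move=> /(_ E); apply: ae_imp => k /(_ I) [] /eqP.
rewrite mulf_eq0 gt_eqF ?japw_gt0//= expf_eq0/= => /eqP; exact: eq0_normc.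
Qed.

(** Uniqueness of the extension. For Schwartz approximants [Phi], [Psi] of the two densities,
    [mconv Phi Psi] is close to [mconv U V] by continuity of convolution and close to the density
    [D] of [M u v] by continuity of [M]. Hence the distance from [D] to [mconv U V] is below every
    e. *)
Lemma mul_extension_represents t s M u v : 2^-1 < s -> - s <= t <= s ->
  mul_extension t s M -> sobolev t u -> sobolev s v ->
  represents (mconv (fourier_density u) (fourier_density v)) (distr_fourier (M u v)).
Proof.
move=> s2 ts [M1 M2 M3] su sv.
have [tu du uoo] := sobolevP su; have [tv dv voo] := sobolevP sv.
have [mdu _ _] := du; have [mdv _ _] := dv.
have [tM dM Moo] := sobolevP (M1 _ _ su sv); have [mdM _ _] := dM.
set U := fourier_density u in du uoo mdu *; set V := fourier_density v in dv voo mdv *.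
set D := fourier_density (M u v) in dM Moo mdM.
have mC := cmeas_mconv mdu mdv.
apply: (represents_ae_eq mC _ dM).
suff : wnorm2 t (fun k => D k - mconv U V k) = 0%E.
  move=> /(wnorm2_eq0 (cmeasB mdM mC)).
  by apply: ae_imp => k /eqP; rewrite subr_eq0 => /eqP.
apply/eqP; rewrite eq_le wnorm2_ge0 andbT; apply/lee_addgt0Pr => e e0; rewrite add0e.
have p0 : 0 < 2 * pi :> R by rewrite mulr_gt0 ?pi_gt0.
have e4 : 0 < e / 4 by rewrite divr_gt0.
have [d d0 H] := mconv_continuous s2 ts mdu mdv uoo voo e4.
have r0 : 0 < Num.sqrt (e / 4 / (2 * pi)) by rewrite sqrtr_gt0 divr_gt0.
have rE : 2 * pi * Num.sqrt (e / 4 / (2 * pi)) ^+ 2 = e / 4.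
  by rewrite sqr_sqrtr ?divr_ge0 ?ltW// mulrC divfK ?gt_eqF.
have [d' d'0 H'] := M3 _ _ su sv _ r0.
(* One precision for both continuity statements, the second translated from norms to [wnorm2]. *)
have c0 : 0 < Num.min d (2 * pi * d' ^+ 2) by rewrite lt_min d0 mulr_gt0 ?exprn_gt0.
have [Phi sPhi Pe] := schwartz_dense mdu uoo c0.
have [Psi sPsi Qe] := schwartz_dense mdv voo c0.
have sphi := schwartz_ifourier sPhi; have spsi := schwartz_ifourier sPsi.
have rphi := represents_of_schwartz sphi; have rpsi := represents_of_schwartz spsi.
have tphi := tempered_of_schwartz sphi; have tpsi := tempered_of_schwartz spsi.
have rM := represents_eq_distr (fun c sc => esym (M2 _ _ sphi spsi c sc))
  (represents_mconv_fourier sphi spsi).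
(* The approximation was made on the Fourier side; the test functions fed to [M] are the inverse
   transforms of [Phi] and [Psi]. *)
rewrite !fourier_ifourier// in rphi rpsi rM.
have su' := sobolev_norm_lty tphi rphi (wnorm2_schwartz t sPhi).
have sv' := sobolev_norm_lty tpsi rpsi (wnorm2_schwartz s sPsi).
have [Pd Pd'] : (wnorm2 t (fun k => Phi k - U k)%R < d%:E)%E /\
    (wnorm2 t (fun k => Phi k - U k)%R < (2 * pi * d' ^+ 2)%:E)%E.
  by split; apply: (lt_le_trans Pe); rewrite lee_fin ge_min lexx ?orbT.
have [Qd Qd'] : (wnorm2 s (fun k => Psi k - V k)%R < d%:E)%E /\
    (wnorm2 s (fun k => Psi k - V k)%R < (2 * pi * d' ^+ 2)%:E)%E.
  by split; apply: (lt_le_trans Qe); rewrite lee_fin ge_min lexx ?orbT.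
have := H' _ _ su' sv'.
rewrite (sobolev_norm_lt _ d'0 (tempered_sub tphi tu) (represents_sub rphi du)) => /(_ Pd').
rewrite (sobolev_norm_lt _ d'0 (tempered_sub tpsi tv) (represents_sub rpsi dv)) => /(_ Qd').
have [tM' _ _] := sobolevP (M1 _ _ su' sv').
rewrite (sobolev_norm_lt _ r0 (tempered_sub tM' tM) (represents_sub rM dM)) rE => hD.
have mPQ := cmeas_mconv (schwartz_cmeas sPhi) (schwartz_cmeas sPsi).
have hC := H _ _ (schwartz_cmeas sPhi) (schwartz_cmeas sPsi) Pd Qd.
have -> : (fun k => D k - mconv U V k) =
    (fun k => (mconv Phi Psi k - mconv U V k) - (mconv Phi Psi k - D k)).
  by apply/funext => k; ring.
apply: (le_trans (wnorm2B t (cmeasB mPQ mC) (cmeasB mPQ mdM))).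
have -> : (e%:E = 2%:E * (e / 4)%:E + 2%:E * (e / 4)%:E)%E.
  by rewrite -!EFinM -EFinD; congr EFin; field.
by apply: leeD; apply: lee_wpmul2l => //; exact: ltW.
Qed.

End sobolev_multiplication.

(** * The Hirota operator *)

Section fractional_symbol.
Context {R : realType}.
Implicit Types (F : R -> R[i]) (a k s t : R).

(** The argument of ik is pi/2 or -pi/2 since acos 0 = pi/2. At k = 0 the formula agrees with the
    convention 0^a = 0 because a > 0 makes the modulus vanish. *)
Lemma cpow_imag a k : 0 < a -> cpow (0 +i* k) a =
  (`|k| `^ a)%:C * expi (a * (if 0 <= k then pi / 2 else - (pi / 2))).
Proof.
move=> a0; rewrite /cpow; have -> : (0 +i* k == 0) = (k == 0).
  by apply/eqP/eqP => [[]//|->].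
case: eqP => [->|/eqP k0].
  by rewrite normr0 powR0 ?gt_eqF// mul0r.
by rewrite /carg normc_imag /= mul0r acos0.
Qed.

Lemma cmeas_cpow a : 0 < a -> cmeas (fun k : R => cpow (0 +i* k) a).
Proof.
move=> a0; have -> : (fun k => cpow (0 +i* k) a) = (fun k =>
    (`|k| `^ a)%:C * expi (a * (if 0 <= k then pi / 2 else - (pi / 2)))).
  by apply/funext => k; exact: cpow_imag.
apply: cmeasM.
  apply: cmeas_real; apply: (measurableT_comp (measurable_powR a)).
  exact: normr_measurable.
apply: cmeas_expi; apply: measurable_funM => //.
apply: measurable_fun_ifT => //.
exact: measurable_fun_ler.
Qed.

Lemma sqr_normc_cpow_le a k : 0 < a -> normc (cpow (0 +i* k) a) ^+ 2 <= jap k `^ a.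
Proof.
move=> a0; rewrite cpow_imag// normcM normc_expi mulr1 normc_real ger0_norm ?powR_ge0//.
rewrite expr2 -powRM// -expr2 real_normK ?num_real//.
by rewrite ge0_ler_powR ?nnegrE ?sqr_ge0 ?jap_ge0 ?ltW// /jap ltrDr.
Qed.

Lemma cpow1 k : cpow (0 +i* k) 1 = 0 +i* k.
Proof.
rewrite cpow_imag// mul1r powRr1// /expi.
case: leP => k0; first by rewrite cos_pihalf sin_pihalf ger0_norm//; apply: complex_eqP => /=; ring.
rewrite cosN sinN cos_pihalf sin_pihalf ltr0_norm//.
by apply: complex_eqP => /=; ring.
Qed.

Lemma wnorm2_cpow s a F : 0 < a -> cmeas F ->
  (wnorm2 (s - a) (fun k => cpow (0 +i* k) a * F k)%R <= wnorm2 s F)%E.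
Proof.
move=> a0 mF; apply: wnorm2_le => //; first exact: cmeasM (cmeas_cpow a0) mF.
move=> k; rewrite normcM exprMn mulrA ler_wpM2r ?sqr_ge0//.
rewrite (le_trans (ler_wpM2l (japw_ge0 _ _) (sqr_normc_cpow_le k a0)))//.
by rewrite -japwD subrK.
Qed.

Lemma wnorm2_imag s F : cmeas F -> (wnorm2 (s - 1) (fun k => (0 +i* k) * F k)%R <= wnorm2 s F)%E.
Proof.
move=> mF; have := wnorm2_cpow s (@ltr01 R) mF.
by under [X in (wnorm2 _ X <= _)%E -> _]eq_fun do rewrite cpow1.
Qed.

Lemma represents_fracD s a (T : functional R) : 0 < a -> sobolev s T ->
  sobolev (s - a) (distr_fracD a T) /\
  represents (fun k => cpow (0 +i* k) a * fourier_density T k)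
    (distr_fourier (distr_fracD a T)).
Proof.
move=> a0 /sobolevP[tT [mF _ _] Foo].
have mP := cmeasM (cmeas_cpow a0) mF.
have Poo := le_lt_trans (wnorm2_cpow s a0 mF) Foo.
have rP := represents_of_density mP Poo.
split => //; exact: (sobolev_norm_lty (tempered_of_density mP Poo) rP Poo).
Qed.

Lemma represents_distr_deriv s (T : functional R) : sobolev s T ->
  sobolev (s - 1) (distr_deriv T) /\
  represents (fun k => (0 +i* k) * fourier_density T k) (distr_fourier (distr_deriv T)).
Proof.
move=> /sobolevP[tT dT Foo]; have [mF _ _] := dT.
have rP := represents_deriv tT dT; split => //.
exact: (sobolev_norm_lty (tempered_deriv tT) rP (le_lt_trans (wnorm2_imag s mF) Foo)).
Qed.

(** For k different from 0 the modulus |k|^a is an exponential in [a], so both parts of the symbol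
    are continuous in [a] at 1. *)
Lemma cvg_cpow1 (u : nat -> R) k : (forall n, 0 < u n) -> u n @[n --> \oo] --> (1 : R) ->
  k != 0 -> normc (cpow (0 +i* k) (u n) - (0 +i* k)) @[n --> \oo] --> 0.
Proof.
move=> u0 u1 k0; pose c := if 0 <= k then pi / 2 else - (pi / 2) : R.
have kn : `|k| != 0 by rewrite normr_eq0.
pose P a := expR (a * ln `|k|).
have cP (a : R) : {for a, continuous P}.
  apply: (@is_derive_continuous _ _ _ (ln `|k| * P a)); apply: is_derive_expR_comp.
  by apply: is_derive_eq; rewrite /GRing.scale/=; ring.
have pE a : `|k| `^ a = P a by rewrite /powR (negbTE kn).
have ca (h : R -> R) : continuous h -> {for (1 : R), continuous (fun a => h (a * c))}.
  move=> ch; apply: (@continuous_comp _ _ _ (fun a => a * c) h); last exact: ch.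
  by apply: cvgM; [exact: cvg_id|exact: cvg_cst].
have E1 : 0 +i* k = (P 1 * cos (1 * c)) +i* (P 1 * sin (1 * c)).
  by rewrite -(cpow1 k) cpow_imag// pE; apply: complex_eqP => /=; rewrite -/c; ring.
have cr : P (u n) * cos (u n * c) @[n --> \oo] --> P 1 * cos (1 * c).
  apply: cvgM.
    exact: (@continuous_cvg _ _ _ _ _ _ P _ (cP 1) u1).
  exact: (@continuous_cvg _ _ _ _ _ _ (fun a => cos (a * c)) _ (ca _ (@continuous_cos R)) u1).
have ci : P (u n) * sin (u n * c) @[n --> \oo] --> P 1 * sin (1 * c).
  apply: cvgM.
    exact: (@continuous_cvg _ _ _ _ _ _ P _ (cP 1) u1).
  exact: (@continuous_cvg _ _ _ _ _ _ (fun a => sin (a * c)) _ (ca _ (@continuous_sin R)) u1).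
have z (v : nat -> R) l : v n @[n --> \oo] --> l -> `|v n - l| @[n --> \oo] --> 0.
  move=> vl; apply/norm_cvg0P; rewrite -[X in _ --> X](subrr l).
  by apply: cvgB => //; exact: cvg_cst.
have D n : cpow (0 +i* k) (u n) - (0 +i* k) =
    (P (u n) * cos (u n * c) - P 1 * cos (1 * c)) +i*
    (P (u n) * sin (u n * c) - P 1 * sin (1 * c)).
  by rewrite cpow_imag// pE -/c E1; apply: complex_eqP => /=; ring.
apply: (@squeeze_cvgr _ _ _ _ (fun=> 0) (fun n => `|P (u n) * cos (u n * c) - P 1 * cos (1 * c)| +
    `|P (u n) * sin (u n * c) - P 1 * sin (1 * c)|)).
- by apply: nearW => n; rewrite normc_ge0/= D (le_trans (ler_normc_ReIm _)).
- exact: cvg_cst.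
- by rewrite -[X in _ --> X](addr0 0); apply: cvgD; exact: z.
Qed.

Lemma wnorm2_cpow_cvg s F (u : nat -> R) : cmeas F -> (wnorm2 s F < +oo)%E ->
  (forall n, 0 < u n < 1) -> u n @[n --> \oo] --> (1 : R) ->
  forall e : R, 0 < e -> \forall n \near \oo,
    (wnorm2 (s - 1) (fun k => (cpow (0 +i* k) (u n) - (0 +i* k)) * F k)%R < e%:E)%E.
Proof.
move=> mF Foo u01 u1.
have u0 n : 0 < u n by case/andP: (u01 n).
have mk : cmeas (fun k : R => 0 +i* k) by exact: cmeas_imag.
(* For exponents at most 1 both symbols have squared modulus at most jap(k), so the squared
   difference is at most 4 jap(k) uniformly in [n]; the power of [jap] restores the order from s - 1
   to s. *)
apply: (@wnorm2_dominated_cvg _ _ _ (fun k => 4 * (jap k `^ s * normc (F k) ^+ 2))).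
- by move=> n; apply: cmeasM mF; apply: cmeasB => //; exact: cmeas_cpow.
- move=> n k; rewrite normcM exprMn [leRHS]mulrA [leLHS]mulrA; apply: ler_wpM2r; first exact: sqr_ge0.
  have j1 : normc (cpow (0 +i* k) (u n)) ^+ 2 <= jap k.
    rewrite (le_trans (sqr_normc_cpow_le k (u0 n)))//.
    rewrite -[leRHS]powRr1 ?jap_ge0// ler_powR ?jap_ge1//.
    by case/andP: (u01 n) => _ /ltW.
  have j2 : normc (0 +i* k : R[i]) ^+ 2 <= jap k.
    by rewrite normc_imag real_normK ?num_real// /jap lerDr.
  have h : normc (cpow (0 +i* k) (u n) - (0 +i* k)) ^+ 2 <= 4 * jap k.
    apply: (@le_trans _ _ ((normc (cpow (0 +i* k) (u n)) + normc (0 +i* k : R[i])) ^+ 2)).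
      by rewrite lerXn2r ?nnegrE ?addr_ge0 ?normc_ge0 ?ler_normcB.
    move: j1 j2; set x := normc _; set y := normc _ => j1 j2.
    have := sqr_ge0 (x - y); rewrite sqrrB sqrrD; lra.
  rewrite (le_trans (ler_wpM2l (japw_ge0 _ _) h))// mulrCA ler_wpM2l//.
  by rewrite -[X in _ * X <= _](powRr1 (jap_ge0 k)) -japwD subrK.
- by apply: integrable_scale; exact: integrable_wnorm2.
- apply: ae_imp (ae_neq 0) => k k0.
  have -> : (fun n => normc ((cpow (0 +i* k) (u n) - (0 +i* k)) * F k)) =
      (fun n => normc (cpow (0 +i* k) (u n) - (0 +i* k)) * normc (F k)).
    by apply/funext => n; rewrite normcM.
  rewrite -[X in _ --> X](mul0r (normc (F k))).
  by apply: cvgM; [exact: cvg_cpow1|exact: cvg_cst].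
Qed.

Lemma cintegrable_cpow_schwartz a phi : 0 < a -> a <= 1 -> schwartz phi ->
  cintegrable (fun k => cpow (0 +i* k) a * phi k).
Proof.
move=> a0 a1 sphi; have [C C0 pC] := schwartz_jap_bound 2 sphi.
apply: (cintegrable_le (g := fun k => C * (jap k)^-1)).
- exact: cmeasM (cmeas_cpow a0) (schwartz_cmeas sphi).
- move=> k; rewrite normcM -ler_pdivrMr ?invr_gt0 ?jap_gt0// invrK.
  apply: le_trans (pC k); rewrite mulrAC ler_wpM2r ?normc_ge0// expr2 ler_wpM2r ?jap_ge0//.
  rewrite -(ler_pXn2r (_ : (0 < 2)%N))// ?nnegrE ?normc_ge0 ?jap_ge0//.
  rewrite (le_trans (sqr_normc_cpow_le k a0))//.
  rewrite (@le_trans _ _ (jap k `^ 1)) ?ler_powR ?jap_ge1//.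
  by rewrite powRr1 ?jap_ge0// expr2 ler_peMl ?jap_ge0 ?jap_ge1.
- by apply: integrable_scale; exact: integrable_japV.
Qed.

Lemma fun_fracD_lin a (c : R[i]) phi psi : 0 < a -> a <= 1 -> schwartz phi -> schwartz psi ->
  fun_fracD a (fun y => c * phi y + psi y) =
  fun x => c * fun_fracD a phi x + fun_fracD a psi x.
Proof.
move=> a0 a1 sphi spsi; rewrite /fun_fracD.
rewrite (fourier_lin c (schwartz_cintegrable sphi) (schwartz_cintegrable spsi)).
rewrite -ifourier_lin; [|by apply: cintegrable_cpow_schwartz => //; exact: schwartz_fourier..].
by congr ifourier; apply/funext => k; rewrite mulrDr mulrCA.
Qed.

(** Whichever multiplication [xget] selects, [mul_extension_represents] gives the same density,
    expressed through any densities [P] and [Q] of the two derivatives. *)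
Lemma distr_hirota_density t s D f g P Q : 2^-1 < s -> - s <= t <= s ->
  sobolev s f -> sobolev s g -> sobolev t (D f) -> sobolev t (D g) ->
  represents P (distr_fourier (D f)) -> represents Q (distr_fourier (D g)) ->
  tempered (distr_hirota t s D f g) /\
  represents (fun k => mconv P (fourier_density g) k - mconv Q (fourier_density f) k)
    (distr_fourier (distr_hirota t s D f g)).
Proof.
move=> s2 ts sf sg sDf sDg rP rQ; rewrite /distr_hirota; case: xgetP => [h _|/(_ (distr_sub
  (sobolev_mul (D f) g) (sobolev_mul (D g) f)))]; last first.
  (* The default value is excluded by exhibiting convolution as an admissible multiplication. *)
  by case; exists (@sobolev_mul R) => //; exact: mul_extension_sobolev_mul.
move=> [M extM ->]; have [sM _ _] := extM.
have [tf [mf _ _] _] := sobolevP sf; have [tg [mg _ _] _] := sobolevP sg.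
have [_ dDf _] := sobolevP sDf; have [_ dDg _] := sobolevP sDg.
have ae0 F : {ae mu, forall x, F x = F x :> R[i]} by exact: aeW.
have [t1 _ _] := sobolevP (sM _ _ sDf sg); have [t2 _ _] := sobolevP (sM _ _ sDg sf).
split; first exact: tempered_sub.
rewrite -(mconv_ae_eq _ _ mg mg (represents_ae_unique dDf rP) (ae0 _));
  [|by case: dDf|by case: rP].
rewrite -(mconv_ae_eq _ _ mf mf (represents_ae_unique dDg rQ) (ae0 _));
  [|by case: dDg|by case: rQ].
by apply: represents_sub; exact: (mul_extension_represents s2 ts).
Qed.

Lemma wnorm2_hirota_le s t (P Q F G : R -> R[i]) : 2^-1 < s -> - s <= t <= s ->
  cmeas P -> cmeas Q -> cmeas F -> cmeas G ->
  (wnorm2 t (fun k => mconv P G k - mconv Q F k)%R <=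
   (2 * mconvC s)%:E * (wnorm2 t P * wnorm2 s G + wnorm2 t Q * wnorm2 s F))%E.
Proof.
move=> s2 ts mP mQ mF mG; apply: (le_trans (wnorm2B t (cmeas_mconv mP mG) (cmeas_mconv mQ mF))).
have -> : ((2 * mconvC s)%:E = 2%:E * (mconvC s)%:E)%E by rewrite EFinM.
have p0 (A B : R -> R[i]) : (0 <= wnorm2 t A * wnorm2 s B)%E by rewrite mule_ge0 ?wnorm2_ge0.
rewrite (ge0_muleDr _ (p0 P G) (p0 Q F)) -2!muleA.
by apply: leeD; apply: lee_wpmul2l => //; exact: wnorm2_mconv.
Qed.

End fractional_symbol.

(** * Norm bound and limit of the Hirota operator *)

Section hirota.
Context {R : realType}.

(** The lower bound amounts to a <= 2s, which follows from a <= 1 < 2s. *)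
Lemma sobolev_order_range (s a : R) : 2^-1 < s -> 0 < a <= 1 -> - s <= s - a <= s.
Proof. by move=> s2 /andP[a0 a1]; apply/andP; split; lra. Qed.

Lemma fun_hirota_linear (a : R) : 0 < a -> a <= 1 ->
  forall (c : R[i]) (f1 f2 g : R -> R[i]), schwartz f1 -> schwartz f2 -> schwartz g ->
  (forall x, fun_hirota a (fun y => c * f1 y + f2 y) g x =
             c * fun_hirota a f1 g x + fun_hirota a f2 g x) /\
  (forall x, fun_hirota a g (fun y => c * f1 y + f2 y) x =
             c * fun_hirota a g f1 x + fun_hirota a g f2 x).
Proof.
move=> a0 a1 c f1 f2 g s1 s2 sg; rewrite /fun_hirota fun_fracD_lin//.
by split => x; move: (fun_fracD a f1 x) (fun_fracD a f2 x) (fun_fracD a g x) => y1 y2 y; ring.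
Qed.

Lemma frac_hirota_density (s a : R) (f g : functional R) : 2^-1 < s -> 0 < a <= 1 ->
  sobolev s f -> sobolev s g ->
  tempered (frac_hirota s a f g) /\
  represents (fun k =>
    mconv (fun k => cpow (0 +i* k) a * fourier_density f k) (fourier_density g) k -
    mconv (fun k => cpow (0 +i* k) a * fourier_density g k) (fourier_density f) k)
    (distr_fourier (frac_hirota s a f g)).
Proof.
move=> s2 a01 sf sg; have a0 : 0 < a by case/andP: a01.
have [sDf rDf] := represents_fracD a0 sf; have [sDg rDg] := represents_fracD a0 sg.
exact: (distr_hirota_density s2 (sobolev_order_range s2 a01)).
Qed.

Lemma classical_hirota_density (s : R) (f g : functional R) : 2^-1 < s ->
  sobolev s f -> sobolev s g ->
  tempered (classical_hirota s f g) /\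
  represents (fun k =>
    mconv (fun k => (0 +i* k) * fourier_density f k) (fourier_density g) k -
    mconv (fun k => (0 +i* k) * fourier_density g k) (fourier_density f) k)
    (distr_fourier (classical_hirota s f g)).
Proof.
move=> s2 sf sg; have a01 : 0 < (1 : R) <= 1 by apply/andP; split.
have [sDf rDf] := represents_distr_deriv sf; have [sDg rDg] := represents_distr_deriv sg.
exact: (distr_hirota_density s2 (sobolev_order_range s2 a01)).
Qed.

(** In the factor 4, one 2 comes from splitting the squared norm of a difference and the other from
    the two terms having equal bounds. The constant depends on [s] only. *)
Lemma sobolev_norm_frac_hirota (s a : R) (f g : functional R) : 2^-1 < s -> 0 < a <= 1 ->
  sobolev s f -> sobolev s g ->
  (sobolev_norm (s - a) (frac_hirota s a f g) <=
   (Num.sqrt (2 * pi * (4 * mconvC s)))%:E * sobolev_norm s f * sobolev_norm s g)%E.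
Proof.
move=> s2 a01 sf sg; have [tH rH] := frac_hirota_density s2 a01 sf sg.
have a0 : 0 < a by case/andP: a01.
have [tf rf foo] := sobolevP sf; have [tg rg goo] := sobolevP sg.
have [mf _ _] := rf; have [mg _ _] := rg.
have K0 := mconvC_ge0 s.
apply: (sobolev_norm_le _ tH rH tf rf tg rg foo goo); first by rewrite mulr_ge0.
apply: (le_trans (wnorm2_hirota_le s2 (sobolev_order_range s2 a01) (cmeasM (cmeas_cpow a0) mf)
  (cmeasM (cmeas_cpow a0) mg) mf mg)).
apply: (@le_trans _ _ ((2 * mconvC s)%:E * (wnorm2 s (fourier_density f) * wnorm2 s (fourier_density g) +
    wnorm2 s (fourier_density g) * wnorm2 s (fourier_density f)))%E).
  apply: lee_wpmul2l; first by rewrite lee_fin mulr_ge0.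
  by apply: leeD; apply: lee_wpmul2r; rewrite ?wnorm2_ge0// wnorm2_cpow.
rewrite -(wnorm2_fineK foo) -(wnorm2_fineK goo).
move: (fine _) (fine _) (mconvC s) => x y K; rewrite -!EFinM lee_fin.
by rewrite le_eqVlt; apply/orP; left; apply/eqP; ring.
Qed.

Lemma cvge0_intro (x : nat -> \bar R) : (forall n, (0 <= x n)%E) ->
  (forall e : R, 0 < e -> \forall n \near \oo, (x n < e%:E)%E) -> x n @[n --> \oo] --> 0%E.
Proof.
move=> x0 xe.
have finx n (e : R) : (x n < e%:E)%E -> x n \is a fin_num.
  by move=> lt; rewrite ge0_fin_numE// (lt_trans lt)// ltry.
apply/fine_cvgP; split; first by apply: filterS (xe 1 ltr01) => n; exact: finx.
apply/cvgrPdist_lt => e e0; apply: filterS (xe e e0) => n lt /=.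
by rewrite sub0r normrN ger0_norm ?fine_ge0// -lte_fin fineK// (finx _ e).
Qed.

Lemma frac_hirota_cvg (s : R) (f g : functional R) (u : nat -> R) : 2^-1 < s ->
  sobolev s f -> sobolev s g -> (forall n, 0 < u n < 1) -> u n @[n --> \oo] --> (1 : R) ->
  sobolev_norm (s - 1) (distr_sub (frac_hirota s (u n) f g) (classical_hirota s f g))
    @[n --> \oo] --> 0%E.
Proof.
move=> s2 sf sg u01 u1.
have u0 n : 0 < u n by case/andP: (u01 n).
have ul n : 0 < u n <= 1 by case/andP: (u01 n) => -> /ltW.
have a1 : 0 < (1 : R) <= 1 by apply/andP; split.
have ts := sobolev_order_range s2 a1.
have [tc rc] := classical_hirota_density s2 sf sg.
have [_ [mf _ _] foo] := sobolevP sf; have [_ [mg _ _] goo] := sobolevP sg.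
set F := fourier_density f in rc mf foo *; set G := fourier_density g in rc mg goo *.
pose p n k := cpow (0 +i* k) (u n) : R[i].
have mk : cmeas (fun k : R => 0 +i* k) by exact: cmeas_imag.
have mp n : cmeas (p n) by exact: cmeas_cpow.
(* The exponent u n is below 1, so order s - u n controls order s - 1, where the limit is
   measured. *)
have le_s (n : nat) (H : R -> R[i]) : cmeas H -> (wnorm2 s H < +oo)%E ->
    (wnorm2 (s - 1) (fun k => p n k * H k)%R < +oo)%E.
  move=> mH; apply: le_lt_trans; apply: le_trans (wnorm2_cpow s (u0 n) mH).
  apply: (wnorm2_le (cmeasM (mp n) mH) (cmeasM (mp n) mH)).
  move=> k; rewrite ler_wpM2r ?sqr_ge0// ler_powR ?jap_ge1// lerD2l lerN2.
  by case/andP: (ul n).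
have le_k (H : R -> R[i]) : cmeas H -> (wnorm2 s H < +oo)%E ->
    (wnorm2 (s - 1) (fun k => (0 +i* k) * H k)%R < +oo)%E.
  by move=> mH; apply: le_lt_trans; exact: wnorm2_imag.
pose d n (H : R -> R[i]) k := p n k * H k - (0 +i* k) * H k.
have dE n H : d n H = (fun k => (p n k - (0 +i* k)) * H k).
  by apply/funext => k; rewrite /d mulrBl.
have md n H : cmeas H -> cmeas (d n H) by move=> mH; exact: (cmeasB (cmeasM (mp n) mH) (cmeasM mk mH)).
(* By bilinearity the difference of the two Hirota densities is the Hirota expression for the
   difference of symbols; it holds almost everywhere, where the convolutions converge. *)
have key n : wnorm2 (s - 1) (fun k => (mconv (fun k => p n k * F k) G k -
      mconv (fun k => p n k * G k) F k) - (mconv (fun k => (0 +i* k) * F k) G k -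
      mconv (fun k => (0 +i* k) * G k) F k))%R =
    wnorm2 (s - 1) (fun k => mconv (d n F) G k - mconv (d n G) F k)%R.
  apply: wnorm2_ae_eq.
  - exact: (cmeasB (cmeasB (cmeas_mconv (cmeasM (mp n) mf) mg) (cmeas_mconv (cmeasM (mp n) mg) mf))
      (cmeasB (cmeas_mconv (cmeasM mk mf) mg) (cmeas_mconv (cmeasM mk mg) mf))).
  - exact: (cmeasB (cmeas_mconv (md n _ mf) mg) (cmeas_mconv (md n _ mg) mf)).
  have aF := ae_mconvB s2 ts (cmeasM (mp n) mf) (cmeasM mk mf) mg (le_s n _ mf foo) (le_k _ mf foo) goo.
  have aG := ae_mconvB s2 ts (cmeasM (mp n) mg) (cmeasM mk mg) mf (le_s n _ mg goo) (le_k _ mg goo) foo.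
  by apply: ae_imp (ae_and aF aG) => k [-> ->]; move: (mconv _ _ k) (mconv _ _ k) (mconv _ _ k) (mconv _ _ k) => *; ring.
apply: cvge0_intro.
  move=> n; rewrite /sobolev_norm; case: ifP => _; last exact: leey.
  exact: poweR_ge0.
move=> e e0; have e'0 : 0 < 2 * pi * e ^+ 2 by rewrite mulr_gt0 ?exprn_gt0// mulr_gt0 ?pi_gt0.
have K0 := mconvC_ge0 s; set K := mconvC s in K0.
pose A := fine (wnorm2 s F); pose B := fine (wnorm2 s G).
have A0 : 0 <= A by exact: wnorm2_fine_ge0.
have B0 : 0 <= B by exact: wnorm2_fine_ge0.
(* The added 1 keeps the divisor positive and makes the final inequality strict. *)
pose c := 2 * K * (B + A) + 1.
have c0 : 0 < c.
  by apply: ltr_wpDl => //; apply: mulr_ge0; [exact: mulr_ge0|exact: addr_ge0].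
pose del := 2 * pi * e ^+ 2 / c; have del0 : 0 < del by rewrite divr_gt0.
have dF := wnorm2_cpow_cvg mf foo u01 u1 del0.
have dG := wnorm2_cpow_cvg mg goo u01 u1 del0.
apply: filterS2 dF dG => n dFn dGn.
have [tn rn] := frac_hirota_density s2 (ul n) sf sg.
rewrite (sobolev_norm_lt _ e0 (tempered_sub tn tc) (represents_sub rn rc)).
rewrite -/F -/G key.
apply: (le_lt_trans (wnorm2_hirota_le s2 ts (md n _ mf) (md n _ mg) mf mg)).
apply: (@le_lt_trans _ _ ((2 * K)%:E * (del%:E * B%:E + del%:E * A%:E))%E).
  apply: lee_wpmul2l; first by rewrite lee_fin mulr_ge0.
  rewrite !wnorm2_fineK//.
  by apply: leeD; apply: lee_wpmul2r; rewrite ?wnorm2_ge0// dE ltW.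
rewrite -!EFinM lte_fin -mulrDr mulrCA.
rewrite /del mulrAC ltr_pdivrMr// ltr_pM2l// /c mulrA ltrDl ltr01//.
Qed.

End hirota.

Theorem theorem4p1 (R : realType) :
  (forall a : R, 0 < a -> a <= 1 ->
    (* (i) *)
    (forall (c : R[i]) (f1 f2 g : R -> R[i]),
       schwartz f1 -> schwartz f2 -> schwartz g ->
       (forall x, fun_hirota a (fun y => c * f1 y + f2 y) g x =
                  c * fun_hirota a f1 g x + fun_hirota a f2 g x) /\
       (forall x, fun_hirota a g (fun y => c * f1 y + f2 y) x =
                  c * fun_hirota a g f1 x + fun_hirota a g f2 x)) /\
    (* (ii) *)
    (forall f g : R -> R[i], schwartz f -> schwartz g ->
       (forall x, fun_hirota a f g x = - fun_hirota a g f x) /\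
       (forall x, fun_hirota a f f x = 0)) /\
    (* (iii) *)
    (forall s : R, 2^-1 < s ->
       exists C : R, forall f g : functional R, sobolev s f -> sobolev s g ->
         (sobolev_norm (s - a) (frac_hirota s a f g) <=
          C%:E * sobolev_norm s f * sobolev_norm s g)%E)) /\
  (* (iv) *)
  (forall s : R, 2^-1 < s ->
    forall f g : functional R, sobolev s f -> sobolev s g ->
      sobolev_norm (s - 1)
        (distr_sub (frac_hirota s a f g) (classical_hirota s f g))
        @[a --> (1 : R)^'-] --> 0%E).
Proof.
split.
  move=> a a0 a1; split; [|split].
  - exact: fun_hirota_linear.
  - by move=> f g _ _; split => x; rewrite /fun_hirota; move: (fun_fracD a f x) => y;
      [move: (fun_fracD a g x) => z|]; ring.
  - move=> s s2; exists (Num.sqrt (2 * pi * (4 * mconvC s))) => f g sf sg.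
    by apply: sobolev_norm_frac_hirota => //; rewrite a0.
(* The left limit is tested along sequences below 1, since dominated convergence is sequential. *)
move=> s s2 f g sf sg; apply/cvge_at_leftP => u [u1 ucvg].
(* Such a sequence is positive only eventually, so its first [N] terms are dropped. *)
have [N _ Nu] : \forall n \near \oo, 0 < u n by exact: (cvgr_gt 1 ucvg _ ltr01).
rewrite -(cvg_shiftn N).
apply: frac_hirota_cvg => //; last by rewrite (cvg_shiftn N).
by move=> n; rewrite u1 andbT; apply: Nu => /=; exact: leq_addl.
Qed.
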